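(* Let $r>1$. For every $f\in\mathcal{O}_r$ and every $t$ with $1\le t<r$, the valency $v_f(t)$ is finite. Moreover, there is a constant $c=c(r)>0$, depending only on $r$, such that for every $f\in\mathcal{O}_r$ $$d_f(r)\le c\,v_f\!\left(\frac{1+r}{2}\right).$$
   Context: $B_c(0,s)\subset\mathbb{C}^n$ ($n\ge1$) denotes the open complex Euclidean ball of radius $s$ centered at $0$; $\mathcal{O}_r$ is the set of holomorphic functions on $B_c(0,r)$. Chebyshev degree: for $f\in\mathcal{O}_r$, $d_f(r)$ is the best constant $d$ (the infimum of all $d>0$) such that $\sup_I|f|\le\left(\frac{4|I|}{|\omega|}\right)^{d}\sup_\omega|f|$ for every real straight line $l_x\subset\mathbb{C}^n=\mathbb{R}^{2n}$ passing through a point $x\in B_c(0,1)$, every interval $I\subset l_x\cap B_c(0,1)$ and every measurable $\omega\subset I$ of positive length ($|\cdot|$ is one-dimensional Lebesgue measure). Such a finite $d$ exists for every $f\in\mathcal{O}_r$. Valency: a univariate holomorphic function on a disk is $p$-valent if it assumes no value more than $p$ times there; a constant function is said to be $0$-valent. The valency is the least such $p$ ($0$ for constants). For $t\in[1,r)$ let $L_t$ be the set of one-dimensional complex affine subspaces $l\subset\mathbb{C}^n$ with $l\cap B_c(0,t)\ne\emptyset$. The valency of $f\in\mathcal{O}_r$ in $B_c(0,t)$ is $v_f(t):=\sup_{l\in L_t}\{\text{valency of } f|_{l\cap B_c(0,t)}\}$. *)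

(* Defs.v *)
From HB Require Import structures.
From mathcomp Require Import all_boot all_order all_algebra.
From mathcomp Require Import complex.
From mathcomp Require Import all_classical all_reals all_analysis.
Import Order.TTheory GRing.Theory Num.Theory.
Import numFieldNormedType.Exports.

Set Implicit Arguments.
Unset Strict Implicit.
Unset Printing Implicit Defensive.

Local Open Scope classical_set_scope.
Local Open Scope ring_scope.

(* Stated over an abstract [K] because the library puts the norm topology on an
   abstract [numFieldType] but not on [R[i]] directly; used with [K := R[i]]. *)
Definition differentiable_on (K : numFieldType) (n : nat)
    (D : set 'rV[K]_n) (f : 'rV[K]_n -> K) : Prop :=
  forall z, D z -> differentiable (f : 'rV[K]_n -> K^o) z.

Section Defs.
Variable R : realType.

(* The [R]-valued modulus; the library's [`|z|] is [R[i]]-valued. *)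
Definition modulus (z : R[i]) : R := ComplexField.Normc.normc z.

Definition len (A : set R) : \bar R := completed_lebesgue_measure A.

(* Lebesgue measurable, i.e., Caratheodory measurable for the Lebesgue outer
   measure, not only Borel. *)
Definition lebesgue_measurable (A : set R) : Prop :=
  ((wlength (@idfun R))^*)%mu.-cara.-measurable A.

Section Space.
Variable n : nat.
Implicit Types (f : 'rV[R[i]]_n -> R[i]) (x v : 'rV[R[i]]_n).
Implicit Types (A D l : set 'rV[R[i]]_n).

(* The Euclidean norm; the library's norm on ['rV_n] is the sup norm. *)
Definition enorm x : R := Num.sqrt (\sum_(i < n) modulus (x ord0 i) ^+ 2).

Definition cball (s : R) : set 'rV[R[i]]_n := [set z | enorm z < s].

(* The values of [f] outside the ball are irrelevant. *)
Definition holomorphic_on_ball (r : R) f : Prop :=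
  differentiable_on (K := R[i]) (cball r) f.

Definition sup_abs f A : \bar R :=
  ereal_sup [set (modulus (f z))%:E | z in A].

(* If [enorm v = 1], this is an isometric parametrization of the real line
   through [x] directed by [v]: intervals, measurable subsets and lengths on
   that line are those of the corresponding sets of parameters. *)
Definition real_line x v (s : R) : 'rV[R[i]]_n := x + (s%:C)%C *: v.

(* [J] parametrizes the interval [I] and [W] the subset [omega]. *)
Definition chebyshev_bound f (d : R) : Prop :=
  forall x v : 'rV[R[i]]_n, cball 1 x -> enorm v = 1 ->
  forall J W : set R,
    is_interval J -> real_line x v @` J `<=` cball 1 ->
    W `<=` J -> lebesgue_measurable W -> (0 < len W)%E ->
    (sup_abs f (real_line x v @` J) <=
      ((4 * fine (len J) / fine (len W)) `^ d)%:E *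
        sup_abs f (real_line x v @` W))%E.

(* Equal to [+oo] if there is no admissible exponent. *)
Definition chebyshev_degree f : \bar R :=
  ereal_inf [set d%:E | d in [set d | 0 < d /\ chebyshev_bound f d]].

Definition p_valent f D (p : nat) : Prop :=
  forall w : R[i], ([set z | D z /\ f z = w] #<= `I_p)%card.

Definition constant_on f D : Prop := exists w, forall z, D z -> f z = w.

(* Equal to [+oo] if [f] is nonconstant on [D] and [p]-valent for no [p]. *)
Definition valency f D : \bar R :=
  ereal_inf [set (p%:R : R)%:E | p in
    [set p : nat | p_valent f D p \/ p = 0%N /\ constant_on f D]].

Definition complex_line l : Prop :=
  exists x v, v != 0 /\ l = [set x + a *: v | a in [set: R[i]]].

Definition ball_valency f (t : R) : \bar R :=
  ereal_sup [set valency f (l `&` cball t) | l in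
    [set l | complex_line l /\ l `&` cball t !=set0]].

End Space.
End Defs.

(* Main.v *)
Require Import Defs.
From HB Require Import structures.
From mathcomp Require Import all_boot all_order all_algebra.
From mathcomp Require Import complex.
From mathcomp Require Import all_classical all_reals all_analysis.
From mathcomp Require Import ring lra zify.
Import Order.TTheory GRing.Theory Num.Theory.
Import numFieldNormedType.Exports.
Local Open Scope classical_set_scope.
Local Open Scope ring_scope.
Set Implicit Arguments.
Unset Strict Implicit.
Unset Printing Implicit Defensive.

(** The two assertions have separate proofs, which share one-variable function
    theory in the plane: a local power series expansion (Goursat and Cauchy), and
    the factorization of a function bounded on the unit disc into a finite Blaschke
    product and a function without zeros on a smaller disc.

    The bound on the Chebyshev degree. Let [t = (1 + r) / 2], and restrict [f] to
    the complex line that contains a given real line. That complex line cuts the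
    ball of radius [t] in a disc. In the coordinate that makes it the unit disc, the
    restriction becomes a function [g] that takes each value at most [p] times, with
    [p] at most the valency, and the real segment stays at distance at most [1 / t]
    from the origin. The growth of [g] is then controlled by [p] alone
    ([valent_doubling]): if [|g| <= M] on a small disc about the origin, then
    [|g| <= M exp (A p)] on a larger one. To see this, compare [g ^+ m] with
    [K ^+ m] for a large exponent [m] and a level [K] between [2 M] and [3 M] chosen
    generically. The difference has at most [m p] zeros in the disc, all simple and
    all outside of the small disc, so dividing by their Blaschke product changes the
    value at the origin by a factor [exp (O (m p))] only; what remains has no zeros,
    and Harnack's inequality for the logarithm of its modulus carries the bound from
    the origin to the disc. The estimate for [g] is the [m]-th root of the result.
    Because of it, [g] itself has [O (p)] zeros and equals, up to a factor of
    logarithmic oscillation [O (p)], the Blaschke product of these zeros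
    ([valent_factorization]). Along a segment this product is comparable with a
    polynomial of degree [O (p)], and for polynomials the inequality is
    Lagrange interpolation at well separated points of [W] ([polynomial_remez]).
    Together this gives [valent_chebyshev]. If the valency is less than 1, then [f] is
    constant on all these lines and every positive exponent is admissible.

    Finiteness of the valency. The difficulty is a sequence of lines that converges
    to a line on which [f] is constant. Near a given base point and direction, write
    [f] on the lines as a series in the coordinate of the line whose
    coefficients [a k] are analytic functions of the base point and the direction,
    collected in a vector [lam]. The ring of convergent power series in [lam] is
    Noetherian, in the quantitative form of [division]: near the centre all [a k]
    with [k > 0] are bounded by a constant times the largest of the first [N] of them.
    If these vanish at [lam], then [f] is constant on the line; if not, dividing by the
    largest one normalizes the function, and the number of points in a small disc where
    it takes a given value is bounded independently of [lam] ([few_zeros]). A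
    compactness argument makes the size of the disc and the bound uniform, finitely
    many of these discs cover the slice of the ball by any line, and constancy on one
    of them spreads to the whole slice by the identity principle
    ([ball_valency_finite]).

    In [division], a monomial in the coordinates of [lam] is encoded by an integer
    all of whose prime factors lie in a fixed finite set of primes, one prime for each
    coordinate. The order of the integers is compatible with multiplication and
    each integer has finitely many predecessors, so that the leading term of a series is
    its term of least index, and for weights [n ^ (- e)] with [e] large it
    dominates the sum of all the others. *)

(** * Modulus, convergence and geometric series in the complex plane *)

Section Modulus.
Variable R : realType.
Local Notation C := R[i].
Implicit Types (x y z w : C) (s : R).

Lemma md0 : modulus (0 : C) = 0. Proof. exact: ComplexField.Normc.normc0. Qed.
Lemma md1 : modulus (1 : C) = 1. Proof. exact: ComplexField.Normc.normc1. Qed.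
Lemma mdM x y : modulus (x * y) = modulus x * modulus y.
Proof. exact: ComplexField.Normc.normcM. Qed.
Lemma mdV x : modulus x^-1 = (modulus x)^-1.
Proof. exact: ComplexField.Normc.normcV. Qed.
Lemma mdX x n : modulus (x ^+ n) = modulus x ^+ n.
Proof. by elim: n => [|n IH]; rewrite ?md1 // !exprS mdM IH. Qed.
Lemma mdN x : modulus (- x) = modulus x.
Proof. exact: complex.normcN. Qed.
Lemma mdD x y : modulus (x + y) <= modulus x + modulus y.
Proof. exact: complex.le_normcD. Qed.
Lemma mdB x y : modulus (x - y) <= modulus x + modulus y.
Proof. by rewrite -(mdN y) mdD. Qed.
Lemma mdC x y : modulus (x - y) = modulus (y - x).
Proof. by rewrite -mdN opprB. Qed.
Lemma md_ge0 x : 0 <= modulus x.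
Proof. by case: x => a b; rewrite /modulus /= sqrtr_ge0. Qed.
Lemma md_eq0 x : (modulus x == 0) = (x == 0).
Proof.
apply/eqP/eqP => [|->]; last exact: md0.
exact: ComplexField.Normc.eq0_normc.
Qed.
Lemma md_gt0 x : (0 < modulus x) = (x != 0).
Proof. by rewrite lt0r md_ge0 andbT md_eq0. Qed.
Lemma md_real s : modulus (s%:C)%C = `|s|.
Proof. by rewrite /modulus /= expr0n /= addr0 sqrtr_sqr. Qed.
Lemma md_sum (I : Type) (r : seq I) (P : pred I) (F : I -> C) :
  modulus (\sum_(i <- r | P i) F i) <= \sum_(i <- r | P i) modulus (F i).
Proof.
elim/big_ind2: _ => [|a b c d h1 h2|//]; first by rewrite md0.
exact: le_trans (mdD _ _) (lerD h1 h2).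
Qed.
Lemma md_dist x y : `|modulus x - modulus y| <= modulus (x - y).
Proof.
rewrite ler_norml; apply/andP; split.
  by rewrite lerNl opprB lerBlDr -{1}(subrK x y) (mdC x) mdD.
by rewrite lerBlDr -{1}(subrK y x) mdD.
Qed.
Lemma md_tri x y z : modulus (x - z) <= modulus (x - y) + modulus (y - z).
Proof. by have := mdD (x - y) (y - z); rewrite addrA subrK. Qed.
Lemma md_Re x : `|complex.Re x| <= modulus x.
Proof.
case: x => a b; rewrite /modulus /= -[`|a|]sqrtr_sqr.
by rewrite ler_wsqrtr // lerDl sqr_ge0.
Qed.
Lemma md_Im x : `|complex.Im x| <= modulus x.
Proof.
case: x => a b; rewrite /modulus /= -[`|b|]sqrtr_sqr.
by rewrite ler_wsqrtr // lerDr sqr_ge0.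
Qed.
Lemma md_le x : modulus x <= `|complex.Re x| + `|complex.Im x|.
Proof.
case: x => a b; rewrite /modulus /=.
rewrite -[leRHS]ger0_norm ?addr_ge0 // -sqrtr_sqr.
apply: ler_wsqrtr; rewrite -(real_normK (num_real a)) -(real_normK (num_real b)).
by rewrite sqrrD addrAC lerDl mulrn_wge0 // mulr_ge0.
Qed.

(** Convergence, like differentiability below, is spelled out with the real-valued
    modulus, so that every estimate is an inequality between real numbers. *)
Definition cconv (u : nat -> C) (l : C) : Prop :=
  forall e : R, 0 < e -> exists N, forall n, (N <= n)%N -> modulus (u n - l) <= e.

Lemma ccauchy (u : nat -> C) :
  (forall e : R, 0 < e -> exists N, forall m n, (N <= m)%N -> (N <= n)%N ->
     modulus (u m - u n) <= e) -> exists l, cconv u l.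
Proof.
move=> H.
have real_case (v : nat -> R) : (forall e : R, 0 < e -> exists N, forall m n,
    (N <= m)%N -> (N <= n)%N -> `|v m - v n| <= e) -> exists l, forall e, 0 < e ->
    exists N, forall n, (N <= n)%N -> `|v n - l| <= e.
  move=> Hv.
  have cv : cvgn v.
    apply/cauchy_cvgP; apply: cauchy_exP => e e0.
    have [N HN] := Hv (e / 2) ltac:(lra).
    exists (v N); exists N => // n /= Nn.
    rewrite /ball_ /=; apply: le_lt_trans (HN _ _ (leqnn N) Nn) _; lra.
  exists (limn v) => e e0.
  move/cvgrPdist_le : cv => /(_ e e0) [N _ HN].
  by exists N => n Nn; rewrite distrC; apply: HN.
have [a Ha] : exists l, forall e, 0 < e ->
    exists N, forall n, (N <= n)%N -> `|complex.Re (u n) - l| <= e.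
  apply: real_case => e e0; have [N HN] := H e e0; exists N => m n Nm Nn.
  apply: le_trans (HN m n Nm Nn); apply: le_trans (md_Re _).
  by case: (u m) => ? ?; case: (u n).
have [b Hb] : exists l, forall e, 0 < e ->
    exists N, forall n, (N <= n)%N -> `|complex.Im (u n) - l| <= e.
  apply: real_case => e e0; have [N HN] := H e e0; exists N => m n Nm Nn.
  apply: le_trans (HN m n Nm Nn); apply: le_trans (md_Im _).
  by case: (u m) => ? ?; case: (u n).
exists (a +i* b)%C => e e0.
have [N1 H1] := Ha (e / 2) ltac:(lra); have [N2 H2] := Hb (e / 2) ltac:(lra).
exists (maxn N1 N2) => n; rewrite geq_max => /andP[n1 n2].
apply: le_trans (md_le _) _.
move: (H1 n n1) (H2 n n2); case: (u n) => x y /= h1 h2; lra.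
Qed.

Lemma cconv_unique (u : nat -> C) l l' : cconv u l -> cconv u l' -> l = l'.
Proof.
move=> h h'; apply/eqP; rewrite -subr_eq0 -md_eq0 eq_le md_ge0 andbT.
apply/ler_addgt0Pr => e e0; rewrite add0r.
have [N1 H1] := h (e / 2) ltac:(lra); have [N2 H2] := h' (e / 2) ltac:(lra).
have := H1 _ (leq_maxl N1 N2); have := H2 _ (leq_maxr N1 N2).
have := md_tri l (u (maxn N1 N2)) l'; rewrite (mdC l (u _)); lra.
Qed.

Lemma geo_small (q e : R) : 0 <= q < 1 -> 0 < e -> exists N, forall n, (N <= n)%N -> q ^+ n <= e.
Proof.
move=> /andP[q0 q1] e0.
have /cvgrPdist_le/(_ e e0)[N _ HN] := @cvg_expr R q ltac:(by rewrite ger0_norm).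
exists N => n Nn; have := HN n Nn.
by rewrite sub0r normrN ger0_norm // exprn_ge0.
Qed.

Lemma geo_partial (q : R) m n : 0 <= q < 1 -> (m <= n)%N ->
  \sum_(m <= k < n) q ^+ k <= q ^+ m / (1 - q).
Proof.
move=> /andP[q0 q1] mn; have q1' : 0 < 1 - q by lra.
rewrite ler_pdivlMr //.
have -> : (\sum_(m <= k < n) q ^+ k) * (1 - q) = q ^+ m - q ^+ n.
  rewrite mulr_suml (eq_bigr (fun k => - (q ^+ k.+1 - q ^+ k))) => [|k _].
    by rewrite sumrN telescope_sumr // opprB.
  by rewrite exprS; ring.
by rewrite gerBl exprn_ge0.
Qed.

Lemma sum_nat_sub (V : zmodType) (u : nat -> V) m n : (m <= n)%N ->
  \sum_(k < n) u k - \sum_(k < m) u k = \sum_(m <= k < n) u k.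
Proof.
move=> mn; rewrite -!(big_mkord xpredT u) (big_cat_nat (leq0n m) mn) /=.
by rewrite addrAC subrr add0r.
Qed.

(** Geometric domination gives the limit of a series together with an explicit bound
    for each of its tails. *)
Lemma geo_sum (u : nat -> C) (M q : R) : 0 <= q < 1 -> 0 <= M ->
  (forall k, modulus (u k) <= M * q ^+ k) ->
  exists l, forall n, modulus (l - \sum_(k < n) u k) <= M * (q ^+ n / (1 - q)).
Proof.
move=> q01 M0 Hu; have /andP[q0 q1] := q01.
have q1' : 0 < 1 - q by lra.
pose S n := \sum_(k < n) u k.
have HS m n : (m <= n)%N -> modulus (S n - S m) <= M * (q ^+ m / (1 - q)).
  move=> mn; rewrite /S sum_nat_sub //.
  apply: le_trans (md_sum _ _ _) _.
  apply: le_trans (ler_sum _ (fun k _ => Hu k)) _.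
  by rewrite -mulr_sumr ler_wpM2l // geo_partial.
have [l Hl] : exists l, cconv S l.
  apply: ccauchy => e e0.
  have e1 : 0 < e * (1 - q) / (M + 1).
    by rewrite divr_gt0 ?mulr_gt0 // ltr_wpDl.
  have [N HN] := geo_small q01 e1.
  have HN' n : (N <= n)%N -> M * (q ^+ n / (1 - q)) <= e.
    move=> /HN h; rewrite mulrA ler_pdivrMr //.
    apply: le_trans (_ : (M + 1) * q ^+ n <= _).
      by rewrite ler_wpM2r ?exprn_ge0 //; lra.
    apply: le_trans (ler_wpM2l _ h) _; first lra.
    by rewrite mulrC mulfVK //; lra.
  exists N => m n Nm Nn; case/orP: (leq_total m n) => mn.
    by rewrite mdC; apply: le_trans (HS _ _ mn) (HN' _ Nm).
  exact: le_trans (HS _ _ mn) (HN' _ Nn).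
exists l => n; apply/ler_addgt0Pr => e e0.
have [N HN] := Hl e e0.
have := HN _ (leq_maxl N n); have := HS _ _ (leq_maxr N n).
have := md_tri l (S (maxn N n)) (S n); rewrite (mdC l (S (maxn N n))); lra.
Qed.

End Modulus.

(** * Complex differentiability *)

Section Cderiv.
Variable R : realType.
Local Notation C := R[i].
Implicit Types (x y z w l : C) (g h : C -> C) (e d : R).

Definition cderiv g z l : Prop := forall e, 0 < e -> exists2 d, 0 < d &
  forall x, modulus (x - z) < d -> modulus (g x - g z - l * (x - z)) <= e * modulus (x - z).
Definition cdiff g z : Prop := exists l, cderiv g z l.
Definition ccont g z : Prop := forall e, 0 < e -> exists2 d, 0 < d &
  forall x, modulus (x - z) < d -> modulus (g x - g z) <= e.

Lemma ccont_local g h z d : 0 < d -> (forall x, modulus (x - z) < d -> g x = h x) ->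
  ccont g z -> ccont h z.
Proof.
move=> d0 gh cg e e0; have [d1 d10 H] := cg e e0.
exists (Num.min d d1); first by rewrite lt_min d0.
move=> x; rewrite lt_min => /andP[xd xd1].
by rewrite -gh // -gh ?subrr ?md0 //; exact: H.
Qed.

Lemma ccont_cst c z : ccont (fun=> c) z.
Proof. by move=> e e0; exists 1 => // x _; rewrite subrr md0 ltW. Qed.

Lemma ccontD g h z : ccont g z -> ccont h z -> ccont (fun x => g x + h x) z.
Proof.
move=> cg ch e e0; have e2 : 0 < e / 2 by lra.
have [d1 d10 H1] := cg _ e2; have [d2 d20 H2] := ch _ e2.
exists (Num.min d1 d2); first by rewrite lt_min d10.
move=> x; rewrite lt_min => /andP[/H1 h1 /H2 h2].
rewrite opprD addrACA; apply: le_trans (mdD _ _) _; lra.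
Qed.

Lemma ccontM g h z : ccont g z -> ccont h z -> ccont (fun x => g x * h x) z.
Proof.
move=> cg ch e e0.
have g0 := md_ge0 (g z); have h0 := md_ge0 (h z).
pose e1 := Num.min 1 (e / (modulus (g z) + modulus (h z) + 1)).
have s0 : 0 < modulus (g z) + modulus (h z) + 1 by lra.
have e10 : 0 < e1 by rewrite lt_min ltr01 divr_gt0.
have e1l : e1 <= 1 by rewrite ge_min lexx.
have e1e : e1 * (modulus (g z) + modulus (h z) + 1) <= e.
  by rewrite -ler_pdivlMr // ge_min lexx orbT.
have [d1 d10 H1] := cg _ e10; have [d2 d20 H2] := ch _ e10.
exists (Num.min d1 d2); first by rewrite lt_min d10.
move=> x; rewrite lt_min => /andP[/H1 h1 /H2 h2].
have -> : g x * h x - g z * h z = (g x - g z) * h x + g z * (h x - h z) by ring.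
apply: le_trans (mdD _ _) _; rewrite !mdM.
have hx : modulus (h x) <= modulus (h z) + 1.
  by have := mdD (h x - h z) (h z); rewrite subrK; lra.
have := ler_pM (md_ge0 _) (md_ge0 _) h1 hx.
have := ler_wpM2l g0 h2.
lra.
Qed.

Lemma ccontV g z : g z != 0 -> ccont g z -> ccont (fun x => (g x)^-1) z.
Proof.
move=> gz cg e e0; have g0 : 0 < modulus (g z) by rewrite md_gt0.
set m := modulus (g z) in g0.
pose e1 := Num.min (m / 2) (e * m ^+ 2 / 2).
have e10 : 0 < e1 by rewrite lt_min !divr_gt0 ?mulr_gt0 ?exprn_gt0.
have [d1 d10 H1] := cg _ e10.
exists d1 => // x /H1 h1.
have h2 : modulus (g x - g z) <= m / 2 by apply: le_trans h1 _; rewrite ge_min lexx.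
have h3 : modulus (g x - g z) <= e * m ^+ 2 / 2.
  by apply: le_trans h1 _; rewrite ge_min lexx orbT.
have gxm : m / 2 <= modulus (g x).
  have := mdD (g z - g x) (g x); rewrite subrK mdC -/m; lra.
have gx : g x != 0 by rewrite -md_gt0; lra.
have -> : (g x)^-1 - (g z)^-1 = (g z - g x) / (g x * g z) by field; rewrite gx gz.
rewrite mdM mdV mdM mdC ler_pdivrMr ?mulr_gt0 ?md_gt0 //.
apply: le_trans h3 _; rewrite -/m -mulrA ler_wpM2l ?(ltW e0) //.
rewrite expr2 mulrAC ler_pM2r //; lra.
Qed.

(** Caratheodory's form of differentiability: the difference quotient extends
    continuously to [z]. The rules for products and inverses become those for
    continuous functions. *)
Lemma cderivP g z l : cderiv g z l <->
  exists q, [/\ forall x, g x - g z = (x - z) * q x, q z = l & ccont q z].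
Proof.
split=> [H|[q [gq qz cq]] e e0].
  exists (fun x => if x == z then l else (g x - g z) / (x - z)); split.
  - move=> x; case: eqVneq => [->|xz]; first by rewrite !subrr mul0r.
    by rewrite mulrC divfK // subr_eq0.
  - by rewrite eqxx.
  move=> e e0; have [d d0 Hd] := H e e0; exists d => // x xd.
  rewrite eqxx; case: eqVneq => [_|xz]; first by rewrite subrr md0 ltW.
  have xz0 : x - z != 0 by rewrite subr_eq0.
  have -> : (g x - g z) / (x - z) - l = (g x - g z - l * (x - z)) / (x - z) by field.
  by rewrite mdM mdV ler_pdivrMr ?md_gt0 //; exact: Hd.
have [d d0 Hd] := cq e e0; exists d => // x /Hd h.
by rewrite gq -qz [X in X - _]mulrC -mulrBl mdM ler_wpM2r ?md_ge0.
Qed.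

Lemma cderiv_local g h z l d : 0 < d -> (forall x, modulus (x - z) < d -> g x = h x) ->
  cderiv g z l -> cderiv h z l.
Proof.
move=> d0 gh cg e e0; have [d1 d10 H] := cg e e0.
exists (Num.min d d1); first by rewrite lt_min d0.
move=> x; rewrite lt_min => /andP[xd xd1].
by rewrite -gh // -gh ?subrr ?md0 //; exact: H.
Qed.

Lemma cderiv_ext g h z l : g =1 h -> cderiv g z l -> cderiv h z l.
Proof. by move=> gh; apply: (@cderiv_local _ _ _ _ 1). Qed.

Lemma cderiv_cont g z l : cderiv g z l -> ccont g z.
Proof.
move=> /cderivP[q [gq _ cq]].
apply: (@ccont_local (fun x => g z + (x - z) * q x) _ _ 1) => //.
  by move=> x _; rewrite -gq addrC subrK.
apply: ccontD; first exact: ccont_cst.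
apply: ccontM => // e e0; exists e => // x xe.
by rewrite subrr subr0 ltW.
Qed.

Lemma cderiv_cst c z : cderiv (fun=> c) z 0.
Proof. by move=> e e0; exists 1 => // x _; rewrite subrr mul0r subr0 md0 mulr_ge0 ?md_ge0 ?ltW. Qed.

Lemma cderiv_id z : cderiv id z 1.
Proof. by move=> e e0; exists 1 => // x _; rewrite mul1r /= subrr md0 mulr_ge0 ?md_ge0 ?ltW. Qed.

Lemma cderivD g h z l l' : cderiv g z l -> cderiv h z l' ->
  cderiv (fun x => g x + h x) z (l + l').
Proof.
move=> /cderivP[q [gq ql cq]] /cderivP[r [hr rl cr]]; apply/cderivP.
exists (fun x => q x + r x); split; [|by rewrite ql rl|exact: ccontD].
by move=> x; rewrite opprD addrACA gq hr mulrDr.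
Qed.

Lemma cderivM g h z l l' : cderiv g z l -> cderiv h z l' ->
  cderiv (fun x => g x * h x) z (l * h z + g z * l').
Proof.
move=> dg dh; have ch := cderiv_cont dh.
move: dg dh => /cderivP[q [gq ql cq]] /cderivP[r [hr rl cr]]; apply/cderivP.
exists (fun x => q x * h x + g z * r x); split; [|by rewrite ql rl|].
  move=> x; have := gq x; have := hr x => h1 h2.
  have -> : g x * h x - g z * h z = (g x - g z) * h x + g z * (h x - h z) by ring.
  by rewrite h1 h2; ring.
by apply: ccontD; apply: ccontM => //; exact: ccont_cst.
Qed.

Lemma cderivV g z l : g z != 0 -> cderiv g z l ->
  cderiv (fun x => (g x)^-1) z (- l / (g z) ^+ 2).
Proof.
move=> gz dg; have cg := cderiv_cont dg.
have [d d0 Hd] := cg (modulus (g z) / 2) ltac:(by rewrite divr_gt0 // md_gt0).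
have nz x : modulus (x - z) < d -> g x != 0.
  move=> /Hd h; rewrite -md_gt0.
  have := mdD (g z - g x) (g x); rewrite subrK mdC.
  have : 0 < modulus (g z) by rewrite md_gt0.
  lra.
move: dg => /cderivP[q [gq ql cq]].
pose h x := if modulus (x - z) < d then (g x)^-1 else (g z)^-1 - (x - z) * q x / (g x * g z).
apply: (@cderiv_local h _ _ _ d) => //; first by move=> x xd; rewrite /h xd.
apply/cderivP; exists (fun x => - q x * ((g x)^-1 * (g z)^-1)); split.
- move=> x; rewrite /h subrr md0 d0; case: ifP => xd.
    have -> : (g x)^-1 - (g z)^-1 = - (g x - g z) * ((g x)^-1 * (g z)^-1).
      by field; rewrite gz nz.
    by rewrite gq; ring.
  by rewrite invfM; ring.
- by rewrite ql -invfM expr2.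
apply: ccontM.
  have := @ccontM (fun=> -1) q z (ccont_cst _ _) cq.
  by apply: (ccont_local ltr01) => x _; rewrite mulN1r.
by apply: ccontM; [exact: ccontV|exact: ccont_cst].
Qed.

Lemma cderiv_affine g a b z l : cderiv g (a * z + b) l ->
  cderiv (fun x => g (a * x + b)) z (l * a).
Proof.
move=> H e e0; have e1 : 0 < e / (modulus a + 1).
  by rewrite divr_gt0 // ltr_wpDl ?md_ge0.
have [d d0 Hd] := H _ e1.
exists (d / (modulus a + 1)); first by rewrite divr_gt0 // ltr_wpDl ?md_ge0.
move=> x; have a0 := md_ge0 a; have a1 : 0 < modulus a + 1 by lra.
rewrite ltr_pdivlMr // => xd.
have E : a * x + b - (a * z + b) = a * (x - z) by ring.
have := Hd (a * x + b); rewrite E mdM mulrA => Hd'.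
have x0 := md_ge0 (x - z).
apply: le_trans (Hd' _) _; first by nra.
rewrite mulrA ler_wpM2r // mulrAC ler_pdivrMr //; nra.
Qed.

Lemma cderiv_unique g z l l' : cderiv g z l -> cderiv g z l' -> l = l'.
Proof.
move=> H H'; apply/eqP; rewrite -subr_eq0 -md_eq0 eq_le md_ge0 andbT.
apply/ler_addgt0Pr => e e0; rewrite add0r.
have e2 : 0 < e / 2 by lra.
have [d d0 Hd] := H _ e2; have [d' d'0 Hd'] := H' _ e2.
pose t := Num.min d d' / 2.
have t0 : 0 < t by rewrite divr_gt0 // lt_min d0.
have td : t < d by rewrite ltr_pdivrMr // gt_min; apply/orP; left; lra.
have td' : t < d' by rewrite ltr_pdivrMr // gt_min; apply/orP; right; lra.
have E : modulus (z + (t%:C)%C - z) = t by rewrite addrC addKr md_real gtr0_norm.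
have := Hd (z + (t%:C)%C); have := Hd' (z + (t%:C)%C); rewrite E => /(_ td') h1 /(_ td) h2.
have : modulus ((l - l') * (z + (t%:C)%C - z)) <= e * t.
  have -> : (l - l') * (z + (t%:C)%C - z) =
    (g (z + (t%:C)%C) - g z - l' * (z + (t%:C)%C - z)) -
    (g (z + (t%:C)%C) - g z - l * (z + (t%:C)%C - z)) by ring.
  apply: le_trans (mdB _ _) _; lra.
by rewrite mdM E ler_pM2r.
Qed.

Lemma cderivX g z l m : cderiv g z l -> cderiv (fun x => g x ^+ m) z (m%:R * (g z) ^+ m.-1 * l).
Proof.
move=> H; elim: m => [|m IH]; first by rewrite !mul0r; exact: cderiv_cst.
have := cderivM H IH; rewrite -/(cderiv _ _ _).
have -> : l * g z ^+ m + g z * (m%:R * g z ^+ m.-1 * l) = m.+1%:R * g z ^+ m.+1.-1 * l.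
  by case: m {IH} => [|m] /=; rewrite ?exprS; ring.
by apply: cderiv_ext => x; rewrite exprS.
Qed.

Lemma cdiffD g h z : cdiff g z -> cdiff h z -> cdiff (fun x => g x + h x) z.
Proof. by move=> [l gl] [l' hl]; exists (l + l'); exact: cderivD. Qed.
Lemma cdiffM g h z : cdiff g z -> cdiff h z -> cdiff (fun x => g x * h x) z.
Proof. by move=> [l gl] [l' hl]; exists (l * h z + g z * l'); exact: cderivM. Qed.
Lemma cdiffV g z : g z != 0 -> cdiff g z -> cdiff (fun x => (g x)^-1) z.
Proof. by move=> gz [l gl]; exists (- l / (g z) ^+ 2); exact: cderivV. Qed.
Lemma cdiff_cst c z : cdiff (fun=> c) z.
Proof. by exists 0; exact: cderiv_cst. Qed.
Lemma cdiff_id z : cdiff id z.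
Proof. by exists 1; exact: cderiv_id. Qed.
Lemma cdiffX g z m : cdiff g z -> cdiff (fun x => g x ^+ m) z.
Proof. by move=> [l gl]; exists (m%:R * (g z) ^+ m.-1 * l); exact: cderivX. Qed.
Lemma cdiff_affine g a b z : cdiff g (a * z + b) -> cdiff (fun x => g (a * x + b)) z.
Proof. by move=> [l gl]; exists (l * a); exact: cderiv_affine. Qed.
Lemma cdiff_local g h z d : 0 < d -> (forall x, modulus (x - z) < d -> g x = h x) ->
  cdiff g z -> cdiff h z.
Proof. by move=> d0 gh [l gl]; exists l; exact: cderiv_local gh gl. Qed.
Lemma cdiff_cont g z : cdiff g z -> ccont g z.
Proof. by move=> [l]; exact: cderiv_cont. Qed.

End Cderiv.

(** * Bisection and curves in the plane *)

Section Bisection.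
Variable R : realType.
Implicit Types a b c d e x y : R.

(** If the rectangle were bad, so would be one of its quarters, and so on; the bad
    rectangles, all similar to the first one, would shrink to a point, against the
    local hypothesis. The mean value inequality, Goursat's theorem and the compactness
    of a disc are all instances. *)
Lemma bisection (Q : R -> R -> R -> R -> Prop) a b c d : a < b -> c < d ->
  (forall a b c d, a < b -> c < d ->
     let m := (a + b) / 2 in let n := (c + d) / 2 in
     Q a m c n -> Q m b c n -> Q a m n d -> Q m b n d -> Q a b c d) ->
  (forall x y, a <= x <= b -> c <= y <= d -> exists2 e, 0 < e &
     forall a' b' c' d', a <= a' <= x -> x <= b' <= b -> c <= c' <= y -> y <= d' <= d ->
       a' < b' -> c' < d' -> b' - a' < e -> d' - c' < e ->
       (b' - a') * (d - c) = (d' - c') * (b - a) -> Q a' b' c' d') ->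
  Q a b c d.
Proof.
move=> ab cd split_Q local_Q; apply: contrapT => nQ.
pose T := ((R * R) * (R * R))%type.
pose bad (s : T) := [/\ s.1.1 < s.1.2, s.2.1 < s.2.2 & ~ Q s.1.1 s.1.2 s.2.1 s.2.2].
pose child (s t : T) := [/\ s.1.1 <= t.1.1 /\ t.1.2 <= s.1.2,
  s.2.1 <= t.2.1 /\ t.2.2 <= s.2.2,
  t.1.2 - t.1.1 = (s.1.2 - s.1.1) / 2 & t.2.2 - t.2.1 = (s.2.2 - s.2.1) / 2].
have [f Hf] : exists f : T -> T, forall s, bad s -> bad (f s) /\ child s (f s).
  suff: forall s, exists t, bad s -> bad t /\ child s t by move=> /choice[f Hf]; exists f.
  move=> [[a0 b0] [c0 d0]]; rewrite /bad /child /=.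
  case: (pselect (a0 < b0 /\ c0 < d0)) => [[h1 h2]|h]; last first.
    by exists ((a0, b0), (c0, d0)) => -[? ? ?]; case: h.
  have := @split_Q a0 b0 c0 d0 h1 h2 => /=.
  set m := (a0 + b0) / 2; set n := (c0 + d0) / 2.
  have [hm1 hm2 hn1 hn2] : [/\ a0 < m, m < b0, c0 < n & n < d0].
    by split; rewrite /m /n; lra.
  have [e1 e2 e3 e4] : [/\ m - a0 = (b0 - a0) / 2, b0 - m = (b0 - a0) / 2,
    n - c0 = (d0 - c0) / 2 & d0 - n = (d0 - c0) / 2] by split; rewrite /m /n; field.
  move=> HQ.
  case: (pselect (Q a0 m c0 n)) => q1; last first.
    exists ((a0, m), (c0, n)) => /= _; split; split=> //; try split; lra.
  case: (pselect (Q m b0 c0 n)) => q2; last first.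
    exists ((m, b0), (c0, n)) => /= _; split; split=> //; try split; lra.
  case: (pselect (Q a0 m n d0)) => q3; last first.
    exists ((a0, m), (n, d0)) => /= _; split; split=> //; try split; lra.
  case: (pselect (Q m b0 n d0)) => q4; last first.
    exists ((m, b0), (n, d0)) => /= _; split; split=> //; try split; lra.
  by exists ((a0, b0), (c0, d0)) => -[_ _ q]; case: q; apply: HQ.
pose r k := iter k f ((a, b), (c, d)).
have rbad k : bad (r k).
  by elim: k => [|k IH] //=; have [] := Hf _ IH.
have rch k : child (r k) (r k.+1) by have [] := Hf _ (rbad k).
have mono k j : [/\ (r k).1.1 <= (r (k + j)%N).1.1, (r (k + j)%N).1.2 <= (r k).1.2,
   (r k).2.1 <= (r (k + j)%N).2.1 & (r (k + j)%N).2.2 <= (r k).2.2].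
  elim: j => [|j [h1 h2 h3 h4]]; first by rewrite addn0.
  have [[g1 g2] [g3 g4] _ _] := rch (k + j)%N; rewrite addnS; split; lra.
have len1 k : (r k).1.2 - (r k).1.1 = (b - a) / 2 ^+ k.
  elim: k => [|k IH]; first by rewrite expr0 divr1.
  by have [_ _ -> _] := rch k; rewrite IH exprS invfM mulrA mulrAC.
have len2 k : (r k).2.2 - (r k).2.1 = (d - c) / 2 ^+ k.
  elim: k => [|k IH]; first by rewrite expr0 divr1.
  by have [_ _ _ ->] := rch k; rewrite IH exprS invfM mulrA mulrAC.
have cross k j : (r k).1.1 <= (r j).1.2 /\ (r k).2.1 <= (r j).2.2.
  have [h1 h2 _] := rbad (maxn k j).
  have [g1 _ g3 _] := mono k (maxn k j - k)%N.
  have [_ g2 _ g4] := mono j (maxn k j - j)%N.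
  move: g1 g2 g3 g4; rewrite !subnKC ?leq_maxl ?leq_maxr // => *; split; lra.
have [x Hx] : exists x, forall k, (r k).1.1 <= x <= (r k).1.2.
  exists (sup [set (r k).1.1 | k in setT]) => k; apply/andP; split.
    apply: ub_le_sup; last by exists k.
    by exists (r 0%N).1.2 => _ [j _ <-]; have [] := cross j 0%N.
  apply: ge_sup; first by exists (r 0%N).1.1, 0%N.
  by move=> _ [j _ <-]; have [] := cross j k.
have [y Hy] : exists y, forall k, (r k).2.1 <= y <= (r k).2.2.
  exists (sup [set (r k).2.1 | k in setT]) => k; apply/andP; split.
    apply: ub_le_sup; last by exists k.
    by exists (r 0%N).2.2 => _ [j _ <-]; have [] := cross j 0%N.
  apply: ge_sup; first by exists (r 0%N).2.1, 0%N.
  by move=> _ [j _ <-]; have [] := cross j k.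
have [e e0 He] := local_Q x y (Hx 0%N) (Hy 0%N).
have [k Hk] : exists k, (b - a) / 2 ^+ k < e /\ (d - c) / 2 ^+ k < e.
  have s0 : 0 < (b - a) + (d - c) by lra.
  have [N HN] := @geo_small R (2^-1) (e / 2 / ((b - a) + (d - c))) ltac:(lra)
    ltac:(by rewrite !divr_gt0).
  have := HN N (leqnn N); rewrite exprVn ler_pdivlMr // => h.
  have t0 : 0 < (2 ^+ N)^-1 :> R by rewrite invr_gt0 exprn_gt0.
  exists N; split; nra.
have [h1 h2 nQk] := rbad k; apply: nQk; have [k1 k2] := Hk.
have [m1 m2 m3 m4] := mono 0%N k; rewrite add0n /= in m1 m2 m3 m4.
have /andP[x1 x2] := Hx k; have /andP[y1 y2] := Hy k.
by apply: He => //; rewrite ?len1 ?len2 ?m1 ?m2 ?m3 ?m4 ?x2 ?y2 //; ring.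
Qed.

End Bisection.

Section Curves.
Variable R : realType.
Local Notation C := R[i].
Implicit Types (a b e d t s : R) (u P : R -> C).

Definition rderiv P t (l : C) : Prop := forall e, 0 < e -> exists2 d, 0 < d &
  forall s, `|s - t| < d -> modulus (P s - P t - ((s - t)%:C)%C * l) <= e * `|s - t|.
Definition rcont u t : Prop := forall e, 0 < e -> exists2 d, 0 < d &
  forall s, `|s - t| < d -> modulus (u s - u t) <= e.

Lemma rderivB P Q t l l' : rderiv P t l -> rderiv Q t l' ->
  rderiv (fun s => P s - Q s) t (l - l').
Proof.
move=> HP HQ e e0; have e2 : 0 < e / 2 by lra.
have [d1 d10 H1] := HP _ e2; have [d2 d20 H2] := HQ _ e2.
exists (Num.min d1 d2); first by rewrite lt_min d10.
move=> s; rewrite lt_min => /andP[/H1 h1 /H2 h2].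
have -> : P s - Q s - (P t - Q t) - ((s - t)%:C)%C * (l - l') =
  (P s - P t - ((s - t)%:C)%C * l) - (Q s - Q t - ((s - t)%:C)%C * l') by ring.
by apply: le_trans (mdB _ _) _; lra.
Qed.

(** Bisection of the interval: near each parameter the difference quotient of [P] is
    at most [M + K], for an arbitrarily small [K]. *)
Lemma rderiv_mean P (u : R -> C) a b (M : R) : a <= b ->
  (forall t, a <= t <= b -> rderiv P t (u t)) ->
  (forall t, a <= t <= b -> modulus (u t) <= M) ->
  modulus (P b - P a) <= M * (b - a).
Proof.
rewrite le_eqVlt => /predU1P[<-|ab] dP uM.
  by rewrite !subrr md0 mulr0.
apply/ler_addgt0Pr => e e0.
have e1 : 0 < e / (b - a) by rewrite divr_gt0 // subr_gt0.
set K := e / (b - a).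
suff : modulus (P b - P a) <= (M + K) * (b - a).
  by rewrite mulrDl /K mulfVK // subr_eq0 gt_eqF.
pose Q (x y _ _ : R) := modulus (P y - P x) <= (M + K) * (y - x).
apply: (@bisection R Q a b 0 1) => //.
  move=> x y c d xy cd m n h1 h2 _ _; rewrite /Q.
  have := md_tri (P y) (P m) (P x); move: h1 h2; rewrite /Q; lra.
move=> x y xab _; have [d d0 Hd] := dP x xab _ e1.
exists d => // a' b' c' d' /andP[aa' a'x] /andP[xb' b'b] _ _ ab' _ dd _ _; rewrite /Q.
have na : `|a' - x| = x - a' by rewrite distrC ger0_norm // subr_ge0.
have nb : `|b' - x| = b' - x by rewrite ger0_norm // subr_ge0.
have h1 := Hd a' ltac:(by rewrite na; lra).
have h2 := Hd b' ltac:(by rewrite nb; lra).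
have -> : P b' - P a' = (P b' - P x - ((b' - x)%:C)%C * u x) -
  (P a' - P x - ((a' - x)%:C)%C * u x) + ((b' - a')%:C)%C * u x.
  by rewrite !rmorphB /=; ring.
have ba : 0 <= b' - a' by lra.
apply: le_trans (mdD _ _) _; rewrite mdM md_real (ger0_norm ba).
have := mdB (P b' - P x - ((b' - x)%:C)%C * u x) (P a' - P x - ((a' - x)%:C)%C * u x).
rewrite na in h1; rewrite nb in h2.
have := ler_wpM2l ba (uM x xab).
rewrite -/K in h1 h2; lra.
Qed.

Lemma rderiv_local P (u : R -> C) t l d : 0 < d ->
  (forall s, `|s - t| < d -> P s = u s) -> rderiv P t l -> rderiv u t l.
Proof.
move=> d0 gh cg e e0; have [d1 d10 H] := cg e e0.
exists (Num.min d d1); first by rewrite lt_min d0.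
move=> x; rewrite lt_min => /andP[xd xd1].
by rewrite -gh // -gh ?subrr ?normr0 //; exact: H.
Qed.

Lemma rderiv_of_real (F : R -> R) t (l : R) : derivable F t 1 -> derive1 F t = l ->
  forall e, 0 < e -> exists2 d, 0 < d &
    forall s, `|s - t| < d -> `|F s - F t - (s - t) * l| <= e * `|s - t|.
Proof.
move=> dF <- e e0.
have /cvgrPdist_le/(_ e e0) := dF.
move=> [d d0 Hd]; exists d => // s st.
have [->|ns] := eqVneq s t; first by rewrite !subrr mul0r subrr normr0 mulr0.
have st0 : s - t != 0 by rewrite subr_eq0.
have := Hd (s - t); rewrite /ball /= sub0r normrN => /(_ st st0).
rewrite /shift /= scaler1 subrK -/('D_1 F t) -derive1E.
rewrite -(ler_pM2r (x := `|s - t|)) ?normr_gt0 // -normrM mulrBl distrC.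
by rewrite [_ *: _]mulrC mulfVK // mulrC.
Qed.

Lemma rprimitive (u : R -> C) a b : a <= b -> (forall t, rcont u t) ->
  exists P, forall t, a <= t <= b -> rderiv P t (u t).
Proof.
move=> ab cu.
have real_case (v : R -> R) : (forall t, {for t, continuous v}) -> exists F : R -> R,
    forall t, a <= t <= b -> derivable F t 1 /\ derive1 F t = v t.
  move=> cv; exists (fun x => (\int[lebesgue_measure]_(t in `[a - 1, x]) (v t))%R) => t /andP[at' tb].
  apply: (@continuous_FTC1_closed _ _ _ _ (b + 1)); [lra| |lra|exact: cv].
  apply: continuous_compact_integrable; first exact: segment_compact.
  by apply: continuous_subspaceT => x; exact: cv.
have [F HF] : exists F : R -> R, forall t, a <= t <= b -> derivable F t 1 /\ derive1 F t = complex.Re (u t).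
  apply: real_case => t; apply/cvgrPdist_le => e e0.
  have [d d0 Hd] := cu t e e0; exists d => // s /=; rewrite /ball_ /= distrC => /Hd h.
  rewrite distrC; apply: le_trans h; apply: le_trans (md_Re _).
  by case: (u s) => ? ?; case: (u t).
have [G HG] : exists G : R -> R, forall t, a <= t <= b -> derivable G t 1 /\ derive1 G t = complex.Im (u t).
  apply: real_case => t; apply/cvgrPdist_le => e e0.
  have [d d0 Hd] := cu t e e0; exists d => // s /=; rewrite /ball_ /= distrC => /Hd h.
  rewrite distrC; apply: le_trans h; apply: le_trans (md_Im _).
  by case: (u s) => ? ?; case: (u t).
exists (fun t => (F t +i* G t)%C) => t tab e e0.
have [dF F'] := HF t tab; have [dG G'] := HG t tab; have e2 : 0 < e / 2 by lra.
have [d1 d10 H1] := rderiv_of_real dF F' e2.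
have [d2 d20 H2] := rderiv_of_real dG G' e2.
exists (Num.min d1 d2); first by rewrite lt_min d10.
move=> s; rewrite lt_min => /andP[/H1 h1 /H2 h2].
apply: le_trans (md_le _) _; move: h1 h2.
case: (u t) => p q /=; rewrite !mul0r addr0 subr0 => h1 h2; lra.
Qed.

End Curves.

(** * Cauchy's formula and power series *)

Section CauchyFormula.
Variable R : realType.
Local Notation C := R[i].
Implicit Types (a b e d t s : R) (u P : R -> C) (z w : C).

Lemma rderiv_cont P t l : rderiv P t l -> rcont P t.
Proof.
move=> H e e0; have l0 := md_ge0 l.
have [d d0 Hd] := H 1 ltr01.
have l1 : 0 < modulus l + 1 by lra.
exists (Num.min d (e / (modulus l + 1))); first by rewrite lt_min d0 divr_gt0.
move=> s; rewrite lt_min => /andP[/Hd h]; rewrite ltr_pdivlMr // => h2.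
rewrite -[P s - P t](subrK (((s - t)%:C)%C * l)).
apply: le_trans (mdD _ _) _; rewrite mdM md_real; lra.
Qed.

Lemma rcont_comp (g : C -> C) u t : ccont g (u t) -> rcont u t -> rcont (fun s => g (u s)) t.
Proof.
move=> cg cu e e0; have [d d0 Hd] := cg e e0.
have [d' d'0 Hd'] := cu (d / 2) ltac:(lra).
exists d' => // s /Hd' h; apply: Hd; lra.
Qed.

Lemma rcontM u v t : rcont u t -> rcont v t -> rcont (fun s => u s * v s) t.
Proof.
move=> cg ch e e0.
have g0 := md_ge0 (u t); have h0 := md_ge0 (v t).
pose e1 := Num.min 1 (e / (modulus (u t) + modulus (v t) + 1)).
have s0 : 0 < modulus (u t) + modulus (v t) + 1 by lra.
have e10 : 0 < e1 by rewrite lt_min ltr01 divr_gt0.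
have e1l : e1 <= 1 by rewrite ge_min lexx.
have e1e : e1 * (modulus (u t) + modulus (v t) + 1) <= e.
  by rewrite -ler_pdivlMr // ge_min lexx orbT.
have [d1 d10 H1] := cg _ e10; have [d2 d20 H2] := ch _ e10.
exists (Num.min d1 d2); first by rewrite lt_min d10.
move=> x; rewrite lt_min => /andP[/H1 h1 /H2 h2].
have -> : u x * v x - u t * v t = (u x - u t) * v x + u t * (v x - v t) by ring.
apply: le_trans (mdD _ _) _; rewrite !mdM.
have hx : modulus (v x) <= modulus (v t) + 1.
  by have := mdD (v x - v t) (v t); rewrite subrK; lra.
have := ler_pM (md_ge0 _) (md_ge0 _) h1 hx.
have := ler_wpM2l g0 h2.
lra.
Qed.

Lemma rcont_lip u t (K : R) : (forall s, modulus (u s - u t) <= K * `|s - t|) -> rcont u t.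
Proof.
move=> H e e0; have K0 : 0 < `|K| + 1 by rewrite ltr_wpDl.
exists (e / (`|K| + 1)) => [|s]; first by rewrite divr_gt0.
rewrite ltr_pdivlMr // => h; apply: le_trans (H s) _.
have := ler_wpM2r (normr_ge0 (s - t)) (ler_norm K); have := normr_ge0 (s - t); lra.
Qed.

Lemma rderiv_chain (g : C -> C) u t l m : cderiv g (u t) l -> rderiv u t m ->
  rderiv (fun s => g (u s)) t (l * m).
Proof.
move=> dg du e e0.
have cu := rderiv_cont du.
have m0 := md_ge0 m; have l0 := md_ge0 l.
have e1 : 0 < e / 2 / (modulus m + 1) by rewrite !divr_gt0 //; lra.
have e2 : 0 < e / 2 / (modulus l + 1) by rewrite !divr_gt0 //; lra.
have [d d0 Hd] := dg _ e1.
have [d1 d10 Hd1] := cu (d / 2) ltac:(lra).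
have [d2 d20 Hd2] := du _ e2.
have [d3 d30 Hd3] := du 1 ltr01.
exists (Num.min d1 (Num.min d2 d3)); first by rewrite !lt_min d10 d20.
move=> s; rewrite !lt_min => /andP[/Hd1 h1 /andP[/Hd2 h2 /Hd3 h3]].
have -> : g (u s) - g (u t) - ((s - t)%:C)%C * (l * m) =
  (g (u s) - g (u t) - l * (u s - u t)) + l * (u s - u t - ((s - t)%:C)%C * m) by ring.
have := Hd (u s) ltac:(lra).
have hu : modulus (u s - u t) <= (modulus m + 1) * `|s - t|.
  rewrite -[u s - u t](subrK (((s - t)%:C)%C * m)).
  apply: le_trans (mdD _ _) _; rewrite mdM md_real; lra.
have := ler_wpM2l (ltW e1) hu.
rewrite mulrA divfK ?gt_eqF //; last by lra.
have := ler_wpM2l l0 h2.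
have : modulus l * (e / 2 / (modulus l + 1) * `|s - t|) <= e / 2 * `|s - t|.
  rewrite mulrA ler_wpM2r // mulrA ler_pdivrMr; [nra|lra].
move=> k1 k2 k3 k4.
apply: le_trans (mdD _ _) _; rewrite mdM; lra.
Qed.

Definition cis t : C := (cos t +i* sin t)%C.

Lemma md_cis t : modulus (cis t) = 1.
Proof. by rewrite /modulus /= cos2Dsin2 sqrtr1. Qed.

Lemma cis_neq0 t : cis t != 0.
Proof. by rewrite -md_gt0 md_cis. Qed.

Lemma rderiv_cis t : rderiv cis t ('i%C * cis t).
Proof.
move=> e e0; have e2 : 0 < e / 2 by lra.
have dc : derivable (@cos R) t 1 by exact: derivable_cos.
have ds : derivable (@sin R) t 1 by exact: derivable_sin.
have [d1 d10 H1] := rderiv_of_real dc (erefl _) e2.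
have [d2 d20 H2] := rderiv_of_real ds (erefl _) e2.
exists (Num.min d1 d2); first by rewrite lt_min d10.
move=> s; rewrite lt_min => /andP[/H1 h1 /H2 h2].
apply: le_trans (md_le _) _; move: h1 h2.
rewrite !derive1E derive_val derive_val /= => h1 h2.
by rewrite !mul0r !mul1r !add0r subr0 addr0; lra.
Qed.

Lemma cis_lip s t : modulus (cis s - cis t) <= `|s - t|.
Proof.
wlog st : s t / t <= s.
  move=> H; case: (leP t s) => [|/ltW] /H //.
  by rewrite mdC distrC.
rewrite ger0_norm ?subr_ge0 // -[leRHS]mul1r.
apply: (rderiv_mean (u := fun t => 'i%C * cis t)) => // x _.
  exact: rderiv_cis.
by rewrite mdM md_cis /modulus /= expr0n /= add0r expr1n sqrtr1 mulr1.
Qed.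

Lemma rcont_cis t : rcont cis t.
Proof. exact: rderiv_cont (rderiv_cis t). Qed.

End CauchyFormula.

Section Pre.
Variable R : realType.
Local Notation C := R[i].
Implicit Types (a b e d t s : R) (u P : R -> C) (z : C).

Lemma rderivZ P t l (x : C) : rderiv P t l -> rderiv (fun s => x * P s) t (x * l).
Proof.
move=> dP; apply: (@rderiv_chain R (fun y => x * y) P t x) => //.
move=> e e0; exists 1 => // y _; rewrite -mulrBr subrr md0 mulr_ge0 ?md_ge0 // ltW //.
Qed.

Lemma rderiv_sum (P : nat -> R -> C) t (l : nat -> C) n :
  (forall k, rderiv (P k) t (l k)) ->
  rderiv (fun s => \sum_(k < n) P k s) t (\sum_(k < n) l k).
Proof.
move=> dP; elim: n => [|n IH].
  move=> e e0; exists 1 => // s _; rewrite !big_ord0 mulr0 !subrr md0 mulr_ge0 // ltW //.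
have := rderivB IH (rderivZ (-1) (dP n)).
rewrite big_ord_recr /= mulN1r opprK.
apply: (@rderiv_local _ _ _ _ _ 1) => // s _.
by rewrite big_ord_recr /= mulN1r opprK.
Qed.

Lemma primitive_unique P Q u a b : a <= b ->
  (forall t, a <= t <= b -> rderiv P t (u t)) ->
  (forall t, a <= t <= b -> rderiv Q t (u t)) -> P b - P a = Q b - Q a.
Proof.
move=> ab dP dQ; apply/eqP; rewrite -subr_eq0 -md_eq0 eq_le md_ge0 andbT.
have -> : P b - P a - (Q b - Q a) = (P b - Q b) - (P a - Q a) by ring.
rewrite -[leRHS](mul0r (b - a)).
apply: (@rderiv_mean _ (fun t => P t - Q t) (fun t => u t - u t)) => // t tab.
  exact: rderivB (dP t tab) (dQ t tab).
by rewrite subrr md0.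
Qed.

(** The same constant [M] bounds the coefficients, in the scale given by [rho], and the
    tails of the series for [g]. *)
Definition psum (a : nat -> C) (g : C -> C) (M rho : R) : Prop :=
  (forall k, modulus (a k) * rho ^+ k <= M) /\
  (forall z, modulus z < rho -> forall n,
    modulus (g z - \sum_(k < n) a k * z ^+ k) <=
      M * ((modulus z / rho) ^+ n / (1 - modulus z / rho))).

End Pre.

Lemma dist_in_segment (R : realType) (a b s x : R) : a <= s <= b -> a <= x <= b -> `|s - x| <= b - a.
Proof. by move=> /andP[? ?] /andP[? ?]; rewrite ler_norml; apply/andP; split; lra. Qed.

Section Goursat.
Variable R : realType.
Local Notation C := R[i].
Implicit Types (a b e d t s : R) (u P : R -> C) (z : C).
Variables (g : C -> C) (rho : R) (w : C).
Hypotheses (rho0 : 0 < rho) (wr : modulus w < rho).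
Hypothesis dg : forall z, modulus z <= rho -> cdiff g z.

(** The circles [zz s] interpolate between [w] and the circle of radius [rho]; [kap] is the
    pull-back of [dz / (z - w)] to each of them, which does not depend on [s]. *)
Let c t : C := (rho%:C)%C * cis t - w.
Let kap t : C := (rho%:C)%C * ('i%C * cis t) / c t.
Let zz s t : C := w + (s%:C)%C * c t.
Let K : R := rho / (rho - modulus w).

Lemma md_rcis t : modulus ((rho%:C)%C * cis t) = rho.
Proof. by rewrite mdM md_cis md_real mulr1 gtr0_norm. Qed.

Let c_ge t : rho - modulus w <= modulus (c t).
Proof.
have := mdD (c t) w; rewrite subrK md_rcis; move: wr; lra.
Qed.

Let c_le t : modulus (c t) <= 2 * rho.
Proof. apply: le_trans (mdB _ _) _; rewrite md_rcis; move: wr; lra. Qed.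

Let c_neq0 t : c t != 0.
Proof. by rewrite -md_gt0; apply: lt_le_trans (c_ge t); rewrite subr_gt0. Qed.

Let K0 : 0 < K. Proof. by rewrite divr_gt0 // subr_gt0. Qed.

Let md_kap t : modulus (kap t) <= K.
Proof.
have -> : kap t = 'i%C * ((rho%:C)%C * cis t) / c t by rewrite /kap; ring.
rewrite mdM mdM mdV md_rcis /K.
have -> : modulus ('i%C : C) = 1 by rewrite /modulus /= expr0n /= add0r expr1n sqrtr1.
rewrite mul1r ler_pM2l // lef_pV2 ?posrE ?c_ge ?subr_gt0 //.
by rewrite md_gt0.
Qed.

Let zz_in s t : 0 <= s <= 1 -> modulus (zz s t) <= rho.
Proof.
move=> /andP[s0 s1].
have -> : zz s t = ((1 - s)%:C)%C * w + (s%:C)%C * ((rho%:C)%C * cis t).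
  by rewrite /zz /c rmorphB /= rmorph1; ring.
apply: le_trans (mdD _ _) _; rewrite mdM [X in _ + X]mdM md_rcis !md_real !ger0_norm ?subr_ge0 //.
have : 0 <= (1 - s) * (rho - modulus w) by rewrite mulr_ge0 ?subr_ge0 // ltW.
lra.
Qed.

Let c_lip t t' : modulus (c t - c t') <= rho * `|t - t'|.
Proof.
have -> : c t - c t' = (rho%:C)%C * (cis t - cis t') by rewrite /c; ring.
by rewrite mdM md_real gtr0_norm // ler_pM2l // cis_lip.
Qed.

Let rcont_c t : rcont c t. Proof. exact: rcont_lip (fun s => c_lip s t). Qed.

Let rcont_kap t : rcont kap t.
Proof.
apply: (@rcont_comp R (fun x => (rho%:C)%C * ('i%C * x) / ((rho%:C)%C * x - w)) (@cis R)).
  apply: ccontM; first by apply: cdiff_cont; apply: cdiffM; [exact: cdiff_cst|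
    apply: cdiffM; [exact: cdiff_cst|exact: cdiff_id]].
  apply: ccontV; first exact: c_neq0.
  apply: cdiff_cont; apply: cdiffD; last exact: cdiff_cst.
  by apply: cdiffM; [exact: cdiff_cst|exact: cdiff_id].
exact: rcont_cis.
Qed.

(** The parameter is clamped to the interval from [s0] to 1, on which the integrand is
    continuous, because primitives are available for functions continuous on the line. *)
Let sc (s0 s : R) : R := Num.max s0 (Num.min s 1).

Let sc_id s0 s : s0 <= s <= 1 -> sc s0 s = s.
Proof. by move=> /andP[h1 h2]; rewrite /sc (min_idPl h2) (max_idPr h1). Qed.

Let sc_in s0 s : s0 <= 1 -> s0 <= sc s0 s <= 1.
Proof. by move=> h; rewrite /sc le_max lexx /= ge_max h ge_min lexx orbT. Qed.

Let sc_lip s0 s s' : `|sc s0 s - sc s0 s'| <= `|s - s'|.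
Proof.
have h1 a x y : `|Num.max a x - Num.max a y| <= `|x - y| :> R.
  have := ler_norm (x - y); have := ler_norm (y - x); rewrite (distrC y) => p q.
  by rewrite ler_norml !maxEle; case: (leP a x) => ?; case: (leP a y) => ?; apply/andP; split; lra.
have h2 a x y : `|Num.min x a - Num.min y a| <= `|x - y| :> R.
  have := ler_norm (x - y); have := ler_norm (y - x); rewrite (distrC y) => p q.
  by rewrite ler_norml !minEle; case: (leP x a) => ?; case: (leP y a) => ?; apply/andP; split; lra.
exact: le_trans (h1 _ _ _) (h2 _ _ _).
Qed.

Let S_exists s0 t : 0 < s0 <= 1 -> exists P, forall s, s0 <= s <= 1 ->
  rderiv P s (g (zz s t) / (s%:C)%C).
Proof.
move=> /andP[s00 s01].
have [|P HP] := @rprimitive R (fun s => g (zz (sc s0 s) t) * ((sc s0 s)%:C)%C^-1) s0 1 s01.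
  move=> s; have /andP[l1 l2] := sc_in s s01.
  apply: rcontM.
    apply: (@rcont_comp R g (fun s => zz (sc s0 s) t)).
      by apply: cdiff_cont; apply: dg; apply: zz_in; rewrite l2 andbT; lra.
    apply: (@rcont_lip _ _ _ (2 * rho)) => s'.
    have -> : zz (sc s0 s') t - zz (sc s0 s) t = ((sc s0 s' - sc s0 s)%:C)%C * c t.
      by rewrite /zz rmorphB /=; ring.
    rewrite mdM md_real mulrC ler_pM ?md_ge0 ?c_le ?sc_lip //.
  apply: (@rcont_comp R (fun x => x^-1) (fun s => ((sc s0 s)%:C)%C)).
    apply: ccontV; last exact: cdiff_cont (cdiff_id _).
    by rewrite -md_gt0 md_real gtr0_norm; lra.
  apply: (@rcont_lip _ _ _ 1) => s'.
  have -> : ((sc s0 s')%:C)%C - ((sc s0 s)%:C)%C = ((sc s0 s' - sc s0 s)%:C)%C by rewrite rmorphB.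
  by rewrite md_real mul1r sc_lip.
exists P => s ss; rewrite -[in zz s t](sc_id ss) -[in X in _ / X](sc_id ss); exact: HP.
Qed.

Let T_exists s : 0 <= s <= 1 -> exists P, forall t, 0 <= t <= 2 * pi ->
  rderiv P t (g (zz s t) * kap t).
Proof.
move=> s01; have p0 : 0 <= 2 * pi :> R by rewrite mulr_ge0 ?pi_ge0.
apply: (@rprimitive R (fun t => g (zz s t) * kap t)) => // t.
apply: rcontM => //; apply: rcont_comp.
  by apply: cdiff_cont; apply: dg; exact: zz_in.
apply: (@rcont_lip _ _ _ rho) => t'.
have -> : zz s t' - zz s t = (s%:C)%C * (c t' - c t) by rewrite /zz; ring.
rewrite mdM md_real; have /andP[s0 s1] := s01; rewrite ger0_norm //.
have := c_lip t' t; have := md_ge0 (c t' - c t); nra.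
Qed.

(** Goursat's argument: pulled back to the rectangle of parameters [(s, t)], the form
    [g z * dz / (z - w)] has a boundary integral that is additive under subdivision and, on
    a small rectangle where [g] is nearly affine, small compared with the area. The
    integrals over the sides are increments of the primitives [S] and [T]. *)
Let contour_zero s0 (S T : R -> R -> C) : 0 < s0 < 1 ->
  (forall t s, s0 <= s <= 1 -> rderiv (S t) s (g (zz s t) / (s%:C)%C)) ->
  (forall s t, s0 <= s <= 1 -> 0 <= t <= 2 * pi -> rderiv (T s) t (g (zz s t) * kap t)) ->
  (S 0 1 - S 0 s0) - (S (2 * pi) 1 - S (2 * pi) s0) +
  (T 1 (2 * pi) - T 1 0) - (T s0 (2 * pi) - T s0 0) = 0.
Proof.
move=> /andP[s00 s01] dS dT.
have p0 : 0 < 2 * pi :> R by rewrite mulr_gt0 ?pi_gt0.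
pose J (a b u v : R) := (S u b - S u a) - (S v b - S v a) + (T b v - T b u) - (T a v - T a u).
rewrite -/(J s0 1 0 (2 * pi)); apply/eqP; rewrite -md_eq0 eq_le md_ge0 andbT.
apply/ler_addgt0Pr => e0 e00; rewrite add0r.
have sp : 0 < (1 - s0) * (2 * pi) by rewrite mulr_gt0 // subr_gt0.
pose e := e0 / ((1 - s0) * (2 * pi)).
have e_gt0 : 0 < e by rewrite divr_gt0.
have -> : e0 = e * ((1 - s0) * (2 * pi - 0)) by rewrite subr0 /e mulfVK // gt_eqF.
pose Q (a b u v : R) := modulus (J a b u v) <= e * ((b - a) * (v - u)).
rewrite -/(Q s0 1 0 (2 * pi)).
apply: (@bisection R Q) => // [a b u v ab uv m n|x y xs yt].
  rewrite /Q => q1 q2 q3 q4.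
  have -> : J a b u v = J a m u n + J m b u n + J a m n v + J m b n v by rewrite /J; ring.
  have -> : e * ((b - a) * (v - u)) = e * ((m - a) * (n - u)) + e * ((b - m) * (n - u))
    + e * ((m - a) * (v - n)) + e * ((b - m) * (v - n)) by ring.
  apply: le_trans (mdD _ _) (lerD _ q4).
  apply: le_trans (mdD _ _) (lerD _ q3).
  exact: le_trans (mdD _ _) (lerD q1 q2).
have x01 : 0 <= x <= 1 by case/andP: xs => *; apply/andP; split; lra.
have [l dl] := dg (zz_in y x01).
pose lam := 2 * pi / (1 - s0).
have lam0 : 0 < lam by rewrite divr_gt0 // subr_gt0.
pose A1 := 2 * rho + rho * lam.
pose A2 := s0^-1 + lam * K.
have s0V : 0 < s0^-1 by rewrite invr_gt0.
have A10 : 0 < A1 by rewrite /A1 /A2 addr_gt0 // mulr_gt0.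
have A20 : 0 < A2 by rewrite /A1 /A2 addr_gt0 // mulr_gt0.
pose e1 := e * lam / (2 * (A1 * A2)).
have e10 : 0 < e1 by apply: divr_gt0; apply: mulr_gt0 => //; apply: mulr_gt0.
have [d d0 Hd] := dl _ e10.
have As : 0 < A1 + lam + 1 by apply: addr_gt0 => //; apply: addr_gt0.
exists (d / (A1 + lam + 1)); first exact: divr_gt0.
move=> a b u v /andP[sa ax] /andP[xb b1] /andP[u0 uy] /andP[yv v2] ab uv; rewrite ?subr0.
move=> hA _ hAB.
set A := b - a in hA hAB *; have A0 : 0 < A by rewrite subr_gt0.
have inS s : a <= s <= b -> s0 <= s <= 1.
  by move=> /andP[h1 h2]; rewrite (le_trans sa h1) (le_trans h2 b1).
have inT t : u <= t <= v -> 0 <= t <= 2 * pi.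
  by move=> /andP[h1 h2]; rewrite (le_trans u0 h1) (le_trans h2 v2).
have pos s : a <= s <= b -> 0 < s.
  by move=> /inS /andP[h1 _]; apply: lt_le_trans h1.
have hB : v - u = lam * A.
  have s1n : 1 - s0 != 0 by rewrite gt_eqF // subr_gt0.
  by apply: (mulIf s1n); rewrite -hAB /lam; field.
have hAd : A1 * A < d.
  have : A * (A1 + lam + 1) < d by rewrite -ltr_pdivlMr.
  have := mulr_gt0 lam0 A0; nra.
pose h s t := g (zz s t) - g (zz x y) - l * (zz s t - zz x y).
have Hh s t : a <= s <= b -> u <= t <= v -> modulus (h s t) <= e1 * (A1 * A).
  move=> /andP[as' sb] /andP[ut tv].
  have hz : modulus (zz s t - zz x y) <= A1 * A.
    have -> : zz s t - zz x y = ((s - x)%:C)%C * c t + (x%:C)%C * (c t - c y).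
      by rewrite /zz rmorphB /=; ring.
    apply: le_trans (mdD _ _) _; rewrite !mdM !md_real.
    have k1 : `|s - x| <= A by apply: dist_in_segment; rewrite ?as' ?ax.
    have k2 : `|t - y| <= lam * A by rewrite -hB; apply: dist_in_segment; rewrite ?ut ?uy.
    have k3 : `|x| <= 1 by case/andP: x01 => x0 x1; rewrite ger0_norm.
    have k4 : modulus (c t - c y) <= rho * (lam * A).
      by apply: le_trans (c_lip t y) _; rewrite ler_pM2l.
    have := lerD (ler_pM (normr_ge0 _) (md_ge0 _) k1 (c_le t)) (ler_pM (normr_ge0 _) (md_ge0 _) k3 k4).
    move=> h0; apply: le_trans h0 _; rewrite le_eqVlt; apply/orP; left; apply/eqP.
    by rewrite /A1; ring.
  apply: le_trans (Hd _ (le_lt_trans hz hAd)) _.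
  by rewrite ler_pM2l.
(* Increments of the primitives, corrected by the exact contribution of the slope [l];
   the value of [g] at the centre cancels out. *)
pose F s := S u s - S v s - (s%:C)%C * (l * (c u - c v)).
pose G t := T b t - T a t - ((b - a)%:C)%C * l * c t.
have hF : modulus (F b - F a) <= (2 * (e1 * (A1 * A)) / s0) * (b - a).
  apply: (@rderiv_mean R F (fun s => (h s u - h s v) / (s%:C)%C)); first exact: ltW.
    move=> s sab; have sn : (s%:C)%C != 0 by rewrite -md_gt0 md_real gtr0_norm pos.
    have -> : (h s u - h s v) / (s%:C)%C =
      (g (zz s u) / (s%:C)%C - g (zz s v) / (s%:C)%C) - l * (c u - c v).
      by rewrite /h /zz; field.
    apply: rderivB; first by apply: rderivB; apply: dS; exact: inS.
    move=> e' e'0; exists 1 => // s' _.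
    have -> : (s'%:C)%C * (l * (c u - c v)) - (s%:C)%C * (l * (c u - c v)) -
      ((s' - s)%:C)%C * (l * (c u - c v)) = 0 by rewrite rmorphB /=; ring.
    by rewrite md0 mulr_ge0 // ltW.
  move=> s sab; have s_gt0 := pos s sab.
  rewrite mdM mdV md_real gtr0_norm //.
  apply: ler_pM; rewrite ?md_ge0 ?invr_ge0 ?(ltW s_gt0) //.
    apply: le_trans (mdB _ _) _; rewrite mulr_natl mulr2n.
    by apply: lerD; apply: Hh; rewrite ?sab ?lexx ?(ltW uv).
  by rewrite lef_pV2 ?posrE //; case/andP: (inS s sab).
have hG : modulus (G v - G u) <= (2 * (e1 * (A1 * A)) * K) * (v - u).
  apply: (@rderiv_mean R G (fun t => (h b t - h a t) * kap t)); first exact: ltW.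
    move=> t tuv.
    have -> : (h b t - h a t) * kap t = (g (zz b t) * kap t - g (zz a t) * kap t) -
      ((b - a)%:C)%C * l * ((rho%:C)%C * ('i%C * cis t)).
      by rewrite /h /zz /kap rmorphB /=; field; exact: c_neq0.
    apply: rderivB; first by apply: rderivB; apply: dT; rewrite ?inT // ?inS ?lexx ?(ltW ab).
    have -> : ((b - a)%:C)%C * l * ((rho%:C)%C * ('i%C * cis t)) =
      ((b - a)%:C)%C * l * (rho%:C)%C * ('i%C * cis t) by ring.
    apply: (@rderiv_chain R (fun x => ((b - a)%:C)%C * l * ((rho%:C)%C * x - w)) (@cis R) t
      (((b - a)%:C)%C * l * (rho%:C)%C)); last exact: rderiv_cis.
    move=> e' e'0; exists 1 => // x' _.
    set X := (X in modulus X); have -> : X = 0 by rewrite /X; ring.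
    by rewrite md0 mulr_ge0 ?md_ge0 // ltW.
  move=> t tuv.
  rewrite mdM; apply: ler_pM; rewrite ?md_ge0 ?md_kap //.
  apply: le_trans (mdB _ _) _; rewrite mulr_natl mulr2n.
  by apply: lerD; apply: Hh; rewrite ?tuv ?lexx ?(ltW ab).
rewrite /Q.
have -> : J a b u v = (F b - F a) + (G v - G u).
  by rewrite /J /F /G rmorphB /=; ring.
apply: le_trans (mdD _ _) _.
apply: le_trans (lerD hF hG) _.
rewrite -/A hB.
have -> : 2 * (e1 * (A1 * A)) / s0 * A + 2 * (e1 * (A1 * A)) * K * (lam * A) =
  e1 * (2 * (A1 * A2)) * (A * A) by rewrite /A2; ring.
rewrite /e1 mulfVK; first by rewrite le_eqVlt; apply/orP; left; apply/eqP; ring.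
by rewrite gt_eqF // !mulr_gt0.
Qed.

Let p0 : 0 < 2 * pi :> R. Proof. by rewrite mulr_gt0 ?pi_gt0. Qed.

(** The circle is shrunk to a neighbourhood of [w], where [g] is close to [g w] by
    continuity. *)
Lemma cauchy_formula_kap (T Kp : R -> C) :
  (forall t, 0 <= t <= 2 * pi -> rderiv T t (g ((rho%:C)%C * cis t) * kap t)) ->
  (forall t, 0 <= t <= 2 * pi -> rderiv Kp t (kap t)) ->
  T (2 * pi) - T 0 = g w * (Kp (2 * pi) - Kp 0).
Proof.
move=> dT dK; apply/eqP; rewrite -subr_eq0 -md_eq0 eq_le md_ge0 andbT.
apply/ler_addgt0Pr => e e0; rewrite add0r.
have e1 : 0 < e / (K * (2 * pi)) by rewrite divr_gt0 // mulr_gt0.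
have [d d0 Hd] := cdiff_cont (dg (ltW wr)) e1.
pose s0 := Num.min (1 / 2) (d / (4 * rho)).
have s00 : 0 < s0 by rewrite lt_min divr_gt0 //= divr_gt0 // mulr_gt0.
have s01 : s0 < 1 by rewrite gt_min; apply/orP; left; lra.
have s0d : s0 * (4 * rho) <= d by rewrite -ler_pdivlMr ?mulr_gt0 // ge_min lexx orbT.
have [S dS] : exists S : R -> R -> C, forall t s, s0 <= s <= 1 ->
    rderiv (S t) s (g (zz s t) / (s%:C)%C).
  have h t : exists P, forall s, s0 <= s <= 1 -> rderiv P s (g (zz s t) / (s%:C)%C).
    by apply: S_exists; rewrite s00 ltW.
  by have [S HS] := choice h; exists S.
have [T' dT'] : exists T' : R -> R -> C, forall s t, s0 <= s <= 1 -> 0 <= t <= 2 * pi ->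
    rderiv (T' s) t (g (zz s t) * kap t).
  have h s : exists P, s0 <= s <= 1 -> forall t, 0 <= t <= 2 * pi ->
      rderiv P t (g (zz s t) * kap t).
    case: (boolP (s0 <= s <= 1)) => [/andP[h1 h2]|_]; last by exists (fun=> 0).
    have [|P HP] := @T_exists s; last by exists P.
    by rewrite h2 andbT; apply: le_trans h1; exact: ltW.
  by have [T' HT] := choice h; exists T' => s t hs; exact: HT.
have cz : c (2 * pi) = c 0.
  by rewrite /c /cis mulr_natl cos2pi sin2pi cos0 sin0.
have s01b : 0 < s0 < 1 by rewrite s00.
have := contour_zero s01b dS dT'.
have -> : S 0 1 - S 0 s0 = S (2 * pi) 1 - S (2 * pi) s0.
  apply: primitive_unique (dS 0) _; first exact: ltW.
  by move=> s hs; have := dS (2 * pi) s hs; rewrite /zz cz.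
rewrite subrr add0r => /subr0_eq E.
have T1 : T' 1 (2 * pi) - T' 1 0 = T (2 * pi) - T 0.
  apply: (@primitive_unique _ _ _ (fun t => g ((rho%:C)%C * cis t) * kap t)) => //; first exact: ltW.
  move=> t ht; have := dT' 1 t; rewrite lexx (ltW s01) => /(_ isT ht).
  by rewrite /zz /c mul1r addrC subrK.
rewrite -T1 E.
have -> : T' s0 (2 * pi) - T' s0 0 - g w * (Kp (2 * pi) - Kp 0) =
  (T' s0 (2 * pi) - g w * Kp (2 * pi)) - (T' s0 0 - g w * Kp 0) by ring.
have -> : e = e / (K * (2 * pi)) * K * (2 * pi - 0).
  by rewrite subr0 -mulrA mulfVK // gt_eqF // mulr_gt0.
apply: (@rderiv_mean _ (fun t => T' s0 t - g w * Kp t) (fun t => g (zz s0 t) * kap t - g w * kap t)).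
- exact: ltW.
- move=> t ht; apply: rderivB; last by apply: rderivZ; exact: dK.
  by apply: dT' => //; rewrite lexx ltW.
move=> t ht; rewrite -mulrBl mdM; apply: ler_pM; rewrite ?md_ge0 ?md_kap //.
apply: Hd; rewrite /zz addrC addKr mdM md_real gtr0_norm //.
have := c_le t; have r0 := rho0; have := mulr_gt0 s00 r0; move=> q1 q2.
have := ler_wpM2l (ltW s00) q2; lra.
Qed.

(** The kernel is a geometric series in [w / z] on the circle [|z| = rho]; the mean value
    inequality bounds the integral of its remainder. *)
Lemma kap_expand (G : R -> C) (M : R) (T : R -> C) (E : nat -> R -> C) n :
  (forall t, 0 <= t <= 2 * pi -> modulus (G t) <= M) ->
  (forall t, 0 <= t <= 2 * pi -> rderiv T t (G t * kap t)) ->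
  (forall k t, 0 <= t <= 2 * pi -> rderiv (E k) t (G t * ('i%C * (cis t)^-1 ^+ k))) ->
  modulus (T (2 * pi) - T 0 - \sum_(k < n) (w / (rho%:C)%C) ^+ k * (E k (2 * pi) - E k 0)) <=
    M * ((modulus w / rho) ^+ n * K) * (2 * pi).
Proof.
move=> GM dT dE; set q := w / (rho%:C)%C.
have rn : (rho%:C)%C != 0 by rewrite -md_gt0 md_real gtr0_norm.
have -> : T (2 * pi) - T 0 - \sum_(k < n) q ^+ k * (E k (2 * pi) - E k 0) =
  (T (2 * pi) - \sum_(k < n) q ^+ k * E k (2 * pi)) - (T 0 - \sum_(k < n) q ^+ k * E k 0).
  rewrite (eq_bigr _ (fun (k : 'I_n) _ => mulrBr (q ^+ k) _ _)) sumrB; ring.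
have -> : M * ((modulus w / rho) ^+ n * K) * (2 * pi) = M * ((modulus w / rho) ^+ n * K) * (2 * pi - 0).
  by rewrite subr0.
apply: (@rderiv_mean _ (fun t => T t - \sum_(k < n) q ^+ k * E k t)
  (fun t => G t * kap t - \sum_(k < n) q ^+ k * (G t * ('i%C * (cis t)^-1 ^+ k)))).
- exact: ltW.
- move=> t ht; apply: rderivB; first exact: dT.
  apply: (@rderiv_sum _ (fun k s => q ^+ k * E k s) t (fun k => q ^+ k * (G t * ('i%C * (cis t)^-1 ^+ k)))).
  by move=> k; apply: rderivZ; exact: dE.
move=> t ht; have cn := cis_neq0 t.
have -> : G t * kap t - \sum_(k < n) q ^+ k * (G t * ('i%C * (cis t)^-1 ^+ k)) =
  G t * (kap t * (q / cis t) ^+ n).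
  rewrite (eq_bigr (fun k : 'I_n => G t * 'i%C * (q / cis t) ^+ k)); last first.
    by move=> k _; rewrite [in RHS]exprMn; ring.
  rewrite -mulr_sumr.
  have k1 : kap t = 'i%C / (1 - q / cis t).
    rewrite /kap /q; have := c_neq0 t; rewrite /c => cn'; field.
    by rewrite cn' cn rn.
  have n1 : 1 - q / cis t != 0.
    have : kap t != 0.
      rewrite /kap mulf_neq0 ?invr_eq0 ?c_neq0 // mulf_neq0 // mulf_neq0 //.
      by rewrite -md_gt0 /modulus /= expr0n /= add0r expr1n sqrtr1.
    by rewrite k1 mulf_eq0 invr_eq0 negb_or => /andP[].
  have := subrX1 (q / cis t) n; set S := \sum_(i < n) _ => hS.
  have {hS}-> : S = ((q / cis t) ^+ n - 1) / (q / cis t - 1).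
    by rewrite hS mulrAC divff ?mul1r // -oppr_eq0 opprB.
  rewrite k1; set y := (q / cis t) ^+ n; set x := q / cis t in n1 *.
  by field; rewrite n1 -oppr_eq0 opprB n1.
rewrite mdM; apply: ler_pM; rewrite ?md_ge0 ?GM // mdM mulrC.
rewrite mdX mdM mdV md_cis invr1 mulr1 /q mdM mdV md_real gtr0_norm //.
by rewrite ler_wpM2l ?md_kap // exprn_ge0 // divr_ge0 ?md_ge0 // ltW.
Qed.

(** In the expansion of the kernel only the constant term lacks a periodic primitive. *)
Lemma primitive_kap (Kp : R -> C) :
  (forall t, 0 <= t <= 2 * pi -> rderiv Kp t (kap t)) ->
  Kp (2 * pi) - Kp 0 = ((2 * pi)%:C)%C * 'i%C.
Proof.
move=> dK.
pose E k t : C := if k is k'.+1 then - (k%:R)^-1 * (cis t)^-1 ^+ k else (t%:C)%C * 'i%C.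
have dE k t : 0 <= t <= 2 * pi -> rderiv (E k) t (1 * ('i%C * (cis t)^-1 ^+ k)).
  move=> _; case: k => [|k].
    rewrite expr0 mulr1 mul1r => e e0; exists 1 => // s _.
    set X := (X in modulus X); have -> : X = 0 by rewrite /X /E rmorphB /=; ring.
    by rewrite md0 mulr_ge0 // ltW.
  have h := cis_neq0 t.
  have -> : 1 * ('i%C * (cis t)^-1 ^+ k.+1) =
    - (k.+1%:R)^-1 * (k.+1%:R * (cis t)^-1 ^+ k * (- 1 / cis t ^+ 2)) * ('i%C * cis t).
    have k0 : (k.+1%:R : C) != 0 by rewrite pnatr_eq0.
    by rewrite exprS; move: (k.+1%:R : C) k0 ((cis t)^-1 ^+ k) => m k0 y; field; rewrite h k0.
  apply: (@rderiv_chain _ (fun x => - (k.+1%:R)^-1 * x^-1 ^+ k.+1) (@cis R)); last exact: rderiv_cis.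
  have := cderivM (cderiv_cst (- (k.+1%:R)^-1) (cis t)) (cderivX k.+1 (cderivV h (cderiv_id (cis t)))).
  by rewrite mul0r add0r.
apply/eqP; rewrite -subr_eq0 -md_eq0 eq_le md_ge0 andbT.
apply/ler_addgt0Pr => e e0; rewrite add0r.
have q01 : 0 <= modulus w / rho < 1.
  by rewrite divr_ge0 ?md_ge0 ?ltW //= ltr_pdivrMr // mul1r.
have e1 : 0 < e / (K * (2 * pi)) by rewrite divr_gt0 // mulr_gt0.
have [N HN] := geo_small q01 e1.
have H1 t : 0 <= t <= 2 * pi -> modulus (1 : C) <= 1 by rewrite md1.
have H2 t : 0 <= t <= 2 * pi -> rderiv Kp t (1 * kap t) by rewrite mul1r; exact: dK.
have := @kap_expand (fun=> 1) 1 Kp E N.+1 H1 H2 dE.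
rewrite big_ord_recl expr0 mul1r big1 ?addr0; last first.
  move=> k _; rewrite /E /= /bump /= add1n /cis mulr_natl cos2pi sin2pi cos0 sin0.
  by rewrite subrr mulr0.
have -> : E (@ord0 N) (2 * pi) - E (@ord0 N) 0 = ((2 * pi)%:C)%C * 'i%C.
  by rewrite /E /= (rmorph0 (real_complex R)) mul0r subr0.
rewrite mul1r => h; apply: le_trans h _.
have -> : e = e / (K * (2 * pi)) * (K * (2 * pi)) by rewrite mulfVK // gt_eqF // mulr_gt0.
rewrite -[leLHS]mulrA ler_pM2r; first by apply: HN; exact: leqnSn.
exact: mulr_gt0.
Qed.

Lemma cauchy_remainder (M : R) (E : nat -> R -> C) n :
  (forall z, modulus z = rho -> modulus (g z) <= M) ->
  (forall k t, 0 <= t <= 2 * pi -> rderiv (E k) t (g ((rho%:C)%C * cis t) * ('i%C * (cis t)^-1 ^+ k))) ->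
  modulus (g w * (((2 * pi)%:C)%C * 'i%C) - \sum_(k < n) (w / (rho%:C)%C) ^+ k * (E k (2 * pi) - E k 0)) <=
    M * ((modulus w / rho) ^+ n * K) * (2 * pi).
Proof.
move=> gM dE.
have [T dT] := @T_exists 1 ltac:(by rewrite ler01 lexx).
have [Kp dK] := rprimitive (ltW p0) rcont_kap.
have dT' t : 0 <= t <= 2 * pi -> rderiv T t (g ((rho%:C)%C * cis t) * kap t).
  by move=> ht; have := dT t ht; rewrite /zz /c mul1r addrC subrK.
rewrite -(primitive_kap dK) -(cauchy_formula_kap dT' dK).
apply: (@kap_expand (fun t => g ((rho%:C)%C * cis t))) => // t _.
by apply: gM; rewrite md_rcis.
Qed.

End Goursat.

Section PowerSeries.
Variable R : realType.
Local Notation C := R[i].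

(** The coefficients are the Fourier coefficients of [g] on the circle. *)
Theorem cauchy_power_series (g : C -> C) (rho M : R) : 0 < rho ->
  (forall z, modulus z <= rho -> cdiff g z) ->
  (forall z, modulus z = rho -> modulus (g z) <= M) ->
  exists a, psum a g M rho.
Proof.
move=> rho0 dg gM.
have p0 : 0 < 2 * pi :> R by rewrite mulr_gt0 ?pi_gt0.
have mi : modulus ('i%C : C) = 1 by rewrite /modulus /= expr0n /= add0r expr1n sqrtr1.
have in0 : ('i%C : C) != 0 by rewrite -md_gt0 mi.
have pn : ((2 * pi : R)%:C)%C != 0 :> C by rewrite -md_gt0 md_real gtr0_norm.
have rn : (rho%:C)%C != 0 :> C by rewrite -md_gt0 md_real gtr0_norm.
have [E dE] : exists E : nat -> R -> C, forall k t, 0 <= t <= 2 * pi ->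
    rderiv (E k) t (g ((rho%:C)%C * cis t) * ('i%C * (cis t)^-1 ^+ k)).
  suff h k : exists P, forall t, 0 <= t <= 2 * pi ->
      rderiv P t (g ((rho%:C)%C * cis t) * ('i%C * (cis t)^-1 ^+ k)).
    by have [E HE] := choice h; exists E.
  apply: (@rprimitive R (fun t => g ((rho%:C)%C * cis t) * ('i%C * (cis t)^-1 ^+ k))).
    exact: ltW.
  move=> t; apply: (@rcont_comp R (fun x => g ((rho%:C)%C * x) * ('i%C * x^-1 ^+ k)) (@cis R));
    last exact: rcont_cis.
  apply: cdiff_cont; apply: cdiffM.
    have := @cdiff_affine R g (rho%:C)%C 0 (cis t).
    rewrite addr0 => /(_ (dg _ _)) [|l hl]; first by rewrite md_rcis.
    exists l; apply: cderiv_ext hl => x; by rewrite addr0.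
  apply: cdiffM; first exact: cdiff_cst.
  apply: cdiffX; apply: cdiffV; [exact: cis_neq0|exact: cdiff_id].
pose a k : C := (E k (2 * pi) - E k 0) / (((2 * pi)%:C)%C * 'i%C * (rho%:C)%C ^+ k).
exists a; split=> [k|w wr n].
  rewrite /a mdM mdV mdM mdX mdM mi mulr1 !md_real (gtr0_norm rho0) (gtr0_norm p0).
  rewrite invfM mulrA mulfVK ?gt_eqF ?exprn_gt0 // ler_pdivrMr //.
  have -> : M * (2 * pi) = M * (2 * pi - 0) by rewrite subr0.
  apply: (@rderiv_mean R (E k) _ 0 (2 * pi) M (ltW p0) (dE k)) => t _.
  rewrite mdM mdM mi mdX mdV md_cis invr1 expr1n !mulr1.
  by apply: gM; rewrite md_rcis.
have := cauchy_remainder rho0 wr dg n gM dE.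
have -> : g w * (((2 * pi)%:C)%C * 'i%C) - \sum_(k < n) (w / (rho%:C)%C) ^+ k * (E k (2 * pi) - E k 0) =
  (((2 * pi)%:C)%C * 'i%C) * (g w - \sum_(k < n) a k * w ^+ k).
  rewrite mulrBr mulr_sumr [g w * _]mulrC; congr (_ - _); apply: eq_bigr => k _.
  rewrite /a exprMn exprVn; set x := _ - _; set y := _ ^+ _; set z := _ ^+ _.
  have zn : z != 0 by rewrite expf_neq0.
  move: (((2 * pi : R)%:C)%C : C) pn => P2 pn.
  by field; rewrite zn pn in0.
rewrite mdM mdM mi mulr1 md_real (gtr0_norm p0) mulrC ler_pM2r // => h.
have -> : (1 - modulus w / rho)^-1 = rho / (rho - modulus w).
  by field; rewrite !gt_eqF // subr_gt0.
exact: h.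
Qed.

End PowerSeries.

(** * Power series *)

Section PsumTheory.
Variable R : realType.
Local Notation C := R[i].
Implicit Types (a b : nat -> C) (g h : C -> C) (M rho : R) (x z : C).

Lemma psum_ge0 a g M rho : psum a g M rho -> 0 <= M.
Proof. by move=> [/(_ 0%N) + _]; rewrite expr0 mulr1; apply: le_trans; exact: md_ge0. Qed.

Lemma ratio01 z rho : modulus z < rho -> 0 <= modulus z / rho < 1.
Proof.
move=> zr; have r0 : 0 < rho by apply: le_lt_trans zr; exact: md_ge0.
by rewrite divr_ge0 ?md_ge0 ?ltW //= ltr_pdivrMr // mul1r.
Qed.

Lemma cconv_geo (u : nat -> C) l M q : 0 <= q < 1 ->
  (forall n, modulus (l - u n) <= M * (q ^+ n / (1 - q))) -> cconv u l.
Proof.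
move=> q01 H e e0; have /andP[q0 q1] := q01.
have q1' : 0 < 1 - q by rewrite subr_gt0.
have K0 : 0 < (`|M| + 1) / (1 - q) by rewrite divr_gt0 // ltr_wpDl.
have [N HN] := geo_small q01 (divr_gt0 e0 K0).
exists N => n Nn; rewrite mdC; apply: le_trans (H n) _.
have h := HN n Nn; rewrite ler_pdivlMr // in h; apply: le_trans h.
rewrite mulrA [leRHS]mulrA ler_pM2r ?invr_gt0 // mulrC ler_wpM2l ?exprn_ge0 //.
by apply: le_trans (ler_norm M) _; rewrite lerDl.
Qed.

Lemma psum_cconv a g M rho z : psum a g M rho -> modulus z < rho ->
  cconv (fun n => \sum_(k < n) a k * z ^+ k) (g z).
Proof. by move=> [_ H] zr; apply: cconv_geo (ratio01 zr) (H z zr). Qed.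

Lemma psum_bound a g M rho z : psum a g M rho -> modulus z < rho ->
  modulus (g z) <= M / (1 - modulus z / rho).
Proof. by move=> [_ H] /H/(_ 0%N); rewrite big_ord0 subr0 expr0 mul1r. Qed.

Lemma coef_geo a M rho z k : 0 < rho -> modulus (a k) * rho ^+ k <= M ->
  modulus (a k * z ^+ k) <= M * (modulus z / rho) ^+ k.
Proof.
move=> r0 h; rewrite mdM mdX expr_div_n [leRHS]mulrA ler_pdivlMr ?exprn_gt0 //.
by rewrite mulrAC ler_wpM2r // exprn_ge0 ?md_ge0.
Qed.

Lemma psum_intro a g M rho : 0 < rho -> (forall k, modulus (a k) * rho ^+ k <= M) ->
  (forall z, modulus z < rho -> cconv (fun n => \sum_(k < n) a k * z ^+ k) (g z)) ->
  psum a g M rho.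
Proof.
move=> r0 Ha Hc; split=> // z zr n.
have M0 : 0 <= M by have := Ha 0%N; rewrite expr0 mulr1; apply: le_trans; exact: md_ge0.
have [l Hl] := @geo_sum R (fun k => a k * z ^+ k) M _ (ratio01 zr) M0
  (fun k => coef_geo z r0 (Ha k)).
by rewrite (cconv_unique (Hc z zr) (cconv_geo (ratio01 zr) Hl)).
Qed.

Lemma psum_exists a M rho : 0 < rho -> (forall k, modulus (a k) * rho ^+ k <= M) ->
  exists g, psum a g M rho.
Proof.
move=> r0 Ha.
have M0 : 0 <= M by have := Ha 0%N; rewrite expr0 mulr1; apply: le_trans; exact: md_ge0.
have h z : exists l, modulus z < rho -> forall n,
    modulus (l - \sum_(k < n) a k * z ^+ k) <= M * ((modulus z / rho) ^+ n / (1 - modulus z / rho)).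
  case: (ltP (modulus z) rho) => [zr|_]; last by exists 0.
  by have [l Hl] := @geo_sum R (fun k => a k * z ^+ k) M _ (ratio01 zr) M0
    (fun k => coef_geo z r0 (Ha k)); exists l.
by have [g Hg] := choice h; exists g; split.
Qed.

Lemma psum0 a g M rho : 0 < rho -> psum a g M rho -> g 0 = a 0%N.
Proof.
move=> r0 pg; have z0 : modulus (0 : C) < rho by rewrite md0.
apply: cconv_unique (psum_cconv pg z0) _ => e e0; exists 1%N => -[//|n] _.
rewrite big_ord_recl big1 ?addr0 ?expr0 ?mulr1 ?subrr ?md0 ?ltW //.
by move=> k _; rewrite expr0n /= mulr0.
Qed.

Lemma psum_shrink a g M rho rho' : 0 < rho' -> rho' <= rho ->
  psum a g M rho -> psum a g M rho'.
Proof.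
move=> r0 rr pg; apply: psum_intro => // [k|z zr]; last first.
  by apply: psum_cconv pg _; apply: lt_le_trans rr.
apply: le_trans (proj1 pg k); rewrite ler_wpM2l ?md_ge0 //.
apply: lerXn2r => //; rewrite nnegrE ltW //; exact: lt_le_trans rr.
Qed.

Lemma psumB a b g h M M' rho : 0 < rho -> psum a g M rho -> psum b h M' rho ->
  psum (fun k => a k - b k) (fun z => g z - h z) (M + M') rho.
Proof.
move=> r0 pg ph; have rk k : 0 <= rho ^+ k by rewrite exprn_ge0 // ltW.
split=> [k|z zr n].
  have := mdB (a k) (b k); have := proj1 pg k; have := proj1 ph k.
  have := rk k; move=> r p q s; apply: le_trans (ler_wpM2r r s) _; lra.
have -> : g z - h z - \sum_(k < n) (a k - b k) * z ^+ k =
  (g z - \sum_(k < n) a k * z ^+ k) - (h z - \sum_(k < n) b k * z ^+ k).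
  rewrite (eq_bigr _ (fun (k : 'I_n) _ => mulrBl (z ^+ k) _ _)) sumrB; ring.
by apply: le_trans (mdB _ _) _; rewrite mulrDl lerD // ?(proj2 pg) ?(proj2 ph).
Qed.

(** Synthetic division: the quotient has the coefficients
    [b k = \sum_j a (k.+1 + j) * z ^+ j]. *)
Lemma psum_div a g M rho z : psum a g M rho -> modulus z < rho ->
  exists b g1, psum b g1 (M / (rho - modulus z)) rho /\
    forall x, modulus x < rho -> g x - g z = (x - z) * g1 x.
Proof.
move=> pg zr; have r0 : 0 < rho by apply: le_lt_trans zr; exact: md_ge0.
have M0 := psum_ge0 pg; have q01 := ratio01 zr.
have rz : 0 < rho - modulus z by rewrite subr_gt0.
have h k : exists l, forall n,
    modulus (l - \sum_(j < n) a (k + j)%N * z ^+ j) <=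
    M / rho ^+ k * ((modulus z / rho) ^+ n / (1 - modulus z / rho)).
  apply: (@geo_sum R (fun j => a (k + j)%N * z ^+ j) (M / rho ^+ k) (modulus z / rho)) => //; first by rewrite divr_ge0 // exprn_ge0 // ltW.
  move=> j; apply: (@coef_geo (fun j => a (k + j)%N)) => //=.
  by rewrite ler_pdivlMr ?exprn_gt0 // -mulrA -exprD addnC (proj1 pg).
have [B HB] := choice h.
have B0 : B 0%N = g z.
  by apply: cconv_unique (psum_cconv pg zr); exact: cconv_geo q01 (HB 0%N).
have BS k : B k = a k + z * B k.+1.
  apply: (@cconv_unique _ (fun n => \sum_(j < n.+1) a (k + j)%N * z ^+ j)).
    move=> e e0; have [N HN] := cconv_geo q01 (HB k) e0.
    by exists N => n Nn; apply: HN; apply: leq_trans Nn _.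
  move=> e e0; have z0 := md_ge0 z.
  have e1 : 0 < e / (modulus z + 1) by rewrite divr_gt0 // ltr_wpDl.
  have [N HN] := cconv_geo q01 (HB k.+1) e1.
  exists N => n /HN; rewrite ler_pdivlMr ?ltr_wpDl // => hn.
  rewrite big_ord_recl addn0 expr0 mulr1.
  have -> : \sum_(i < n) a (k + lift ord0 i)%N * z ^+ lift ord0 i =
      z * \sum_(i < n) a (k.+1 + i)%N * z ^+ i.
    rewrite mulr_sumr; apply: eq_bigr => i _.
    by rewrite /= /bump /= add1n exprS addnS addSn; ring.
  rewrite opprD addrACA subrr add0r -mulrBr mdM.
  have := md_ge0 (\sum_(i < n) a (k.+1 + i)%N * z ^+ i - B k.+1); lra.
have Bk k : modulus (B k.+1) * rho ^+ k <= M / (rho - modulus z).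
  have := HB k.+1 0%N; rewrite big_ord0 subr0 expr0 mul1r => hb.
  have -> : M / (rho - modulus z) = M / rho ^+ k.+1 / (1 - modulus z / rho) * rho ^+ k.
    rewrite exprS; have : rho ^+ k != 0 by rewrite gt_eqF // exprn_gt0.
    move: (rho ^+ k) => y yn.
    by field; rewrite yn !gt_eqF.
  by rewrite ler_wpM2r // exprn_ge0 // ltW.
have [g1 pg1] := psum_exists r0 Bk.
exists (fun k => B k.+1), g1; split => // x xr.
have E n : (x - z) * \sum_(k < n) B k.+1 * x ^+ k =
    \sum_(k < n) a k * x ^+ k - g z + B n * x ^+ n.
  elim: n => [|n IH]; first by rewrite !big_ord0 B0 expr0; ring.
  by rewrite !big_ord_recr /= mulrDr IH (BS n) exprS; ring.
apply: (@cconv_unique _ (fun n => (x - z) * \sum_(k < n) B k.+1 * x ^+ k)); last first.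
  move=> e e0; have e1 : 0 < e / (modulus (x - z) + 1) by rewrite divr_gt0 // ltr_wpDl ?md_ge0.
  have [N HN] := psum_cconv pg1 xr e1; exists N => n /HN.
  rewrite ler_pdivlMr ?ltr_wpDl ?md_ge0 // -mulrBr mdM => hn.
  have := md_ge0 (\sum_(k < n) B k.+1 * x ^+ k - g1 x); lra.
move=> e e0; have [N1 HN1] := psum_cconv pg xr (divr_gt0 e0 (ltr0n _ 2)).
have [N2 HN2] := geo_small (ratio01 xr) (e := e / 2 / (M / (rho - modulus z) * rho + 1))
  ltac:(by rewrite !divr_gt0 // ltr_wpDl // mulr_ge0 ?divr_ge0 // ltW).
exists (maxn N1 N2.+1) => n; rewrite geq_max => /andP[/HN1 h1]; case: n h1 => // n h1 n2.
rewrite E.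
have -> : \sum_(k < n.+1) a k * x ^+ k - g z + B n.+1 * x ^+ n.+1 - (g x - g z) =
  (\sum_(k < n.+1) a k * x ^+ k - g x) + x * (B n.+1 * x ^+ n) by rewrite exprS; ring.
apply: le_trans (mdD _ _) _; rewrite mdM.
have /(_ n) := @coef_geo (fun k => B k.+1) (M / (rho - modulus z)) rho x.
move=> /(_ r0 (Bk n)) h2.
have h3 := HN2 n n2; rewrite ler_pdivlMr in h3; last first.
  by rewrite ltr_wpDl // mulr_ge0 ?divr_ge0 // ltW.
set Q := (modulus x / rho) ^+ n in h2 h3 *; set M1 := M / _ in h2 h3 *.
have Q0 : 0 <= Q by rewrite exprn_ge0 // divr_ge0 ?md_ge0 // ltW.
have M10 : 0 <= M1 by rewrite divr_ge0 // ltW.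
have := ler_pM (md_ge0 _) (md_ge0 _) (ltW xr) h2; lra.
Qed.

Lemma psum_cderiv a g M rho z : psum a g M rho -> modulus z < rho ->
  exists l, cderiv g z l /\ modulus l <= M / (rho - modulus z) / (1 - modulus z / rho).
Proof.
move=> pg zr; have [b [g1 [pg1 E1]]] := psum_div pg zr.
have [c [g2 [pg2 E2]]] := psum_div pg1 zr.
exists (g1 z); split; last exact: psum_bound pg1 zr.
have rz : 0 < rho - modulus z by rewrite subr_gt0.
have rho0 : 0 < rho by apply: le_lt_trans zr; exact: md_ge0.
set M2 := _ / _ / _ in pg2; have M20 := psum_ge0 pg2.
pose K := M2 * (2 * rho) / (rho - modulus z).
have K0 : 0 <= K by apply: divr_ge0; [apply: mulr_ge0 => //; lra|exact: ltW].
have K1 : 0 < K + 1 by rewrite ltr_wpDl.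
move=> e e0; exists (Num.min ((rho - modulus z) / 2) (e / (K + 1))).
  by rewrite lt_min !divr_gt0.
move=> x; rewrite lt_min ltr_pdivlMr // (ltr_pdivlMr _ _ K1) => /andP[h1 h2].
have xz := mdD (x - z) z; rewrite subrK in xz.
have x0 := md_ge0 (x - z).
have xr : modulus x < rho by lra.
rewrite E1 //.
have -> : (x - z) * g1 x - g1 z * (x - z) = (x - z) * (g1 x - g1 z) by ring.
rewrite E2 // mdM mulrC ler_wpM2r // mdM.
have hg : modulus (g2 x) <= K.
  apply: le_trans (psum_bound pg2 xr) _; rewrite /K -mulrA ler_wpM2l //.
  have -> : (1 - modulus x / rho)^-1 = rho / (rho - modulus x).
    by field; rewrite !gt_eqF // subr_gt0.
  rewrite ler_pdivrMr ?subr_gt0 // mulrAC ler_pdivlMr //.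
  have h : 0 <= rho * (2 * (rho - modulus x) - (rho - modulus z)).
    by apply: mulr_ge0; [exact: ltW|lra].
  lra.
have := ler_wpM2l x0 hg; lra.
Qed.

Lemma psum_cdiff a g M rho z : psum a g M rho -> modulus z < rho -> cdiff g z.
Proof. by move=> pg zr; have [l [dl _]] := psum_cderiv pg zr; exists l. Qed.

Lemma psum_tail a g M rho rho' n : 0 < rho' < rho -> psum a g M rho ->
  psum (fun k => if (k < n)%N then 0 else a k)
    (fun z => g z - \sum_(k < n) a k * z ^+ k) (M * (rho' / rho) ^+ n) rho'.
Proof.
move=> /andP[r0 rr] pg; have rho0 : 0 < rho by apply: lt_trans rr.
have M0 := psum_ge0 pg.
have q0 : 0 <= rho' / rho by rewrite divr_ge0 // ltW.
have q1 : rho' / rho <= 1 by rewrite ler_pdivrMr // mul1r ltW.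
apply: psum_intro => // [k|z zr].
  case: ltnP => [_|nk]; first by rewrite md0 mul0r mulr_ge0 // exprn_ge0.
  apply: le_trans (_ : M * (rho' / rho) ^+ k <= _).
    rewrite expr_div_n [leRHS]mulrA ler_pdivlMr ?exprn_gt0 // mulrAC ler_wpM2r ?(proj1 pg) //.
    by rewrite exprn_ge0 // ltW.
  by rewrite ler_wpM2l // ler_wiXn2l.
have zr' : modulus z < rho by apply: lt_trans rr.
move=> e e0; have [N HN] := psum_cconv pg zr' e0; exists (maxn N n) => m.
rewrite geq_max => /andP[Nm nm]; have := HN m Nm.
have -> : \sum_(k < m) (if (k < n)%N then 0 else a k) * z ^+ k = \sum_(n <= k < m) a k * z ^+ k.
  rewrite -(big_mkord xpredT (fun k => (if (k < n)%N then 0 else a k) * z ^+ k)).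
  rewrite (big_cat_nat (leq0n n) nm) /= big_nat_cond big1 ?add0r; last first.
    by move=> k /andP[/andP[_ ->]]; rewrite mul0r.
  by apply: eq_big_nat => k /andP[h _]; rewrite ltnNge h.
by rewrite -(sum_nat_sub (fun k => a k * z ^+ k) nm) opprB addrA subrK.
Qed.

Lemma cderiv_poly a n z :
  cderiv (fun x => \sum_(k < n) a k * x ^+ k) z (\sum_(k < n) a k * (k%:R * z ^+ k.-1)).
Proof.
elim: n => [|n IH].
  rewrite big_ord0; apply: (@cderiv_ext _ (fun=> 0)); last exact: cderiv_cst.
  by move=> x; rewrite big_ord0.
rewrite big_ord_recr /=.
have := cderivD IH (cderivM (cderiv_cst (a n) z) (cderivX n (cderiv_id z))).
rewrite mul0r add0r mulr1; apply: cderiv_ext => x; by rewrite big_ord_recr.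
Qed.

(** Polynomials are differentiated term by term, and the derivative of a tail at [z] is
    small by [psum_cderiv], applied on a slightly smaller disc. *)
Lemma psum_termwise a g M rho z l : psum a g M rho -> modulus z < rho ->
  cconv (fun n => \sum_(k < n) a k * (k%:R * z ^+ k.-1)) l -> cderiv g z l.
Proof.
move=> pg zr cl; have rho0 : 0 < rho by apply: le_lt_trans zr; exact: md_ge0.
have [l0 [dl0 _]] := psum_cderiv pg zr.
suff -> : l = l0 by [].
apply: cconv_unique cl _ => e e0.
pose r := (modulus z + rho) / 2.
have zr' : modulus z < r by rewrite /r; lra.
have r0 : 0 < r by apply: le_lt_trans zr'; exact: md_ge0.
have rr : r < rho by rewrite /r; lra.
have M0 := psum_ge0 pg.
pose K := (r - modulus z)^-1 / (1 - modulus z / r).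
have K0 : 0 < K.
  by rewrite divr_gt0 ?invr_gt0 ?subr_gt0 // ltr_pdivrMr // mul1r.
have q01 : 0 <= r / rho < 1 by rewrite divr_ge0 ?ltW //= ltr_pdivrMr // mul1r.
have MK : 0 < M * K + 1 by rewrite ltr_wpDl // mulr_ge0 // ltW.
have [N HN] := geo_small q01 (divr_gt0 e0 MK).
exists N => n Nn.
have /psum_cderiv/(_ zr')[l1 [dl1 bl1]] := psum_tail n (introT andP (conj r0 rr)) pg.
have dp := cderiv_poly a n z.
have E : l1 + \sum_(k < n) a k * (k%:R * z ^+ k.-1) = l0.
  apply: cderiv_unique dl0; have := cderivD dl1 dp; apply: cderiv_ext => x /=.
  by rewrite subrK.
rewrite -E mdC addrK; apply: le_trans bl1 _.
have := HN n Nn; rewrite ler_pdivlMr // => h; apply: le_trans h.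
rewrite /K; set Q := (r / rho) ^+ n; have Q0 : 0 <= Q by rewrite exprn_ge0 // divr_ge0 // ltW.
rewrite mulrDr mulr1 mulrA mulrA [Q * M]mulrC; lra.
Qed.

Lemma psum_derivative a g M rho rho' : 0 < rho' < rho -> psum a g M rho ->
  exists M' g', psum (fun k => k.+1%:R * a k.+1) g' M' rho' /\
    forall z, modulus z < rho' -> cderiv g z (g' z).
Proof.
move=> /andP[r0 rr] pg; have rho0 : 0 < rho by apply: lt_trans rr.
have M0 := psum_ge0 pg.
pose t := rho' / rho.
have t0 : 0 <= t by rewrite divr_ge0 // ltW.
have t1 : t < 1 by rewrite ltr_pdivrMr // mul1r.
have ht k : k.+1%:R * t ^+ k <= (1 - t)^-1.
  have := @geo_partial R t 0 k.+1 ltac:(by rewrite t0) isT.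
  rewrite expr0 mul1r; apply: le_trans.
  rewrite big_mkord mulr_natl.
  have -> : t ^+ k *+ k.+1 = \sum_(i < k.+1) t ^+ k by rewrite sumr_const card_ord.
  apply: ler_sum => i _; apply: ler_wiXn2l => //; first exact: ltW.
  by rewrite -ltnS.
have Hb k : modulus (k.+1%:R * a k.+1) * rho' ^+ k <= M / rho / (1 - t).
  rewrite mdM -(rmorph_nat (real_complex R)) md_real ger0_norm //.
  have h := proj1 pg k.+1.
  have h' : modulus (a k.+1) * rho ^+ k <= M / rho.
    by rewrite ler_pdivlMr // -mulrA -exprSr.
  have -> : k.+1%:R * modulus (a k.+1) * rho' ^+ k =
      (modulus (a k.+1) * rho ^+ k) * (k.+1%:R * t ^+ k).
    by rewrite /t expr_div_n; field; rewrite expf_neq0 // gt_eqF.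
  apply: ler_pM => //; rewrite mulr_ge0 ?md_ge0 ?exprn_ge0 ?ler0n // ltW //.
have [g' pg'] := psum_exists r0 Hb.
exists (M / rho / (1 - t)), g'; split => // z zr.
apply: psum_termwise pg _ _; first exact: lt_trans rr.
move=> e e0; have [N HN] := psum_cconv pg' zr e0.
exists N.+1 => -[//|n] Nn; have := HN n Nn.
congr (modulus (_ - _) <= _); rewrite big_ord_recl mul0r mulr0 add0r.
by apply: eq_bigr => k _; rewrite /= /bump /= add1n; ring.
Qed.

Lemma psum_primitive a q M rho : psum a q M rho -> 0 < rho ->
  exists c phi, [/\ psum c phi (M * rho) rho, phi 0 = 0 &
    forall z, modulus z < rho -> cderiv phi z (q z)].
Proof.
move=> pq r0; have M0 := psum_ge0 pq.
pose c k : C := if k is k'.+1 then a k' / k'.+1%:R else 0.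
have Hc k : modulus (c k) * rho ^+ k <= M * rho.
  case: k => [|k]; first by rewrite (_ : c 0%N = 0) // md0 mul0r mulr_ge0 // ltW.
  rewrite /= mdM mdV -(rmorph_nat (real_complex R)) md_real ger0_norm // exprSr mulrA.
  rewrite (ler_wpM2r (ltW r0)) //; apply: le_trans (proj1 pq k).
  rewrite ler_wpM2r ?exprn_ge0 ?(ltW r0) // -[leRHS]mulr1 ler_wpM2l ?md_ge0 //.
  by rewrite invf_le1 ?ler1n.
have [phi pphi] := psum_exists r0 Hc.
exists c, phi; split => //; first by rewrite (psum0 r0 pphi).
move=> z zr; apply: (psum_termwise pphi zr).
move=> e e0; have [N HN] := psum_cconv pq zr e0.
exists N.+1 => -[//|n] Nn; have := HN n Nn.
congr (modulus (_ - _) <= _); rewrite big_ord_recl mul0r add0r.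
apply: eq_bigr => k _; rewrite /= /bump /= add1n.
by rewrite mulrA mulfVK // pnatr_eq0.
Qed.

(** Applied to the power [g ^+ m], the crude bound of [psum_bound] loses a factor
    independent of [m], which disappears in the [m]-th root. *)
Lemma max_principle g rho M z : 0 < rho -> (forall x, modulus x <= rho -> cdiff g x) ->
  (forall x, modulus x = rho -> modulus (g x) <= M) -> modulus z <= rho ->
  modulus (g z) <= M.
Proof.
move=> r0 dg gM; rewrite le_eqVlt => /predU1P[|zr]; first exact: gM.
have M0 : 0 <= M.
  have := gM (rho%:C)%C; rewrite md_real gtr0_norm // => /(_ erefl).
  by apply: le_trans; exact: md_ge0.
have /andP[q0 q1] := ratio01 zr.
have H m : modulus (g z) ^+ m <= M ^+ m / (1 - modulus z / rho).
  have [a pa] : exists a, psum a (fun x => g x ^+ m) (M ^+ m) rho.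
    apply: cauchy_power_series => // x xr; first by apply: cdiffX; exact: dg.
    by rewrite mdX lerXn2r ?nnegrE ?md_ge0 ?gM.
  by rewrite -mdX; exact: psum_bound pa zr.
rewrite leNgt; apply/negP => lt.
have g0 : 0 < modulus (g z) by apply: le_lt_trans lt.
have t01 : 0 <= M / modulus (g z) < 1.
  apply/andP; split; first by apply: divr_ge0 => //; exact: ltW.
  by rewrite ltr_pdivrMr // mul1r.
have p1 : 0 < (1 - modulus z / rho) / 2 by rewrite divr_gt0 // subr_gt0.
have [N /(_ N (leqnn N))] := geo_small t01 p1.
have := H N; rewrite ler_pdivlMr ?subr_gt0 // expr_div_n ler_pdivrMr ?exprn_gt0 //.
have : 0 < modulus (g z) ^+ N by rewrite exprn_gt0.
nra.
Qed.

End PsumTheory.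

(** * Averages over roots of unity *)

Section Averages.
Variable R : realType.
Local Notation C := R[i].
Implicit Types (a b : nat -> C) (g h : C -> C) (M rho s : R) (x z w : C).

Lemma ccont_bounded g rho : 0 < rho -> (forall x, modulus x <= rho -> ccont g x) ->
  exists2 M, 0 < M & forall x, modulus x <= rho -> modulus (g x) <= M.
Proof.
move=> r0 cg.
pose Q (a b c d : R) := exists2 M, 0 < M & forall x : C, a <= complex.Re x <= b ->
  c <= complex.Im x <= d -> modulus x <= rho -> modulus (g x) <= M.
have [] : Q (- rho) rho (- rho) rho; last first.
  move=> M M0 HM; exists M => // x xr; apply: HM => //.
    by rewrite -ler_norml; apply: le_trans (md_Re x) xr.
  by rewrite -ler_norml; apply: le_trans (md_Im x) xr.
apply: (@bisection R Q); [lra|lra| |].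
  move=> u v c d ab cd m n [M1 p1 H1] [M2 p2 H2] [M3 p3 H3] [M4 p4 H4].
  exists (M1 + M2 + M3 + M4); first by rewrite !addr_gt0.
  move=> x /andP[ax xb] /andP[cx xd] xr.
  case: (leP (complex.Re x) m) => h1; case: (leP (complex.Im x) n) => h2.
  - have := H1 x; rewrite ax h1 cx h2 => /(_ isT isT xr); lra.
  - have := H3 x; rewrite ax h1 (ltW h2) xd => /(_ isT isT xr); lra.
  - have := H2 x; rewrite xb (ltW h1) cx h2 => /(_ isT isT xr); lra.
  - have := H4 x; rewrite xb (ltW h1) xd (ltW h2) => /(_ isT isT xr); lra.
move=> p q _ _; pose z : C := (p +i* q)%C.
have near_z (a b c d e : R) x : a <= p <= b -> c <= q <= d -> b - a < e -> d - c < e ->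
    a <= complex.Re x <= b -> c <= complex.Im x <= d -> modulus (x - z) < 2 * e.
  move=> /andP[h1 h2] /andP[h3 h4] h5 h6 /andP[h7 h8] /andP[h9 h10].
  apply: le_lt_trans (md_le _) _; move: h7 h8 h9 h10; case: x => u v /= h7 h8 h9 h10.
  have k1 : `|u - p| < e by rewrite ltr_norml; apply/andP; split; lra.
  have k2 : `|v - q| < e by rewrite ltr_norml; apply/andP; split; lra.
  lra.
case: (leP (modulus z) rho) => zr.
  have [d d0 Hd] := cg z zr 1 ltr01.
  exists (d / 2); first lra.
  move=> a' b' c' d' /andP[_ h1] /andP[h2 _] /andP[_ h3] /andP[h4 _] _ _ h5 h6 _.
  exists (modulus (g z) + 1); first by rewrite ltr_wpDl ?md_ge0.
  move=> x hx hy _.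
  have := Hd x; have := @near_z a' b' c' d' (d / 2) x.
  rewrite h1 h2 h3 h4 => /(_ isT isT h5 h6 hx hy) => k1 /(_ ltac:(lra)) k2.
  have := mdD (g x - g z) (g z); rewrite subrK; lra.
exists ((modulus z - rho) / 2); first lra.
move=> a' b' c' d' /andP[_ h1] /andP[h2 _] /andP[_ h3] /andP[h4 _] _ _ h5 h6 _.
exists 1 => // x hx hy xr.
have := @near_z a' b' c' d' _ x.
rewrite h1 h2 h3 h4 => /(_ _ isT isT h5 h6 hx hy).
have := mdD (z - x) x; rewrite subrK mdC; lra.
Qed.

Lemma cdiff_bounded g rho : 0 < rho -> (forall x, modulus x <= rho -> cdiff g x) ->
  exists2 M, 0 < M & forall x, modulus x <= rho -> modulus (g x) <= M.
Proof. by move=> r0 dg; apply: ccont_bounded => // x /dg; exact: cdiff_cont. Qed.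

Lemma cdiff_psum g rho : 0 < rho -> (forall x, modulus x <= rho -> cdiff g x) ->
  exists a M, psum a g M rho.
Proof.
move=> r0 dg; have [M _ HM] := cdiff_bounded r0 dg.
have [a pa] := cauchy_power_series r0 dg (fun z zr => HM z ltac:(by rewrite zr)).
by exists a, M.
Qed.

(** Repeated square roots of -1; orders that are powers of 2 suffice to sample a circle
    as finely as needed. *)
Lemma prim_root_pow2 j : exists w : C, (2 ^ j.+1)%N.-primitive_root w /\ modulus w = 1.
Proof.
have [w wE] : exists w : C, w ^+ (2 ^ j) = -1.
  elim: j => [|j [w wE]]; first by exists (-1); rewrite expr1.
  exists (sqrtc w); by rewrite expnS exprM sqr_sqrtc.
exists w.
have w1 : w ^+ (2 ^ j.+1) = 1 by rewrite expnSr exprM wE sqrrN expr1n.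
have N0 : (0 < 2 ^ j.+1)%N by rewrite expn_gt0.
split.
  have [m pm /dvdn_pfactor[//|i ij mE]] := prim_order_exists N0 w1.
  move: ij; rewrite leq_eqVlt => /predU1P[ij|]; first by rewrite -ij -mE.
  rewrite ltnS => ij; exfalso.
  have : w ^+ (2 ^ j) = 1.
    by apply/eqP; rewrite -(prim_order_dvd pm) mE dvdn_exp2l.
  rewrite wE => /eqP; rewrite -subr_eq0 -opprD oppr_eq0 => /eqP h.
  by have := pnatr_eq0 C 2; rewrite -natr1 h eqxx.
apply/eqP; rewrite -(@pexpr_eq1 _ _ (2 ^ j.+1)) ?md_ge0 //.
by rewrite -mdX w1 md1.
Qed.

(** A discrete Fourier coefficient of [g] on the circle of radius [s], sampled at the
    powers of the [N]-th root of unity [w]. *)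
Definition avg g s w N m : C :=
  (N%:R)^-1 * \sum_(i < N) g ((s%:C)%C * w ^+ i) * (w ^+ i) ^+ m.

Lemma md_natr n : modulus (n%:R : C) = n%:R.
Proof. by rewrite -(rmorph_nat (real_complex R)) md_real ger0_norm. Qed.

Lemma avg_le g s w N m (B : R) : (0 < N)%N -> modulus w = 1 ->
  (forall i, modulus (g ((s%:C)%C * w ^+ i)) <= B) -> modulus (avg g s w N m) <= B.
Proof.
move=> N0 w1 gB; rewrite /avg mdM mdV md_natr mulrC ler_pdivrMr ?ltr0n //.
apply: le_trans (md_sum _ _ _) _.
apply: le_trans (_ : \sum_(i < N) B <= _); last by rewrite sumr_const card_ord mulr_natr.
by apply: ler_sum => i _; rewrite mdM !mdX w1 !expr1n mulr1.
Qed.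

Lemma sum_root w N d : N.-primitive_root w ->
  \sum_(i < N) (w ^+ i) ^+ d = if (N %| d)%N then N%:R else 0.
Proof.
move=> pw; have -> : \sum_(i < N) (w ^+ i) ^+ d = \sum_(i < N) (w ^+ d) ^+ i.
  by apply: eq_bigr => i _; rewrite -!exprM mulnC.
rewrite (prim_order_dvd pw); case: eqP => [->|/eqP h].
  transitivity (\sum_(i < N) (1 : C)); last by rewrite sumr_const card_ord.
  by apply: eq_bigr => i _; rewrite expr1n.
have := subrX1 (w ^+ d) N; rewrite -exprM mulnC exprM (prim_expr_order pw) expr1n subrr.
by move/eqP; rewrite eq_sym mulf_eq0 subr_eq0 (negPf h) => /eqP.
Qed.

Lemma avg_poly a s w N n m : N.-primitive_root w -> (0 < N)%N ->
  avg (fun x => \sum_(l < n) a l * x ^+ l) s w N m =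
  \sum_(l < n | (N %| l + m)%N) a l * (s%:C)%C ^+ l.
Proof.
move=> pw N0; rewrite /avg.
rewrite (eq_bigr (fun i : 'I_N => \sum_(l < n) (a l * (s%:C)%C ^+ l) * (w ^+ i) ^+ (l + m))); last first.
  move=> i _; rewrite mulr_suml; apply: eq_bigr => l _.
  by rewrite exprMn exprD; ring.
rewrite exchange_big /= mulr_sumr [RHS]big_mkcond /=; apply: eq_bigr => l _.
rewrite -mulr_sumr (sum_root _ pw); case: ifP => _; last by rewrite !mulr0.
by rewrite mulrCA mulVf ?mulr1 // pnatr_eq0 -lt0n.
Qed.

Lemma avg_err a g M rho s w N m n : psum a g M rho -> 0 < s < rho ->
  N.-primitive_root w -> (0 < N)%N -> modulus w = 1 ->
  modulus (avg g s w N m - \sum_(l < n | (N %| l + m)%N) a l * (s%:C)%C ^+ l) <=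
    M * ((s / rho) ^+ n / (1 - s / rho)).
Proof.
move=> pg /andP[s0 sr] pw N0 w1; rewrite -(avg_poly _ _ _ _ pw N0).
have -> : avg g s w N m - avg (fun x => \sum_(l < n) a l * x ^+ l) s w N m =
  avg (fun x => g x - \sum_(l < n) a l * x ^+ l) s w N m.
  rewrite /avg -mulrBr -sumrB; congr (_ * _); apply: eq_bigr => i _; ring.
apply: avg_le => // i.
have ms : modulus ((s%:C)%C * w ^+ i) = s by rewrite mdM mdX w1 expr1n mulr1 md_real gtr0_norm.
have zr : modulus ((s%:C)%C * w ^+ i) < rho by rewrite ms.
by have := proj2 pg _ zr n; rewrite ms.
Qed.

(** The average picks the terms of the series whose index is congruent to [k] modulo
    [N]; all but one of them lie in the tail. *)
Lemma avg_coef a g M rho s w N k : psum a g M rho -> 0 < s < rho ->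
  N.-primitive_root w -> (k < N)%N -> modulus w = 1 ->
  modulus (avg g s w N (N - k) - a k * (s%:C)%C ^+ k) <= M * ((s / rho) ^+ N / (1 - s / rho)).
Proof.
move=> pg s0 pw kN w1; have N0 : (0 < N)%N by apply: leq_ltn_trans kN.
have := avg_err (N - k) N pg s0 pw N0 w1.
rewrite (bigD1 (Ordinal kN)) /=; last by rewrite subnKC // ltnW.
rewrite big1 ?addr0 // => l /andP[/dvdnP[q qE] /eqP h]; exfalso; apply: h.
apply: val_inj => /=; have := ltn_ord l => lN.
have q1 : q = 1%N.
  have h1 : (0 < q * N)%N by rewrite -qE addn_gt0 subn_gt0 kN orbT.
  have h2 : (q * N < 2 * N)%N by rewrite -qE mul2n -addnn; lia.
  by move: h1 h2; rewrite muln_gt0 N0 andbT ltn_mul2r N0; lia.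
by move: qE; rewrite q1 mul1n; lia.
Qed.

Lemma avg_neg a g M rho s w N k : psum a g M rho -> 0 < s < rho ->
  N.-primitive_root w -> (0 < k)%N -> (k < N)%N -> modulus w = 1 ->
  modulus (avg g s w N k) <= M * ((s / rho) ^+ (N - k) / (1 - s / rho)).
Proof.
move=> pg s0 pw k0 kN w1; have N0 : (0 < N)%N by apply: leq_ltn_trans kN.
have := avg_err k (N - k) pg s0 pw N0 w1.
rewrite big1 ?subr0 // => l /dvdnP[q qE]; exfalso; have := ltn_ord l => lN.
case: q qE => [|q]; first by lia.
rewrite mulSn => qE; have := leq_addr (q * N) N; rewrite -qE leqNgt.
by have -> : (l + k < N)%N by lia.
Qed.

Lemma pow2_ge n : (n < 2 ^ n.+1)%N.
Proof. exact: ltn_trans (ltnSn n) (ltn_expl n.+1 (isT : (1 < 2)%N)). Qed.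

(** A coefficient is a limit of averages of [g], on circles of radius less than [rho]. *)
Lemma cauchy_est a g M rho B : 0 < rho -> psum a g M rho ->
  (forall z, modulus z < rho -> modulus (g z) <= B) ->
  forall k, modulus (a k) * rho ^+ k <= B.
Proof.
move=> r0 pg gB k; have M0 := psum_ge0 pg.
have H s : 0 < s < rho -> modulus (a k) * s ^+ k <= B.
  move=> sr; have /andP[s0 s1] := sr.
  have q01 : 0 <= s / rho < 1.
    by apply/andP; split; [apply: divr_ge0; exact: ltW|rewrite ltr_pdivrMr // mul1r].
  apply/ler_addgt0Pr => e e0.
  have e1 : 0 < e * (1 - s / rho) / (M + 1).
    by case/andP: q01 => _ ?; rewrite divr_gt0 ?mulr_gt0 ?subr_gt0 // ltr_wpDl.
  have [N0 HN] := geo_small q01 e1.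
  pose j := maxn N0 k; pose N := (2 ^ j.+1)%N.
  have jN : (j < N)%N by exact: pow2_ge.
  have [w [pw w1]] := prim_root_pow2 j.
  have kN : (k < N)%N by apply: leq_ltn_trans jN; exact: leq_maxr.
  have h1 := avg_coef pg sr pw kN w1.
  have h2 : modulus (avg g s w N (N - k)) <= B.
    apply: avg_le => //; first by apply: leq_ltn_trans jN.
    by move=> i; apply: gB; rewrite mdM mdX w1 expr1n mulr1 md_real gtr0_norm.
  have h3 : M * ((s / rho) ^+ N / (1 - s / rho)) <= e.
    have := HN N ltac:(apply: leq_trans (ltnW jN); exact: leq_maxl).
    case/andP: q01 => q0 q1; rewrite ler_pdivlMr; last by rewrite ltr_wpDl.
    move=> h; rewrite mulrA ler_pdivrMr ?subr_gt0 //; apply: le_trans h.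
    have : 0 <= (s / rho) ^+ N by rewrite exprn_ge0.
    lra.
  have := mdB (avg g s w N (N - k)) (avg g s w N (N - k) - a k * (s%:C)%C ^+ k).
  rewrite opprB addrC subrK mdM mdX md_real gtr0_norm //; lra.
rewrite leNgt; apply/negP => lt.
have cont : {for rho, continuous (fun s : R => modulus (a k) * s ^+ k)}.
  by apply: cvgM; [exact: cvg_cst|exact: exprn_continuous].
have e0 : 0 < modulus (a k) * rho ^+ k - B by rewrite subr_gt0.
move/cvgrPdist_lt : cont => /(_ _ e0)[d /= d0 Hd].
pose s := Num.max (rho / 2) (rho - d / 2).
have s1 : 0 < s by rewrite lt_max divr_gt0.
have s2 : s < rho by rewrite gt_max; apply/andP; split; lra.
have s3 : rho - d / 2 <= s by rewrite le_max lexx orbT.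
have := Hd s; rewrite /ball_ /= gtr0_norm ?subr_gt0 // => /(_ ltac:(lra)).
have := H s ltac:(by rewrite s1); move=> h1; have := ler_norm (modulus (a k) * rho ^+ k - modulus (a k) * s ^+ k); lra.
Qed.

Definition holo g s := forall z, modulus z < s -> cdiff g z.

Lemma holo_psum g s rho : 0 < rho < s -> holo g s -> exists a M, psum a g M rho.
Proof. by move=> /andP[r0 rs] hg; apply: cdiff_psum => // x xr; apply: hg; exact: le_lt_trans rs. Qed.

Lemma mid z s : modulus z < s -> exists rho, [/\ modulus z < rho, 0 < rho & rho < s].
Proof.
move=> zs; have := md_ge0 z => z0; exists ((modulus z + s) / 2); split; lra.
Qed.

(** The coefficients of [h n] form Cauchy sequences, by the Cauchy estimates for
    differences, uniformly in the index; the series of their limits sums to [g]. *)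
Lemma holo_limit (h : nat -> C -> C) g s : 0 < s -> (forall N, holo (h N) s) ->
  (forall e : R, 0 < e -> exists N, forall n, (N <= n)%N ->
     forall z, modulus z < s -> modulus (h n z - g z) <= e) -> holo g s.
Proof.
move=> s0 hh hg z zs; have [rho [zr r0 rs]] := mid zs.
have hp N : exists a : nat -> C, exists M, psum a (h N) M rho.
  by have [a [M p]] := holo_psum (introT andP (conj r0 rs)) (hh N); exists a, M.
have [a Ha] := choice hp.
have rk k : 0 < rho ^+ k by rewrite exprn_gt0.
have close e : 0 < e -> exists N, forall m n, (N <= m)%N -> (N <= n)%N ->
    forall k, modulus (a m k - a n k) * rho ^+ k <= e.
  move=> e0; have [N HN] := hg (e / 2) ltac:(lra); exists N => m n Nm Nn k.
  have [M1 p1] := Ha m; have [M2 p2] := Ha n.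
  apply: (cauchy_est r0 (psumB r0 p1 p2)) => x xr.
  have xs : modulus x < s by apply: lt_trans rs.
  have := HN m Nm x xs; have := HN n Nn x xs.
  have := md_tri (h m x) (g x) (h n x); rewrite (mdC (g x)); lra.
have lim k : exists l, cconv (fun n => a n k) l.
  apply: ccauchy => e e0; have [N HN] := close (e * rho ^+ k) ltac:(by rewrite mulr_gt0).
  by exists N => m n Nm Nn; have := HN m n Nm Nn k; rewrite ler_pM2r.
have [c Hc] := choice lim.
have cl e : 0 < e -> exists N, forall n, (N <= n)%N ->
    forall k, modulus (a n k - c k) * rho ^+ k <= e.
  move=> e0; have [N HN] := close e e0; exists N => n Nn k.
  apply/ler_addgt0Pr => e' e'0.
  have [N' HN'] := Hc k (e' / rho ^+ k) ltac:(by rewrite divr_gt0).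
  have h1 := HN' _ (leq_maxr N N'); have h2 := HN n _ Nn (leq_maxl N N') k.
  rewrite ler_pdivlMr // in h1.
  have h3 := ler_wpM2r (ltW (rk k)) (md_tri (a n k) (a (maxn N N') k) (c k)).
  lra.
have [N0 HN0] := cl 1 ltr01.
have [M0 p0] := Ha N0.
have cb k : modulus (c k) * rho ^+ k <= M0 + 1.
  have h1 := HN0 _ (leqnn N0) k; have h2 := proj1 p0 k.
  have := ler_wpM2r (ltW (rk k)) (mdB (a N0 k) (a N0 k - c k)).
  rewrite opprB addrC subrK; lra.
have [G pG] := psum_exists r0 cb.
have E x : modulus x < rho -> G x = g x.
  move=> xr; apply/eqP; rewrite -subr_eq0 -md_eq0 eq_le md_ge0 andbT.
  apply/ler_addgt0Pr => e e0; rewrite add0r.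
  have /andP[q0 q1] := ratio01 xr.
  have e1 : 0 < e / 2 * (1 - modulus x / rho) by rewrite mulr_gt0 ?divr_gt0 ?subr_gt0.
  have [N1 HN1] := cl _ e1; have [N2 HN2] := hg (e / 2) ltac:(lra).
  pose n := maxn N1 N2.
  have h2 := HN2 n (leq_maxr _ _) x (lt_trans xr rs).
  have [M1 p1] := Ha n.
  have p2 : psum (fun k => a n k - c k) (fun x => h n x - G x) (e / 2 * (1 - modulus x / rho)) rho.
    have pB := psumB r0 p1 pG.
    apply: psum_intro => // [k|y yr]; last exact: psum_cconv pB yr.
    exact: HN1 (leq_maxl _ _) k.
  have h3 := psum_bound p2 xr; rewrite mulfK in h3; last by rewrite gt_eqF // subr_gt0.
  have := md_tri (G x) (h n x) (g x); rewrite (mdC (G x) (h n x)); lra.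
have [l dl] := psum_cdiff pG zr; exists l.
apply: (@cderiv_local _ G g z l (rho - modulus z)) => //; first by rewrite subr_gt0.
move=> x xz; apply: E; have := mdD (x - z) z; rewrite subrK; lra.
Qed.

Lemma holo_derivative g s : holo g s ->
  exists2 g', holo g' s & forall z, modulus z < s -> cderiv g z (g' z).
Proof.
move=> hg.
have h z : exists l, modulus z < s -> cderiv g z l.
  by case: (ltP (modulus z) s) => [/hg[l dl]|_]; [exists l|exists 0].
have [g' Hg'] := choice h; exists g' => // z zs.
have [rho [zr r0 rs]] := mid zs; have [r [zr' r'0 rr]] := mid zr.
have [a [M pg]] := holo_psum (introT andP (conj r0 rs)) hg.
have [M' [G [pG dG]]] := psum_derivative (introT andP (conj r'0 rr)) pg.
have [l dl] := psum_cdiff pG zr'; exists l.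
apply: (@cderiv_local _ G g' z l (r - modulus z)) => //; first by rewrite subr_gt0.
move=> x xz; have xr : modulus x < r.
  have := mdD (x - z) z; rewrite subrK; lra.
apply: cderiv_unique (dG x xr) (Hg' x _); apply: lt_trans rs; exact: lt_trans rr.
Qed.

End Averages.

(** * The logarithm of the modulus of a zero-free function *)

Section LogModulus.
Variable R : realType.
Local Notation C := R[i].
Implicit Types (c : nat -> C) (g h phi : C -> C) (M rho s : R) (x y z w : C).

Lemma md_sq z : modulus z ^+ 2 = complex.Re z ^+ 2 + complex.Im z ^+ 2.
Proof. by case: z => a b; rewrite /modulus /= sqr_sqrtr // addr_ge0 // sqr_ge0. Qed.

Lemma rcB (p q : R) : (p%:C)%C - (q%:C)%C = ((p - q)%:C)%C :> R[i].
Proof. by rewrite rmorphB. Qed.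

Lemma ln_le_sub1 (x : R) : 0 < x -> ln x <= x - 1.
Proof.
by move=> x0; have := expR_ge1Dx (ln x); rewrite lnK ?posrE //; lra.
Qed.

Lemma ln_md1D z : modulus z <= 1 / 2 ->
  `|ln (modulus (1 + z)) - complex.Re z| <= 13 * modulus z ^+ 2.
Proof.
move=> z2; set t := modulus z in z2 *; have t0 : 0 <= t by exact: md_ge0.
set a := complex.Re z.
have at_ : `|a| <= t by exact: md_Re.
pose u := 2 * a + t ^+ 2.
have E : modulus (1 + z) ^+ 2 = 1 + u.
  rewrite md_sq /u /t md_sq /a; case: (z) => p q /=; ring.
have m0 : 1 / 2 <= modulus (1 + z).
  have := mdB (1 + z) z; rewrite addrK md1 -/t; lra.
have u1 : 1 / 4 <= 1 + u by rewrite -E; nra.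
have lnE : ln (modulus (1 + z)) = ln (1 + u) / 2.
  rewrite -E lnXn; last lra.
  by rewrite -[_ *+ 2]mulr_natr; field.
have h1 := @ln_le_sub1 (1 + u) ltac:(lra).
have h2 := @ln_le_sub1 (1 + u)^-1 ltac:(by rewrite invr_gt0; lra).
rewrite lnV ?posrE in h2; last lra.
have h3 : (1 + u)^-1 - 1 <= - u + 4 * u ^+ 2.
  rewrite -subr_ge0.
  have -> : - u + 4 * u ^+ 2 - ((1 + u)^-1 - 1) = u ^+ 2 * (4 - (1 + u)^-1).
    by field; rewrite gt_eqF //; lra.
  rewrite mulr_ge0 ?sqr_ge0 // subr_ge0 -[leRHS]invrK lef_pV2 ?posrE ?invr_gt0 //; lra.
have [a1 a2] : - t <= a /\ a <= t by move: at_; rewrite ler_norml => /andP[].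
have hu : u ^+ 2 <= (5 / 2 * t) ^+ 2.
  have t2 : t ^+ 2 <= t / 2 by rewrite expr2; nra.
  have k1 : 0 <= 5 / 2 * t - u by rewrite /u; lra.
  have k2 : 0 <= 5 / 2 * t + u by rewrite /u; have := sqr_ge0 t; lra.
  by have := mulr_ge0 k1 k2; lra.
rewrite lnE ler_norml; apply/andP; split; rewrite /u in h1 h2 h3 hu *; nra.
Qed.

(** The differential of [ln |h|] is the real part of [h' / h dz], so the function
    [ln |h| - Re phi] has derivative zero along the segment from 0 to [x]. *)
Lemma log_modulus h h' phi s x :
  (forall z, modulus z < s -> h z != 0) ->
  (forall z, modulus z < s -> cderiv h z (h' z)) ->
  (forall z, modulus z < s -> cderiv phi z (h' z / h z)) ->
  modulus x < s ->
  ln (modulus (h x)) - ln (modulus (h 0)) = complex.Re (phi x) - complex.Re (phi 0).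
Proof.
move=> hn dh dp xs.
pose D z := ln (modulus (h z)) - complex.Re (phi z).
have local z : modulus z < s -> forall e, 0 < e -> exists2 d, 0 < d &
    forall y, modulus (y - z) < d -> `|D y - D z| <= e * modulus (y - z).
  move=> zs e e0; have hz := hn z zs; set q := h' z / h z.
  have hm : 0 < modulus (h z) by rewrite md_gt0.
  have q0 := md_ge0 q.
  have e3 : 0 < e / 3 by lra.
  have e4 : 0 < Num.min 1 (e / 3) * modulus (h z) by rewrite mulr_gt0 // lt_min ltr01.
  have [d1 d10 H1] := dh z zs _ e4.
  have [d2 d20 H2] := dp z zs _ e3.
  pose K := modulus q + 1.
  have K0 : 0 < K by rewrite /K; lra.
  pose d3 := Num.min (1 / 2 / K) (e / 3 / (13 * K ^+ 2)).
  have K2 : 0 < 13 * K ^+ 2 by rewrite mulr_gt0 // exprn_gt0.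
  have d30 : 0 < d3.
    by rewrite lt_min; apply/andP; split; apply: divr_gt0 => //; lra.
  exists (Num.min d1 (Num.min d2 d3)); first by rewrite lt_min d10 lt_min d20.
  move=> y; rewrite !lt_min => /andP[/H1 h1 /andP[/H2 h2]].
  rewrite ltr_pdivlMr // (ltr_pdivlMr _ _ K2) => /andP[h3 h4].
  set r := modulus (y - z) in h1 h2 h3 h4 *; have r0 : 0 <= r by exact: md_ge0.
  pose t := (h y - h z) / h z.
  have ht : modulus (t - q * (y - z)) <= Num.min 1 (e / 3) * r.
    have -> : t - q * (y - z) = (h y - h z - h' z * (y - z)) / h z by rewrite /t /q; field.
    by rewrite mdM mdV ler_pdivrMr // mulrAC.
  have min1 : Num.min 1 (e / 3) * r <= r.
    by rewrite -[leRHS]mul1r ler_wpM2r // ge_min lexx.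
  have mine : Num.min 1 (e / 3) * r <= e / 3 * r.
    by rewrite ler_wpM2r // ge_min lexx orbT.
  have tK : modulus t <= K * r.
    have := mdD (t - q * (y - z)) (q * (y - z)); rewrite subrK (mdM q) -/r /K; lra.
  have t2 : modulus t <= 1 / 2 by lra.
  have l1 := ln_md1D t2.
  have hy : h y = h z * (1 + t) by rewrite /t; field.
  have t1 : 0 < modulus (1 + t).
    have := mdB (1 + t) t; rewrite addrK md1; lra.
  have lE : ln (modulus (h y)) = ln (modulus (h z)) + ln (modulus (1 + t)).
    by rewrite hy mdM lnM ?posrE.
  have k1 : 13 * modulus t ^+ 2 <= e / 3 * r.
    have tt : modulus t ^+ 2 <= (K * r) ^+ 2 by rewrite lerXn2r ?nnegrE ?md_ge0 // mulr_ge0 // ltW.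
    have : (r * (13 * K ^+ 2)) * r <= e / 3 * r by rewrite ler_wpM2r // ltW.
    rewrite exprMn in tt; lra.
  have k2 : `|complex.Re t - complex.Re (q * (y - z))| <= e / 3 * r.
    apply: le_trans mine; apply: le_trans ht; apply: le_trans (md_Re _).
    by case: (t) => ? ?; case: (q * (y - z)).
  have k3 : `|complex.Re (phi y) - complex.Re (phi z) - complex.Re (q * (y - z))| <= e / 3 * r.
    apply: le_trans h2; apply: le_trans (md_Re _).
    by case: (phi y) => ? ?; case: (phi z) => ? ?; case: (q * (y - z)).
  move: l1 k2 k3; rewrite /D lE !ler_norml => /andP[? ?] /andP[? ?] /andP[? ?].
  apply/andP; split; lra.
have : modulus (((D (1%:C%C * x))%:C)%C - ((D (0%:C%C * x))%:C)%C) <= 0 * (1 - 0).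
  apply: (@rderiv_mean _ (fun t => ((D (t%:C%C * x))%:C)%C) (fun=> 0) 0 1) => // [t /andP[t0 t1]|t _]; last by rewrite md0.
  have tx : modulus (t%:C%C * x) < s.
    rewrite mdM md_real ger0_norm //; have := md_ge0 x; nra.
  move=> e e0; have e1 : 0 < e / (modulus x + 1) by rewrite divr_gt0 // ltr_wpDl ?md_ge0.
  have [d d0 Hd] := local _ tx _ e1.
  exists (d / (modulus x + 1)); first by rewrite divr_gt0 // ltr_wpDl ?md_ge0.
  move=> t' ht; rewrite mulr0 subr0 rcB md_real.
  have E : t'%:C%C * x - t%:C%C * x = (t' - t)%:C%C * x by rewrite rmorphB /=; ring.
  have := Hd (t'%:C%C * x); rewrite E mdM md_real.
  rewrite ltr_pdivlMr ?ltr_wpDl ?md_ge0 // in ht.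
  have x0 := md_ge0 x; have n0 := normr_ge0 (t' - t).
  move=> /(_ ltac:(nra)) hD; apply: le_trans hD _.
  rewrite mulrAC ler_pdivrMr; last lra.
  rewrite -mulrA ler_pM2l //; nra.
rewrite !mul0r rcB md_real normr_le0 subr_eq0 => /eqP.
rewrite rmorph1 mul1r /D; lra.
Qed.

End LogModulus.

Section LogModulusLipschitz.
Variable R : realType.
Local Notation C := R[i].
Implicit Types (c : nat -> C) (g h phi : C -> C) (M rho s : R) (x y z w : C).

(** The function [L - Re phi] is nonnegative with mean [L] over the circles about 0, so
    its discrete Fourier coefficients are at most [L] in modulus. Up to the small
    averages of negative index, they are minus one half of the coefficients of [phi]. *)
Lemma re_coef c phi M rho1 rho (L : R) k : psum c phi M rho1 -> 0 < rho < rho1 ->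
  phi 0 = 0 -> (forall z, modulus z < rho1 -> complex.Re (phi z) <= L) ->
  modulus (c k) * rho ^+ k <= 2 * L.
Proof.
move=> pp rr p0 pL; have /andP[r0 r1] := rr; have M0 := psum_ge0 pp.
have rho10 : 0 < rho1 by apply: lt_trans r1.
have L0 : 0 <= L by have := pL 0; rewrite md0 p0 => /(_ rho10).
case: k => [|k]; first by rewrite -(psum0 rho10 pp) p0 md0 mul0r mulr_ge0.
set k1 := k.+1; apply/ler_addgt0Pr => e e0.
have q01 : 0 <= rho / rho1 < 1.
  by apply/andP; split; [apply: divr_ge0; exact: ltW|rewrite ltr_pdivrMr // mul1r].
have e1 : 0 < e / 4 * (1 - rho / rho1) / (M + 1).
  by case/andP: q01 => _ ?; rewrite divr_gt0 ?mulr_gt0 ?subr_gt0 // ltr_wpDl.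
have [N0 HN] := geo_small q01 e1.
pose j := (N0 + k1)%N; pose N := (2 ^ j.+1)%N.
have jN : (j < N)%N by exact: pow2_ge.
have [w [pw w1]] := prim_root_pow2 R j; rewrite -/N in pw.
have kN : (k1 < N)%N by apply: leq_ltn_trans jN; exact: leq_addl.
have N0k : (N0 <= N - k1)%N by rewrite -(leq_add2r k1) subnK ?(ltnW kN) // ltnW.
clearbody N.
have N_gt0 : (0 < N)%N by apply: leq_ltn_trans kN.
have err n : (N0 <= n)%N -> M * ((rho / rho1) ^+ n / (1 - rho / rho1)) <= e / 4.
  move=> /HN; case/andP: q01 => q0 q1; rewrite ler_pdivlMr; last by rewrite ltr_wpDl.
  move=> h; rewrite mulrA ler_pdivrMr ?subr_gt0 //; apply: le_trans h.
  have : 0 <= (rho / rho1) ^+ n by rewrite exprn_ge0.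
  lra.
have h1 := avg_coef pp rr pw kN w1.
have h2 := avg_neg pp rr pw (isT : (0 < k1)%N) kN w1.
have h0 := avg_coef pp rr pw N_gt0 w1.
rewrite subn0 -(psum0 rho10 pp) p0 mul0r subr0 in h0.
have {}h1 := le_trans h1 (err N ltac:(apply: leq_trans (ltnW jN); exact: leq_addr)).
have {}h0 := le_trans h0 (err N ltac:(apply: leq_trans (ltnW jN); exact: leq_addr)).
have {}h2 := le_trans h2 (err (N - k1)%N N0k).
pose ph (i : nat) := phi (rho%:C%C * w ^+ i).
pose re (i : nat) := complex.Re (ph i).
(* Conjugation exchanges the averages of indices [k] and [N - k]. *)
have wc (i : nat) m : (m <= N)%N -> ((w ^+ i) ^+ m)^*%C = (w ^+ i) ^+ (N - m) :> C.
  move=> mN.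
  have wn : w != 0 by rewrite -md_gt0 w1.
  have cw : w^*%C = w^-1.
    apply: (mulfI wn); rewrite divff //.
    have := md_sq w; rewrite w1 expr1n; case: (w) => a b /= h.
    apply/eqP; rewrite eq_complex /=; apply/andP; split; apply/eqP; last ring.
    by rewrite h; ring.
  rewrite !rmorphXn /= cw -!exprM exprVn; apply: (mulfI (_ : w ^+ (i * m) != 0)).
    by rewrite expf_neq0.
  rewrite divff ?expf_neq0 // -exprD -mulnDr subnKC // mulnC exprM.
  by rewrite (prim_expr_order pw) expr1n.
have claim : modulus (avg phi rho w N (N - k1) + (avg phi rho w N k1)^*%C) <= 2 * L + 2 * (e / 4).
  have Nn : (N%:R : C) != 0 by rewrite pnatr_eq0 -lt0n.
  have -> : avg phi rho w N (N - k1) + (avg phi rho w N k1)^*%C =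
     - ((N%:R)^-1 * \sum_(i < N) (2 * (L - re i))%:C%C * (w ^+ i) ^+ (N - k1)).
    have z0 : \sum_(i < N) (w ^+ i) ^+ (N - k1) = 0.
      rewrite (sum_root _ pw); case: ifP => // /dvdnP[q]; case: q => [|q].
        by move/eqP; rewrite mul0n subn_eq0 leqNgt kN.
      rewrite mulSn => h; exfalso; have := leq_addr (q * N) N.
      by rewrite -h leqNgt ltn_subrL N_gt0.
    rewrite (eq_bigr (fun i : 'I_N => (2 * L)%:C%C * (w ^+ i) ^+ (N - k1) -
       (ph i * (w ^+ i) ^+ (N - k1) + (ph i)^*%C * (w ^+ i) ^+ (N - k1)))); last first.
      move=> i _; rewrite /re; case: (ph i) => a b.
      rewrite -mulrDl -mulrBl; congr (_ * _); apply/eqP; rewrite eq_complex /=.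
      by apply/andP; split; apply/eqP; ring.
    rewrite sumrB -mulr_sumr z0 mulr0 sub0r mulrN opprK big_split /= mulrDr.
    rewrite /avg rmorphM rmorph_sum fmorphV rmorph_nat /=; congr (_ + _ * _).
    by apply: eq_bigr => i _; rewrite rmorphM /= wc // ltnW.
  rewrite mdN mdM mdV md_natr mulrC ler_pdivrMr ?ltr0n //.
  apply: le_trans (md_sum _ _ _) _.
  have rL i : re i <= L.
    by apply: pL; rewrite mdM mdX w1 expr1n mulr1 md_real gtr0_norm.
  rewrite (eq_bigr (fun i : 'I_N => 2 * L - 2 * re i)); last first.
    move=> i _; rewrite mdM md_real !mdX w1 !expr1n mulr1 ger0_norm; first by ring.
    by have := rL i; lra.
  rewrite sumrB sumr_const card_ord -mulr_sumr.
  have hs : - \sum_(i < N) re i <= e / 4 * N%:R.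
    have : modulus (\sum_(i < N) ph i) <= e / 4 * N%:R.
      rewrite -ler_pdivrMr ?ltr0n // mulrC -md_natr -mdV -mdM; move: h0.
      rewrite /avg; congr (modulus (_ * _) <= _); apply: eq_bigr => i _.
      by rewrite -exprM mulnC exprM (prim_expr_order pw) expr1n mulr1.
    move=> h; apply: le_trans h; apply: le_trans (md_Re _).
    rewrite (_ : complex.Re _ = \sum_(i < N) re i); first by rewrite -normrN ler_norm.
    by rewrite (raddf_sum (@complex.Re R)).
  rewrite -[(2 * L) *+ N]mulr_natr; lra.
have mc x : modulus (x^*)%C = modulus x.
  by case: x => a b; rewrite /modulus /= sqrrN.
have : modulus (c k1 * rho%:C%C ^+ k1) <= 2 * L + e.
  set A1 := avg _ _ _ _ (N - k1) in h1 claim; set A2 := avg _ _ _ _ k1 in h2 claim.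
  have -> : c k1 * rho%:C%C ^+ k1 = (A1 + A2^*%C) - A2^*%C - (A1 - c k1 * rho%:C%C ^+ k1) by ring.
  apply: le_trans (mdB _ _) _; have := mdB (A1 + A2^*%C) (A2^*%C); rewrite mc; lra.
by rewrite mdM mdX md_real gtr0_norm.
Qed.

(** A form of Harnack's inequality. Let [phi] be the primitive of [h' / h] that
    vanishes at 0; its real part is at most [L = - ln |h 0|], so that [re_coef]
    bounds all its coefficients by [2 L], and [psum_div] its difference quotients. *)
Theorem log_modulus_lipschitz h s (kap : R) x y : 0 < s -> 0 <= kap < 1 -> holo h s ->
  (forall z, modulus z < s -> h z != 0) -> (forall z, modulus z < s -> modulus (h z) <= 1) ->
  modulus x <= kap * s -> modulus y <= kap * s ->
  ln (modulus (h x)) - ln (modulus (h y)) <=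
    8 / (1 - kap) ^+ 2 * - ln (modulus (h 0)) * (modulus (x - y) / s).
Proof.
move=> s0 /andP[k0 k1] hh hn h1 xs ys.
have [h' hh' dh] := holo_derivative hh.
have hq : holo (fun z => h' z * (h z)^-1) s.
  by move=> z zs; apply: cdiffM; [exact: hh'|apply: cdiffV; [exact: hn|exact: hh]].
pose rho := s * (1 + kap) / 2.
have r0 : 0 < rho by rewrite /rho divr_gt0 // mulr_gt0 // ltr_pwDl.
have rs : rho < s by rewrite /rho; nra.
pose rho1 := (rho + s) / 2.
have rr1 : 0 < rho < rho1 by rewrite r0 /rho1; lra.
have r1s : 0 < rho1 < s by rewrite /rho1; apply/andP; split; lra.
have [a [M pq]] := holo_psum r1s hq.
have r10 : 0 < rho1 by case/andP: r1s.
have [c [phi [pphi phi0 dphi]]] := psum_primitive pq r10.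
pose L := - ln (modulus (h 0)).
have logE z : modulus z < rho1 -> ln (modulus (h z)) = complex.Re (phi z) - L.
  move=> zr; have lt z' : modulus z' < rho1 -> modulus z' < s.
    by move=> ?; apply: lt_trans (_ : rho1 < s) => //; case/andP: r1s.
  have := @log_modulus R h h' phi rho1 z (fun z hz => hn z (lt z hz))
    (fun z hz => dh z (lt z hz)) dphi zr.
  by rewrite phi0 /= subr0 /L opprK => <-; rewrite subrK.
have pL z : modulus z < rho1 -> complex.Re (phi z) <= L.
  move=> zr; have zs : modulus z < s by apply: lt_trans zr _; case/andP: r1s.
  have := logE z zr; have := @ln_le_sub1 R (modulus (h z)) ltac:(by rewrite md_gt0 hn).
  have := h1 z zs; lra.
have L0 : 0 <= L by have := pL 0; rewrite md0 phi0 => /(_ r10).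
have cb k := re_coef k pphi rr1 phi0 pL.
have p2 : psum c phi (2 * L) rho.
  apply: psum_intro => // z zr; apply: psum_cconv pphi _; apply: lt_trans zr _.
  by case/andP: rr1.
have kr : kap * s < rho by rewrite /rho; nra.
have yr : modulus y < rho by apply: le_lt_trans kr.
have xr : modulus x < rho by apply: le_lt_trans kr.
have rr : rho < rho1 by case/andP: rr1.
rewrite (logE x (lt_trans xr rr)) (logE y (lt_trans yr rr)).
have [b [g1 [pg1 E1]]] := psum_div p2 yr.
have -> : complex.Re (phi x) - L - (complex.Re (phi y) - L) = complex.Re (phi x - phi y).
  by case: (phi x) => ? ?; case: (phi y) => ? ? /=; ring.
apply: le_trans (ler_norm _) _; apply: le_trans (md_Re _) _.
rewrite E1 // mdM mulrC.
have hb := psum_bound pg1 xr.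
have -> : 8 / (1 - kap) ^+ 2 * - ln (modulus (h 0)) * (modulus (x - y) / s) =
  (8 / (1 - kap) ^+ 2 * L / s) * modulus (x - y) by rewrite /L; ring.
rewrite ler_wpM2r ?md_ge0 //; apply: le_trans hb _.
have -> : (1 - modulus x / rho)^-1 = rho / (rho - modulus x).
  by field; rewrite !gt_eqF // subr_gt0.
have d1 : s * (1 - kap) / 2 <= rho - modulus x by rewrite /rho; lra.
have d2 : s * (1 - kap) / 2 <= rho - modulus y by rewrite /rho; lra.
have d0 : 0 < s * (1 - kap) / 2 by rewrite divr_gt0 // mulr_gt0 // subr_gt0.
have i1 : (rho - modulus x)^-1 <= (s * (1 - kap) / 2)^-1 by rewrite lef_pV2 ?posrE //; lra.
have i2 : (rho - modulus y)^-1 <= (s * (1 - kap) / 2)^-1 by rewrite lef_pV2 ?posrE //; lra.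
have i0 : 0 <= (s * (1 - kap) / 2)^-1 by rewrite invr_ge0 ltW.
have i1' : 0 <= (rho - modulus x)^-1 by rewrite invr_ge0 subr_ge0 ltW.
have i2' : 0 <= (rho - modulus y)^-1 by rewrite invr_ge0 subr_ge0 ltW.
apply: le_trans (_ : 2 * L * (s * (1 - kap) / 2)^-1 * (s * (s * (1 - kap) / 2)^-1) <= _).
  have LL : 0 <= 2 * L by rewrite mulr_ge0.
  have b1 := ler_wpM2l LL i2.
  have b2 := ler_pM (ltW r0) i1' (ltW rs) i1.
  by apply: ler_pM b1 b2; [exact: mulr_ge0|apply: mulr_ge0 => //; exact: ltW].
rewrite le_eqVlt; apply/orP; left; apply/eqP; field.
by rewrite !gt_eqF // subr_gt0.
Qed.

End LogModulusLipschitz.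

(** * Blaschke products *)

Section Blaschke.
Variable R : realType.
Local Notation C := R[i].
Implicit Types (g h q : C -> C) (M rho s : R) (c x y z w : C) (zs : seq C).

Lemma holo_div g s c : holo g s -> modulus c < s ->
  exists q, holo q s /\ forall x, g x - g c = (x - c) * q x.
Proof.
move=> hg cs; have [l dl] := hg c cs.
pose q x := if x == c then l else (g x - g c) / (x - c).
have Eq x : g x - g c = (x - c) * q x.
  rewrite /q; case: eqVneq => [->|xc]; first by rewrite !subrr mul0r.
  by rewrite mulrC mulfVK // subr_eq0.
exists q; split=> // z zs.
have [rho [mr r0 rs]] : exists rho, [/\ modulus z < rho /\ modulus c < rho, 0 < rho & rho < s].
  exists ((Num.max (modulus z) (modulus c) + s) / 2).
  have h1 : modulus z <= Num.max (modulus z) (modulus c) by rewrite le_max lexx.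
  have h2 : modulus c <= Num.max (modulus z) (modulus c) by rewrite le_max lexx orbT.
  have h3 : Num.max (modulus z) (modulus c) < s by rewrite gt_max zs.
  have h4 := md_ge0 z; split; [split|..]; lra.
case: mr => zr cr.
have [a [M pg]] := holo_psum (introT andP (conj r0 rs)) hg.
have [b [g1 [pg1 E1]]] := psum_div pg cr.
have dg1 : cderiv g c (g1 c).
  have [l1 dl1] := psum_cdiff pg1 cr.
  have := cderivM (cderivD (cderiv_id c) (cderiv_cst (- c) c)) dl1.
  rewrite subrr mul0r !addr0 mul1r => H.
  have := cderivD H (cderiv_cst (g c) c); rewrite addr0.
  apply: (@cderiv_local _ _ _ _ _ (rho - modulus c)); first by rewrite subr_gt0.
  move=> x xc; rewrite -E1 ?subrK //; have := mdD (x - c) c; rewrite subrK; lra.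
have lE : l = g1 c by exact: cderiv_unique dl dg1.
apply: (@cdiff_local _ g1 q z (rho - modulus z)); first by rewrite subr_gt0.
  move=> x xz; have xr : modulus x < rho by have := mdD (x - z) z; rewrite subrK; lra.
  rewrite /q; case: eqVneq => [->//|xc].
  by rewrite E1 // mulrAC divff ?mul1r // subr_eq0.
exact: psum_cdiff pg1 zr.
Qed.

Definition blaschke c z : C := (z - c) / (1 - c^*%C * z).

Lemma mdJ c : modulus (c^*%C) = modulus c.
Proof. by case: c => a b; rewrite /modulus /= sqrrN. Qed.

Lemma blaschke_den c z : modulus c < 1 -> modulus z <= 1 ->
  1 - modulus c <= modulus (1 - c^*%C * z) <= 2.
Proof.
move=> c1 z1; have c0 := md_ge0 c; have z0 := md_ge0 z.
have h : modulus (c^*%C * z) <= modulus c by rewrite mdM mdJ; nra.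
apply/andP; split.
  have := mdD (1 - c^*%C * z) (c^*%C * z); rewrite subrK md1; lra.
apply: le_trans (mdB _ _) _; rewrite md1; lra.
Qed.

Lemma blaschke_den_neq0 c z : modulus c < 1 -> modulus z <= 1 -> 1 - c^*%C * z != 0.
Proof.
move=> c1 z1; have /andP[h _] := blaschke_den c1 z1.
by rewrite -md_gt0; apply: lt_le_trans h; rewrite subr_gt0.
Qed.

Lemma blaschke_sq c z : modulus c < 1 -> modulus z <= 1 ->
  modulus (blaschke c z) ^+ 2 =
  1 - (1 - modulus z ^+ 2) * (1 - modulus c ^+ 2) / modulus (1 - c^*%C * z) ^+ 2.
Proof.
move=> c1 z1; rewrite /blaschke mdM mdV.
have := blaschke_den_neq0 c1 z1; rewrite -md_gt0 => d0.
have E : modulus (z - c) ^+ 2 = modulus (1 - c^*%C * z) ^+ 2 - (1 - modulus z ^+ 2) * (1 - modulus c ^+ 2).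
  by rewrite !md_sq; case: (z) => a b; case: (c) => p q /=; ring.
by rewrite exprMn E exprVn mulrBl divff // expf_neq0 // gt_eqF.
Qed.

Lemma blaschke_le1 c z : modulus c < 1 -> modulus z <= 1 -> modulus (blaschke c z) <= 1.
Proof.
move=> c1 z1; rewrite -ler_sqr ?nnegrE ?md_ge0 //.
rewrite blaschke_sq // expr1n gerBl divr_ge0 ?exprn_ge0 ?md_ge0 // mulr_ge0 // subr_ge0.
  by rewrite expr_le1 // md_ge0.
by rewrite expr_le1 ?md_ge0 // ltW.
Qed.

Lemma blaschke_eq0 c z : modulus c < 1 -> modulus z <= 1 -> (blaschke c z == 0) = (z == c).
Proof.
move=> c1 z1; rewrite /blaschke mulf_eq0 invr_eq0 (negPf (blaschke_den_neq0 c1 z1)) orbF.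
by rewrite subr_eq0.
Qed.

Lemma blaschke_cdiff c z : modulus c < 1 -> modulus z <= 1 -> cdiff (blaschke c) z.
Proof.
move=> c1 z1; apply: cdiffM; first by apply: cdiffD; [exact: cdiff_id|exact: cdiff_cst].
apply: cdiffV; first exact: blaschke_den_neq0.
apply: (@cdiff_local _ (fun x => 1 + (- c^*%C) * x) _ _ 1) => //.
  by move=> x _; rewrite mulNr.
by apply: cdiffD; [exact: cdiff_cst|apply: cdiffM; [exact: cdiff_cst|exact: cdiff_id]].
Qed.

(** A number less than 1 that bounds the squared modulus of a Blaschke factor with zero in
    the disc of radius [th] at the points of the disc of radius [kap]. *)
Definition bbound (th kap : R) : R := 1 - (1 - kap ^+ 2) * (1 - th ^+ 2) / 4.

Lemma bbound01 th kap : 0 <= th < 1 -> 0 <= kap < 1 -> 0 < bbound th kap < 1.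
Proof.
move=> /andP[t0 t1] /andP[k0 k1].
have h1 : 0 < 1 - kap ^+ 2 by rewrite subr_gt0 exprn_ilt1 //.
have h2 : 0 < 1 - th ^+ 2 by rewrite subr_gt0 exprn_ilt1 //.
have h3 : 1 - kap ^+ 2 <= 1 by rewrite gerBl sqr_ge0.
have h4 : 1 - th ^+ 2 <= 1 by rewrite gerBl sqr_ge0.
by rewrite /bbound; apply/andP; split; nra.
Qed.

Lemma blaschke_bound c z th kap : 0 <= th < 1 -> 0 <= kap < 1 ->
  modulus c <= th -> modulus z <= kap -> modulus (blaschke c z) ^+ 2 <= bbound th kap.
Proof.
move=> /andP[t0 t1] /andP[k0 k1] cth zk.
have c1 : modulus c < 1 by lra.
have z1 : modulus z <= 1 by lra.
rewrite blaschke_sq // /bbound lerB //.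
have h0 : 0 <= 1 - kap ^+ 2 by rewrite subr_ge0 exprn_ile1 // ltW.
have h0' : 0 <= 1 - th ^+ 2 by rewrite subr_ge0 exprn_ile1 // ltW.
have h1 : 1 - kap ^+ 2 <= 1 - modulus z ^+ 2 by rewrite lerB // lerXn2r ?nnegrE ?md_ge0.
have h2 : 1 - th ^+ 2 <= 1 - modulus c ^+ 2 by rewrite lerB // lerXn2r ?nnegrE ?md_ge0.
have /andP[d1 d2] := blaschke_den c1 z1.
have d0 : 0 < modulus (1 - c^*%C * z) by rewrite md_gt0 blaschke_den_neq0.
apply: ler_pM; rewrite ?mulr_ge0 ?invr_ge0 //; first exact: ler_pM.
rewrite lef_pV2 ?posrE ?exprn_gt0 //.
have -> : 4 = 2 ^+ 2 :> R by ring.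
by rewrite lerXn2r ?nnegrE // ltW.
Qed.

(** Schwarz's lemma: on a circle close to the unit circle the Blaschke factor has
    modulus close to 1, so the quotient is nearly bounded by 1 there, and then inside by the
    maximum principle. *)
Lemma blaschke_div g c : holo g 1 -> (forall z, modulus z < 1 -> modulus (g z) <= 1) ->
  modulus c < 1 -> g c = 0 ->
  exists h, [/\ holo h 1, forall z, modulus z < 1 -> modulus (h z) <= 1 &
    forall z, modulus z < 1 -> g z = blaschke c z * h z].
Proof.
move=> hg g1 c1 gc; have [q [hq Eq]] := holo_div hg c1.
pose h z := q z * (1 + (- c^*%C) * z).
have hh : holo h 1.
  move=> z z1; apply: cdiffM; first exact: hq.
  by apply: cdiffD; [exact: cdiff_cst|apply: cdiffM; [exact: cdiff_cst|exact: cdiff_id]].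
have Eh z : modulus z < 1 -> g z = blaschke c z * h z.
  move=> z1; have := Eq z; rewrite gc subr0 => ->; rewrite /blaschke /h mulNr.
  have := blaschke_den_neq0 c1 (ltW z1) => d; set D := 1 - _ in d *.
  by field.
exists h; split => // z z1.
rewrite leNgt; apply/negP => hz.
set H := modulus (h z) ^+ 2.
have H1 : 1 < H by rewrite /H exprn_egt1.
pose K := (1 - modulus c ^+ 2) / (1 - modulus c) ^+ 2.
have c0 := md_ge0 c; have c1' : 0 < 1 - modulus c by rewrite subr_gt0.
have K0 : 0 < K by rewrite divr_gt0 ?exprn_gt0 // subr_gt0 exprn_ilt1.
have H0 : 0 < H by apply: lt_trans H1.
have KH : 0 < 4 * K * H by apply: mulr_gt0 => //; apply: mulr_gt0.
pose tau := Num.min ((1 - modulus z) / 2) ((H - 1) / (4 * K * H)).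
have t0 : 0 < tau.
  rewrite lt_min; apply/andP; split; first by rewrite divr_gt0 // subr_gt0.
  by rewrite divr_gt0 ?subr_gt0.
have t1 : tau <= (1 - modulus z) / 2 by rewrite ge_min lexx.
have t2 : tau * (4 * K * H) <= H - 1.
  by rewrite -ler_pdivlMr // ge_min lexx orbT.
pose rho := 1 - tau.
have z0 := md_ge0 z.
have r0 : 0 < rho by rewrite /rho; lra.
have r1 : rho < 1 by rewrite /rho; lra.
pose B := 1 - 2 * tau * K.
have B0 : 0 < B.
  have : 2 * tau * K * H < H by nra.
  rewrite /B -(ltr_pM2r (x := H)); last lra.
  nra.
have hx x : modulus x = rho -> modulus (h x) <= Num.sqrt B^-1.
  move=> xr; have x1 : modulus x < 1 by rewrite xr.
  rewrite -[leLHS]ger0_norm ?md_ge0 // -sqrtr_sqr ler_wsqrtr //.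
  have b2 : B <= modulus (blaschke c x) ^+ 2.
    rewrite blaschke_sq ?(ltW x1) // /B lerB // xr.
    have d0 : 0 < modulus (1 - c^*%C * x) by rewrite md_gt0 blaschke_den_neq0 // ltW.
    have /andP[d1 _] := blaschke_den c1 (ltW x1).
    rewrite -mulrA; apply: ler_pM.
    - by rewrite subr_ge0 exprn_ile1 // ltW.
    - by rewrite divr_ge0 ?exprn_ge0 ?(ltW d0) // subr_ge0 exprn_ile1 // ltW.
    - by rewrite /rho; have := sqr_ge0 tau; lra.
    rewrite ler_wpM2l //; first by rewrite subr_ge0 exprn_ile1 // ltW.
    by rewrite lef_pV2 ?posrE ?exprn_gt0 // lerXn2r ?nnegrE // ltW.
  have gx := g1 x x1; rewrite Eh // mdM in gx.
  have : (modulus (blaschke c x) * modulus (h x)) ^+ 2 <= 1.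
    by rewrite exprn_ile1 // mulr_ge0 ?md_ge0.
  rewrite exprMn => k; rewrite -[leRHS]mul1r ler_pdivlMr // mulrC; apply: le_trans k.
  by rewrite ler_wpM2r // sqr_ge0.
have := max_principle r0 (fun x xr => hh x (le_lt_trans xr r1)) hx (z := z).
rewrite /rho => /(_ ltac:(lra)) hz2.
have : H <= B^-1.
  rewrite /H -(sqr_sqrtr (_ : 0 <= B^-1)) ?invr_ge0 ?(ltW B0) //.
  by rewrite lerXn2r ?nnegrE ?md_ge0 ?sqrtr_ge0.
rewrite -[leRHS]mul1r ler_pdivlMr // /B; nra.
Qed.

Definition bprod zs z : C := \prod_(c <- zs) blaschke c z.

Lemma bprod_le1 zs z : (forall c, c \in zs -> modulus c < 1) -> modulus z <= 1 ->
  modulus (bprod zs z) <= 1.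
Proof.
move=> hz z1; elim: zs hz => [|c zs IH] hz; first by rewrite /bprod big_nil md1.
rewrite /bprod big_cons mdM mulr_ile1 ?md_ge0 //.
  by apply: blaschke_le1 => //; apply: hz; rewrite mem_head.
by apply: IH => c' c'z; apply: hz; rewrite inE c'z orbT.
Qed.

Lemma bprod_bound zs z th kap : 0 <= th < 1 -> 0 <= kap < 1 ->
  (forall c, c \in zs -> modulus c <= th) -> modulus z <= kap ->
  modulus (bprod zs z) ^+ 2 <= bbound th kap ^+ size zs.
Proof.
move=> t01 k01 hz zk; elim: zs hz => [|c zs IH] hz.
  by rewrite /bprod big_nil md1 expr1n expr0.
rewrite /bprod big_cons mdM exprMn [bbound _ _ ^+ _]exprS; apply: ler_pM; rewrite ?sqr_ge0 //.
  by apply: blaschke_bound => //; apply: hz; rewrite mem_head.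
by apply: IH => c' c'z; apply: hz; rewrite inE c'z orbT.
Qed.

(** Zeros are divided out one at a time. By [blaschke_bound] each step multiplies the
    squared modulus at [z0] by at least the inverse of [bbound th kap], while the quotient
    remains bounded by 1, so the process stops. *)
Theorem zero_factorization g th kap z0 : 0 <= th < 1 -> 0 <= kap < 1 ->
  holo g 1 -> (forall z, modulus z < 1 -> modulus (g z) <= 1) ->
  modulus z0 <= kap -> g z0 != 0 ->
  exists zs h, [/\ holo h 1, forall z, modulus z < 1 -> modulus (h z) <= 1,
    forall c, c \in zs -> modulus c <= th,
    forall z, modulus z < 1 -> g z = bprod zs z * h z &
    forall z, modulus z <= th -> h z != 0].
Proof.
move=> t01 k01 hg g1 zk gz.
have /andP[b0 b1] := bbound01 t01 k01.
have z1 : modulus z0 < 1 by case/andP: k01 => _; apply: le_lt_trans.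
have [n] : exists n, bbound th kap ^+ n < modulus (g z0) ^+ 2.
  have g0 : 0 < modulus (g z0) ^+ 2 / 2 by rewrite divr_gt0 // exprn_gt0 // md_gt0.
  have [N /(_ N (leqnn N)) h] := geo_small (introT andP (conj (ltW b0) b1)) g0.
  by exists N; lra.
elim: n g hg g1 gz => [|n IH] g hg g1 gz hn.
  exfalso; move: hn; rewrite expr0 ltNge => /negP; apply.
  by rewrite exprn_ile1 ?md_ge0 // g1.
case: (pselect (exists2 c, modulus c <= th & g c = 0)) => [[c ct gc]|nz]; last first.
  exists [::], g; split => // z zt; first by rewrite /bprod big_nil mul1r.
  by apply/eqP => gz0; apply: nz; exists z.
have c1 : modulus c < 1 by case/andP: t01 => _; apply: le_lt_trans.
have [h [hh h1 Eh]] := blaschke_div hg g1 c1 gc.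
have hz : h z0 != 0 by apply: contra_neq gz => h0; rewrite Eh // h0 mulr0.
have [|zs [k [hk k1 zst Ek kn]]] := IH h hh h1 hz.
  move: hn; rewrite Eh // mdM exprMn [bbound _ _ ^+ _]exprS => hn.
  have := blaschke_bound t01 k01 ct zk => hb.
  have h2 : 0 <= modulus (h z0) ^+ 2 by rewrite sqr_ge0.
  rewrite -(ltr_pM2l b0); apply: lt_le_trans hn _; exact: ler_wpM2r.
exists (c :: zs), k; split => //.
  by move=> c'; rewrite inE => /predU1P[->//|/zst].
by move=> z z'1; rewrite Eh // Ek // /bprod big_cons mulrA.
Qed.

Lemma bprod_eq0 zs z : (forall c, c \in zs -> modulus c < 1) -> modulus z <= 1 ->
  (bprod zs z == 0) = (z \in zs).
Proof.
move=> hz z1; elim: zs hz => [|c zs IH] hz; first by rewrite /bprod big_nil oner_eq0.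
rewrite /bprod big_cons mulf_eq0 -/(bprod zs z) IH ?inE ?blaschke_eq0 //.
  by apply: hz; rewrite mem_head.
by move=> c' c'z; apply: hz; rewrite inE c'z orbT.
Qed.

Lemma bprod_cdiff zs z : (forall c, c \in zs -> modulus c < 1) -> modulus z <= 1 ->
  cdiff (bprod zs) z.
Proof.
move=> hz z1; elim: zs hz => [|c zs IH] hz.
  by apply: (@cdiff_local _ (fun=> 1) _ _ 1) => //; [move=> x _; rewrite /bprod big_nil|exact: cdiff_cst].
apply: (@cdiff_local _ (fun x => blaschke c x * bprod zs x) _ _ 1) => //.
  by move=> x _; rewrite /bprod big_cons.
apply: cdiffM; first by apply: blaschke_cdiff => //; apply: hz; rewrite mem_head.
by apply: IH => c' c'z; apply: hz; rewrite inE c'z orbT.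
Qed.

Lemma double_zero zs h g : holo h 1 -> (forall c, c \in zs -> modulus c < 1) ->
  (forall z, modulus z < 1 -> g z = bprod zs z * h z) -> ~~ uniq zs ->
  exists2 c, c \in zs & cderiv g c 0.
Proof.
move=> hh hz Eg nu.
have [c [zs' pz]] : exists c zs', perm_eq zs (c :: c :: zs').
  elim: zs nu {hz Eg} => // a zs IH /=.
  rewrite negb_and negbK => /orP[az|/IH[c [zs' pz]]].
    by exists a, (rem a zs); rewrite perm_cons; exact: perm_to_rem.
  exists c, (a :: zs'); rewrite -(perm_cons a) in pz; apply: (perm_trans pz).
  by rewrite -[_ :: _ :: c :: zs']/([:: a; c; c] ++ zs') -[_ :: _ :: a :: zs']/([:: c; c; a] ++ zs')
    perm_cat2r -[[:: a; c; c]]/([:: a] ++ [:: c; c]) -[[:: c; c; a]]/([:: c; c] ++ [:: a]) perm_catC.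
have cz : c \in zs by rewrite (perm_mem pz) mem_head.
have c1 := hz c cz; exists c => //.
have hz' c' : c' \in zs' -> modulus c' < 1.
  by move=> h'; apply: hz; rewrite (perm_mem pz) !inE h' !orbT.
have [l dl] := blaschke_cdiff c1 (ltW c1).
have [l' dl'] : cdiff (fun x => bprod zs' x * h x) c.
  by apply: cdiffM; [exact: bprod_cdiff hz' (ltW c1)|exact: hh].
have := cderivM dl (cderivM dl dl').
have b0 : blaschke c c = 0 by apply/eqP; rewrite blaschke_eq0 // ltW.
rewrite b0 !mul0r mulr0 addr0; apply: (@cderiv_local _ _ _ _ _ (1 - modulus c)).
  by rewrite subr_gt0.
move=> x xc; have x1 : modulus x < 1 by have := mdD (x - c) c; rewrite subrK; lra.
by rewrite Eg // /bprod (perm_big _ pz) /= !big_cons; ring.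
Qed.

End Blaschke.

(** * Counting preimages in the unit disc *)

Section Doubling.
Variable R : realType.
Local Notation C := R[i].
Implicit Types (g h q : C -> C) (M rho s : R) (c x y z w : C) (zs : seq C).

Lemma disc_net rho (d : R) : 0 < rho -> 0 < d -> exists ns : seq C,
  (forall n, n \in ns -> modulus n <= rho) /\
  forall z, modulus z <= rho -> exists2 n, n \in ns & modulus (z - n) <= d.
Proof.
move=> r0 d0.
pose Q (a b u v : R) := exists ns : seq C, (forall n, n \in ns -> modulus n <= rho) /\
  forall z, modulus z <= rho -> a <= complex.Re z <= b -> u <= complex.Im z <= v ->
    exists2 n, n \in ns & modulus (z - n) <= d.
have [] : Q (- rho) rho (- rho) rho; last first.
  move=> ns [h1 h2]; exists ns; split => // z zr; apply: h2 => //.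
    by rewrite -ler_norml; apply: le_trans (md_Re z) zr.
  by rewrite -ler_norml; apply: le_trans (md_Im z) zr.
apply: (@bisection R Q); [lra|lra| |].
  move=> a b u v ab uv m n [n1 [i1 h1]] [n2 [i2 h2]] [n3 [i3 h3]] [n4 [i4 h4]].
  exists (n1 ++ n2 ++ n3 ++ n4); split.
    by move=> x; rewrite !mem_cat => /or4P[/i1|/i2|/i3|/i4].
  move=> z zr /andP[z1 z2] /andP[z3 z4].
  case: (leP (complex.Re z) m) => k1; case: (leP (complex.Im z) n) => k2.
  - have := h1 z zr; rewrite z1 k1 z3 k2 => /(_ isT isT)[x xn xd]; exists x => //.
    by rewrite !mem_cat xn.
  - have := h3 z zr; rewrite z1 k1 (ltW k2) z4 => /(_ isT isT)[x xn xd]; exists x => //.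
    by rewrite !mem_cat xn !orbT.
  - have := h2 z zr; rewrite (ltW k1) z2 z3 k2 => /(_ isT isT)[x xn xd]; exists x => //.
    by rewrite !mem_cat xn !orbT.
  - have := h4 z zr; rewrite (ltW k1) z2 (ltW k2) z4 => /(_ isT isT)[x xn xd]; exists x => //.
    by rewrite !mem_cat xn !orbT.
move=> p q _ _; exists (d / 2); first lra.
move=> a b u v _ _ _ _ _ _ ab uv _.
case: (pselect (exists z0, [/\ modulus z0 <= rho, a <= complex.Re z0 <= b & u <= complex.Im z0 <= v])).
  move=> [z0 [zr z1 z2]]; exists [:: z0]; split; first by move=> n; rewrite inE => /eqP ->.
  move=> z _ z3 z4; exists z0; first by rewrite inE.
  apply: le_trans (md_le _) _.
  move: z1 z2 z3 z4; case: (z) => x1 y1; case: (z0) => x2 y2 /=.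
  move=> /andP[? ?] /andP[? ?] /andP[? ?] /andP[? ?].
  have k1 : `|x1 - x2| <= d / 2 by rewrite ler_norml; apply/andP; split; lra.
  have k2 : `|y1 - y2| <= d / 2 by rewrite ler_norml; apply/andP; split; lra.
  lra.
move=> nz; exists [::]; split => // z zr z1 z2; exfalso; apply: nz; exists z; split => //.
Qed.

Lemma avoid_finite (vs : seq R) (a b : R) : a < b ->
  exists K eta, [/\ a <= K <= b, 0 < eta & forall v, v \in vs -> eta <= `|K - v|].
Proof.
move=> ab.
suff [a' [b' [h1 h2 h3 h4]]] : exists a' b', [/\ a <= a', b' <= b, a' < b' &
    forall v, v \in vs -> v < a' \/ b' < v].
  exists ((a' + b') / 2), ((b' - a') / 2); split; [by apply/andP; split; lra|lra|].
  move=> v /h4[h|h].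
    by rewrite ger0_norm; lra.
  by rewrite ler0_norm; lra.
elim: vs a b ab => [|v vs IH] a b ab; first by exists a, b.
case: (leP v ((a + b) / 2)) => hv.
  have [a' [b' [h1 h2 h3 h4]]] := IH ((a + 3 * b) / 4) b ltac:(lra).
  exists a', b'; split => //; first lra.
  by move=> v'; rewrite inE => /predU1P[->|/h4//]; left; lra.
have [a' [b' [h1 h2 h3 h4]]] := IH a ((3 * a + b) / 4) ltac:(lra).
exists a', b'; split => //; first lra.
by move=> v'; rewrite inE => /predU1P[->|/h4//]; right; lra.
Qed.

Lemma size_by_values (T U : eqType) (f : T -> U) (p : nat) (ws : seq U) (s : seq T) :
  (forall x : T, x \in s -> f x \in ws) ->
  (forall w : U, (size [seq x : T <- s | f x == w] <= p)%N) -> (size s <= size ws * p)%N.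
Proof.
elim: ws s => [|w ws IH] s hs hp.
  by case: s hs {hp} => // x s /(_ x (mem_head _ _)).
have -> : size s = (size [seq x : T <- s | f x == w] + size [seq x : T <- s | f x != w])%N.
  by rewrite !size_filter -(count_predC (fun x : T => f x == w) s).
rewrite /= mulSn leq_add // IH //.
  by move=> x; rewrite mem_filter => /andP[xw /hs]; rewrite inE (negPf xw).
move=> w'; rewrite -filter_predI; apply: leq_trans (hp w').
rewrite !size_filter; apply: sub_count => x /= /andP[] //.
Qed.

(** Preimages are counted without multiplicity, and in the open unit disc only. *)
Definition valent g (p : nat) : Prop := forall w zs, uniq zs ->
  (forall z, z \in zs -> modulus z < 1 /\ g z = w) -> (size zs <= p)%N.

(** The derivative does not vanish identically, so its zeros in a smaller disc are among
    those of a finite Blaschke product. *)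
Lemma critical_points g s1 (th : R) : 1 < s1 -> holo g s1 -> 0 <= th < 1 ->
  (exists2 z, modulus z < 1 & g z != g 0) ->
  exists cs : seq C, forall z, modulus z <= th -> cderiv g z 0 -> z \in cs.
Proof.
move=> s11 hg th01 [z0 z01 gz0]; have [g' hg' dg'] := holo_derivative hg.
have lt1 z : modulus z <= 1 -> modulus z < s1 by move=> h; apply: le_lt_trans s11.
have [M M0 HM] := cdiff_bounded ltr01 (fun x xr => hg' x (lt1 x xr)).
have [z1 z11 nz1] : exists2 z1, modulus z1 < 1 & g' z1 != 0.
  apply: contrapT => H; move/eqP: gz0; apply.
  have g'0 z : modulus z < 1 -> g' z = 0.
    by move=> zz; apply/eqP; apply: contrapT => /negP h; apply: H; exists z.
  apply/eqP; rewrite -subr_eq0 -md_eq0 eq_le md_ge0 andbT.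
  have : modulus (g (1%:C%C * z0) - g (0%:C%C * z0)) <= 0 * (1 - 0).
    apply: (@rderiv_mean _ (fun t => g (t%:C%C * z0)) (fun t => 0 * z0) 0 1) => // [t /andP[t0 t1]|t _]; last by rewrite mul0r md0.
    have tz : modulus (t%:C%C * z0) < 1.
      rewrite mdM md_real ger0_norm //; have := md_ge0 z0; nra.
    apply: (@rderiv_chain R g (fun t => t%:C%C * z0)).
      by rewrite -(g'0 _ tz); apply: dg'; apply: lt1; exact: ltW.
    move=> e e0; exists 1 => // t' _.
    set X := (X in modulus X); have -> : X = 0 by rewrite /X rmorphB /=; ring.
    by rewrite md0 mulr_ge0 // ltW.
  by rewrite !mul0r rmorph1 mul1r.
pose G z := (M%:C)%C^-1 * g' z.
have Mn : (M%:C)%C != 0 :> C by rewrite -md_gt0 md_real gtr0_norm.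
have hG : holo G 1.
  by move=> z zz; apply: cdiffM; [exact: cdiff_cst|apply: hg'; apply: lt1; exact: ltW].
have G1 z : modulus z < 1 -> modulus (G z) <= 1.
  by move=> zz; rewrite mdM mdV md_real gtr0_norm // mulrC ler_pdivrMr // mul1r HM // ltW.
have z1k : 0 <= modulus z1 < 1 by rewrite md_ge0.
have Gz1 : G z1 != 0 by rewrite mulf_neq0 // invr_eq0.
have [zs [h [hh h1 zst Eh hn]]] := zero_factorization th01 z1k hG G1 (lexx _) Gz1.
exists zs => z zt dz; have zz1 : modulus z < 1 by case/andP: th01 => _; apply: le_lt_trans.
have : G z = 0.
  by rewrite /G (cderiv_unique (dg' z (lt1 _ (ltW zz1))) dz) mulr0.
rewrite Eh // => /eqP; rewrite mulf_eq0 (negPf (hn z zt)) orbF bprod_eq0 ?(ltW zz1) //.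
by move=> c /zst ct; case/andP: th01 => _; apply: le_lt_trans.
Qed.

(** On [zs] the function [g] takes at most [m] values, the roots of [X ^+ m - a]. *)
Lemma card_roots (zs : seq C) g (m p : nat) (a : C) : (0 < m)%N -> valent g p -> uniq zs ->
  (forall c, c \in zs -> modulus c < 1 /\ g c ^+ m = a) -> (size zs <= m * p)%N.
Proof.
move=> m0 vg uz hz; pose ws := undup [seq g c | c <- zs].
apply: leq_trans (_ : size ws * p <= _)%N.
  apply: (@size_by_values _ _ g) => [x xz|w]; first by rewrite mem_undup map_f.
  apply: (vg w); first exact: filter_uniq.
  by move=> z; rewrite mem_filter => /andP[/eqP gz /hz[]].
rewrite leq_mul2r; apply/orP; right; rewrite -ltnS -(size_XnsubC a m0).
apply: max_poly_roots; last exact: undup_uniq.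
  by rewrite -size_poly_gt0 size_XnsubC.
apply/allP => w; rewrite mem_undup => /mapP[c /hz[_ ga] ->].
by rewrite /root !hornerE ga subrr.
Qed.

(** The ratio of [K] to a number at distance at least [eta] from it is bounded away from
    1, so its [m]-th power is far from 1 for large [m]. *)
Lemma pow_gap (K eta : R) : 0 < K -> 0 < eta -> exists2 m, (0 < m)%N &
  forall v : R, 0 <= v -> eta <= `|K - v| -> K ^+ m / 2 <= `|v ^+ m - K ^+ m|.
Proof.
move=> K0 e0.
have q1 : 0 <= Num.max 0 ((K - eta) / K) < 1.
  by rewrite le_max lexx /= gt_max ltr01 /= ltr_pdivrMr // mul1r; lra.
have q2 : 0 <= K / (K + eta) < 1.
  apply/andP; split; first by rewrite divr_ge0 //; lra.
  by rewrite ltr_pdivrMr; lra.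
have h2 : 0 < 1 / 2 :> R by lra.
have [N1 H1] := geo_small q1 h2; have [N2 H2] := geo_small q2 h2.
exists (maxn 1 (maxn N1 N2)); first by rewrite leq_max.
set m := maxn _ _ => v v0.
have Km : 0 < K ^+ m by rewrite exprn_gt0.
case: (leP v K) => vK.
  rewrite ger0_norm ?subr_ge0 // => hv.
  have := H1 m ltac:(by rewrite !leq_max leqnn orbT).
  have vq : v / K <= Num.max 0 ((K - eta) / K).
    by rewrite le_max; apply/orP; right; rewrite ler_pM2r ?invr_gt0 //; lra.
  have : (v / K) ^+ m <= Num.max 0 ((K - eta) / K) ^+ m.
    by rewrite lerXn2r ?nnegrE ?divr_ge0 //; [exact: ltW|case/andP: q1].
  move=> a1 a2; have := le_trans a1 a2; rewrite expr_div_n ler_pdivrMr // => k.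
  rewrite ler0_norm; lra.
rewrite ler0_norm; last lra.
move=> hv; have := H2 m ltac:(by rewrite !leq_max leqnn !orbT).
have v1 : 0 < v by lra.
have vq : K / v <= K / (K + eta) by rewrite ler_pM2l // lef_pV2 ?posrE; lra.
have : (K / v) ^+ m <= (K / (K + eta)) ^+ m.
  by rewrite lerXn2r ?nnegrE //; [apply: divr_ge0; lra|case/andP: q2].
move=> a1 a2; have := le_trans a1 a2; rewrite expr_div_n ler_pdivrMr ?exprn_gt0 // => k.
rewrite ger0_norm; lra.
Qed.

Lemma bprod_ge0 zs s : 0 < s -> (forall c, c \in zs -> s <= modulus c) ->
  s ^+ size zs <= modulus (bprod zs 0).
Proof.
move=> s0; elim: zs => [|c zs IH] hz; first by rewrite /bprod big_nil md1 expr0.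
rewrite /bprod big_cons mdM /= exprS ler_pM ?exprn_ge0 ?(ltW s0) //.
  by rewrite /blaschke sub0r mulr0 subr0 invr1 mulr1 mdN hz // mem_head.
by apply: IH => c' c'z; apply: hz; rewrite inE c'z orbT.
Qed.

End Doubling.

(** * The doubling inequality *)

Section DoublingTheorem.
Variable R : realType.
Local Notation C := R[i].
Implicit Types (g h q : C -> C) (M rho s : R) (c x y z w : C) (zs : seq C).

(** Consider [G = (g ^+ m - K ^+ m) / (2 A ^+ m)], where [A] bounds [|g|] on the unit
    disc, the level [K] between [2 M] and [3 M] avoids the values of [|g|] at the critical
    points and at the points of a fine net, and [m] is so large that [|G|] is at least
    [K ^+ m / (4 A ^+ m)] on the net. Each of the at most [m] values of [g] at the
    zeros of [G] is taken at most [p] times, so that [G] has at most [m p] zeros, which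
    are simple because [K] avoids the critical values and lie outside of the disc of
    radius [s] because [K > M]. Write [G = bprod zs * h]. The size of [h] at the origin
    is known up to a factor [s ^+ (m p)]; the net together with a crude Lipschitz bound
    for [ln |h|] shows that [h] is nowhere much smaller than [K ^+ m / A ^+ m]; and
    Harnack's inequality for the inverse of [h] then bounds [h] from above with a
    constant of size [exp (O (m p))]. Since [K <= 3 M], the [m]-th root of the bound for
    [g ^+ m] has the required form; the dependence on [A] has cancelled. *)
Theorem valent_doubling (s th : R) : 0 < s < 1 -> 0 < th < 1 ->
  exists2 A : R, 0 < A & forall g (p : nat) s1 M, 1 < s1 -> holo g s1 -> (0 < p)%N ->
    valent g p -> 0 < M -> (forall z, modulus z <= s -> modulus (g z) <= M) ->
    forall z, modulus z <= th -> modulus (g z) <= M * expR (A * p%:R).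
Proof.
move=> /andP[s0 s1'] /andP[t0 t1].
pose th3 := (1 + th) / 2; pose th2 := (th + th3) / 2.
have [t12 t23 t31] : [/\ th < th2, th2 < th3 & th3 < 1] by rewrite /th2 /th3; split; lra.
have th20 : 0 < th2 by lra.
have th30 : 0 < th3 by lra.
pose C1 := 8 / (1 - th / th2) ^+ 2.
have k1 : 0 <= th / th2 < 1.
  by apply/andP; split; [apply: divr_ge0; exact: ltW|rewrite ltr_pdivrMr // mul1r].
have C10 : 0 < C1 by case/andP: k1 => _ k; rewrite divr_gt0 // exprn_gt0 // subr_gt0.
pose c3 := - ln s + 3.
have lns : ln s < 0 by rewrite ln_lt0 // s0.
have c30 : 0 < c3 by rewrite /c3; lra.
pose E := (1 + C1) * c3.
have E0 : 0 < E by rewrite mulr_gt0 //; lra.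
exists (E + 3); first by rewrite addr_gt0.
move=> g p s1 M s11 hg p0 vg M0 gM z zth.
have lt1 x : modulus x <= 1 -> modulus x < s1 by move=> h; apply: le_lt_trans s11.
have p1 : 1 <= p%:R :> R by rewrite ler1n.
have e8 : 8 <= expR 3 :> R.
  have -> : 3 = 1 + 1 + 1 :> R by ring.
  have := expR_ge1Dx (1 : R); rewrite !expRD; set e := expR 1 => e2.
  have : 2 * 2 <= e * e by apply: ler_pM => //; lra.
  move=> e4; have : 4 * 2 <= e * e * e by apply: ler_pM => //; lra.
  lra.
have bigE : 8 <= expR ((E + 3) * p%:R).
  apply: le_trans e8 _; rewrite ler_expR.
  have : 0 <= E * p%:R by rewrite mulr_ge0 // ltW.
  lra.
case: (pselect (exists2 z, modulus z < 1 & g z != g 0)) => [nc|cst]; last first.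
  have z1 : modulus z < 1 by lra.
  have -> : g z = g 0.
    by apply/eqP; apply: contrapT => /negP h; apply: cst; exists z.
  have := gM 0; rewrite md0 => /(_ (ltW s0)) h; apply: le_trans h _.
  rewrite -[leLHS]mulr1 ler_pM2l //; lra.
have th301 : 0 <= th3 < 1 by rewrite t31 andbT ltW.
have [cs Hcs] := critical_points s11 hg th301 nc.
have [A0 A00 HA0] := cdiff_bounded ltr01 (fun x xr => hg x (lt1 x xr)).
pose A := A0 + 3 * M.
have A_gt0 : 0 < A by rewrite addr_gt0 ?mulr_gt0.
have gA x : modulus x <= 1 -> modulus (g x) <= A.
  by move=> x1; apply: le_trans (HA0 x x1) _; rewrite /A; lra.
(* [m * Lp] will bound [- ln |h 0|], so that [m * Lam] is a Lipschitz constant for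
   [ln |h|]; a net of mesh [Lam^-1] loses a factor [exp m] only, whatever [m] is. *)
pose Lp := ln (A / (2 * M)) + ln 4.
have Lp0 : 0 < Lp.
  have ? : 0 <= ln (A / (2 * M)).
    by apply: ln_ge0; rewrite ler_pdivlMr ?mulr_gt0 // mul1r /A; lra.
  have : 0 < ln 4 :> R by rewrite ln_gt0 //; lra.
  rewrite /Lp; lra.
pose Lam := 8 / (1 - th2 / th3) ^+ 2 * Lp / th3.
have k2 : 0 <= th2 / th3 < 1.
  by apply/andP; split; [apply: divr_ge0; exact: ltW|rewrite ltr_pdivrMr // mul1r].
have Lam0 : 0 < Lam.
  case/andP: k2 => _ k; rewrite divr_gt0 // mulr_gt0 // divr_gt0 // exprn_gt0 // subr_gt0 //.
have Lami : 0 < Lam^-1 by rewrite invr_gt0.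
have [ns [ns1 ns2]] := disc_net th20 Lami.
have [K [eta [/andP[K2 K3] eta0 Hvs]]] := @avoid_finite R [seq modulus (g x) | x <- ns ++ cs] (2 * M) (3 * M) ltac:(lra).
have K0 : 0 < K by lra.
have [m m0 Hm] := pow_gap K0 eta0.
have m1 : 1 <= m%:R :> R by rewrite ler1n.
have KA : K <= A by move: K3 A00; rewrite /A; clear; lra.
have Km0 : 0 < K ^+ m by rewrite exprn_gt0.
have Am0 : 0 < A ^+ m by rewrite exprn_gt0.
have KAm : K ^+ m <= A ^+ m by rewrite lerXn2r ?nnegrE // ltW.
pose D : C := ((2 * A ^+ m)%:C)%C.
have Dm : modulus D = 2 * A ^+ m by rewrite /D md_real gtr0_norm // mulr_gt0.
have D0 : 0 < 2 * A ^+ m by rewrite mulr_gt0.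
have Dn : D != 0 by rewrite -md_gt0 Dm.
pose KC : C := (K%:C)%C.
have mKC : modulus (KC ^+ m) = K ^+ m by rewrite mdX md_real gtr0_norm.
pose G x := D^-1 * (g x ^+ m + - KC ^+ m).
have mG x : modulus (G x) = modulus (g x ^+ m - KC ^+ m) / (2 * A ^+ m).
  by rewrite /G mdM mdV Dm mulrC.
have hG : holo G 1.
  move=> x xr; apply: cdiffM; first exact: cdiff_cst.
  apply: cdiffD; last exact: cdiff_cst.
  by apply: cdiffX; apply: hg; apply: lt1; exact: ltW.
have G1 x : modulus x < 1 -> modulus (G x) <= 1.
  move=> xr; rewrite mG ler_pdivrMr // mul1r; apply: le_trans (mdB _ _) _.
  rewrite mKC mdX; have : modulus (g x) ^+ m <= A ^+ m.
    by rewrite lerXn2r ?nnegrE ?md_ge0 ?gA ?(ltW xr) // ltW.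
  by move: KAm; clear; lra.
have half : (M / K) ^+ m <= 1 / 2.
  have q0 : 0 <= M / K by rewrite divr_ge0 // ltW.
  have q2 : M / K <= 1 / 2 by rewrite ler_pdivrMr //; move: K2; clear; lra.
  rewrite -(prednK m0) exprS -[leRHS]mulr1 ler_pM ?exprn_ge0 //.
  by rewrite exprn_ile1 //; move: q2; clear; lra.
have MmK : M ^+ m <= K ^+ m / 2 by move: half; rewrite expr_div_n ler_pdivrMr //; clear; lra.
have g0M : modulus (g 0) <= M by apply: gM; rewrite md0 ltW.
have g0m : modulus (g 0) ^+ m <= K ^+ m / 2.
  by apply: le_trans MmK; rewrite lerXn2r ?nnegrE ?md_ge0 // ltW.
have G0lo : K ^+ m / (4 * A ^+ m) <= modulus (G 0).
  rewrite mG ler_pdivlMr // ; have -> : K ^+ m / (4 * A ^+ m) * (2 * A ^+ m) = K ^+ m / 2.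
    by field; rewrite gt_eqF.
  have := mdB (g 0 ^+ m) (g 0 ^+ m - KC ^+ m); rewrite opprB addrC subrK mKC mdX; move: g0m; clear; lra.
have G0hi : modulus (G 0) <= K ^+ m / A ^+ m.
  rewrite mG ler_pdivrMr //; have -> : K ^+ m / A ^+ m * (2 * A ^+ m) = 2 * K ^+ m.
    by field; rewrite gt_eqF.
  have := mdB (g 0 ^+ m) (KC ^+ m); rewrite mKC mdX; move: g0m Km0; clear; lra.
have G0n : G 0 != 0.
  by rewrite -md_gt0; apply: lt_le_trans G0lo; rewrite divr_gt0 // mulr_gt0.
have kap0 : 0 <= (0 : R) < 1 by rewrite lexx ltr01.
have m00 : modulus (0 : C) <= 0 by rewrite md0.
have [zs [h [hh h1 zst Eh hn]]] := zero_factorization th301 kap0 hG G1 m00 G0n.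
have zs1 c : c \in zs -> modulus c < 1 by move=> /zst ct; apply: le_lt_trans t31.
have zsz c : c \in zs -> g c ^+ m = KC ^+ m.
  move=> cz; have c1 := zs1 c cz; apply/eqP; rewrite -subr_eq0.
  have : G c == 0 by rewrite Eh // mulf_eq0 bprod_eq0 ?cz // ltW.
  by rewrite mulf_eq0 invr_eq0 (negPf Dn).
have gcK c : c \in zs -> modulus (g c) = K.
  move=> cz; have := congr1 (@modulus R) (zsz c cz); rewrite mKC mdX => /eqP.
  by rewrite eqrXn2 ?md_ge0 ?(ltW K0) // => /eqP.
have uz : uniq zs.
  apply: contrapT => /negP nu; have [c cz dc] := double_zero hh zs1 Eh nu.
  have c1 := zs1 c cz.
  have [l dl] := hg c (lt1 c (ltW c1)).
  have dG := cderivM (cderiv_cst D^-1 c) (cderivD (cderivX m dl) (cderiv_cst (- KC ^+ m) c)).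
  have := cderiv_unique dc dG; rewrite mul0r add0r addr0 => /esym/eqP.
  have gcn : g c != 0 by rewrite -md_gt0 gcK.
  rewrite !mulf_eq0 invr_eq0 (negPf Dn) expf_eq0 (negPf gcn) andbF /= orbF.
  rewrite pnatr_eq0 (gtn_eqF m0) /= => /eqP l0; rewrite l0 in dl.
  have ccs := Hcs c (zst c cz) dl.
  have Kin : K \in [seq modulus (g x) | x <- ns ++ cs].
    by apply/mapP; exists c; [rewrite mem_cat ccs orbT|rewrite gcK].
  by have := Hvs K Kin; rewrite subrr normr0 leNgt eta0.
have sz : (size zs <= m * p)%N.
  by apply: (card_roots m0 vg uz) => c cz; split; [exact: zs1|exact: zsz].
have zss c : c \in zs -> s <= modulus c.
  move=> cz; rewrite leNgt; apply/negP => cs'.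
  have := gM c (ltW cs'); rewrite gcK //; move: K2 M0; clear; lra.
have h0E : modulus (G 0) = modulus (bprod zs 0) * modulus (h 0).
  by rewrite Eh ?md0 // mdM.
have b0le : modulus (bprod zs 0) <= 1 by apply: bprod_le1 => //; rewrite md0.
have b0ge : s ^+ (m * p) <= modulus (bprod zs 0).
  apply: le_trans (bprod_ge0 s0 zss); apply: ler_wiXn2l => //; exact: ltW.
have h0lo : modulus (G 0) <= modulus (h 0).
  by rewrite h0E -[leRHS]mul1r ler_wpM2r // md_ge0.
have hn' x : modulus x < th3 -> h x != 0 by move=> xr; apply: hn; exact: ltW.
have hh3 : holo h th3 by move=> x xr; apply: hh; apply: lt_trans t31.
have h13 x : modulus x < th3 -> modulus (h x) <= 1.
  by move=> xr; apply: h1; apply: lt_trans t31.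
have h0pos : 0 < modulus (h 0) by rewrite md_gt0 hn' ?md0.
pose lKA := ln K - ln A.
have lnKA : ln (K ^+ m / A ^+ m) = m%:R * lKA.
  by rewrite ln_div ?posrE // !lnXn // /lKA -[X in X - _]mulr_natl -[X in _ - X]mulr_natl mulrBr.
have lh0lo : m%:R * lKA - ln 4 <= ln (modulus (h 0)).
  have : ln (K ^+ m / (4 * A ^+ m)) <= ln (modulus (h 0)).
    by rewrite ler_ln ?posrE ?divr_gt0 ?mulr_gt0 //; apply: le_trans h0lo.
  have -> : K ^+ m / (4 * A ^+ m) = K ^+ m / A ^+ m / 4 by field; rewrite gt_eqF.
  by rewrite (ln_div (x := K ^+ m / A ^+ m)) ?posrE ?divr_gt0 // lnKA.
have lh0hi : ln (modulus (h 0)) <= m%:R * lKA - m%:R * p%:R * ln s.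
  have : ln (s ^+ (m * p)) + ln (modulus (h 0)) <= ln (K ^+ m / A ^+ m).
    have q1 : 0 < s ^+ (m * p) by rewrite exprn_gt0.
    have q2 : 0 < K ^+ m / A ^+ m by rewrite divr_gt0.
    rewrite -lnM ?posrE // ler_ln ?posrE //; last exact: mulr_gt0.
    by apply: le_trans G0hi; rewrite h0E ler_wpM2r // md_ge0.
  rewrite lnKA lnXn // -[ln s *+ _]mulr_natl natrM; clear; lra.
have lnA : lKA >= - ln (A / (2 * M)).
  rewrite ln_div ?posrE ?mulr_gt0 // /lKA.
  have : ln (2 * M) <= ln K by rewrite ler_ln ?posrE ?mulr_gt0.
  clear; lra.
have ln4 : 0 < ln 4 :> R by rewrite ln_gt0 //; clear; lra.
have L0 : - ln (modulus (h 0)) <= m%:R * Lp.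
  have : ln 4 <= m%:R * ln 4 :> R by rewrite ler_peMl // ltW.
  have : - (m%:R * lKA) <= m%:R * ln (A / (2 * M)) by rewrite -mulrN ler_wpM2l //; move: lnA; clear; lra.
  move: lh0lo; rewrite /Lp; clear; lra.
have lip x y : modulus x <= th2 -> modulus y <= th2 ->
    ln (modulus (h x)) - ln (modulus (h y)) <= m%:R * Lam * modulus (x - y).
  move=> xr yr.
  have e2 : th2 = th2 / th3 * th3 by rewrite mulfVK // gt_eqF.
  have := @log_modulus_lipschitz R h th3 (th2 / th3) x y th30 k2 hh3 hn' h13.
  rewrite -e2 => /(_ xr yr) hl; apply: le_trans hl _.
  pose B := 8 / (1 - th2 / th3) ^+ 2; rewrite -/B.
  have B0 : 0 <= B * (modulus (x - y) / th3).
    apply: mulr_ge0; first by apply: divr_ge0 => //; exact: sqr_ge0.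
    by apply: divr_ge0; [exact: md_ge0|exact: ltW].
  rewrite [leLHS]mulrAC.
  apply: le_trans (ler_wpM2l B0 L0) _.
  by rewrite le_eqVlt; apply/orP; left; apply/eqP; rewrite /Lam -/B; ring.
pose lb := m%:R * lKA - ln 4 - m%:R.
have hlow x : modulus x <= th2 -> lb <= ln (modulus (h x)).
  move=> xr; have [n nn xn] := ns2 x xr.
  have nr := ns1 n nn.
  have n1 : modulus n < 1 by apply: le_lt_trans nr _; apply: lt_trans t23 t31.
  have hnn : K ^+ m / (4 * A ^+ m) <= modulus (h n).
    have : K ^+ m / (4 * A ^+ m) <= modulus (G n).
      rewrite mG ler_pdivlMr //; have -> : K ^+ m / (4 * A ^+ m) * (2 * A ^+ m) = K ^+ m / 2.
        by field; rewrite gt_eqF.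
      have := Hm (modulus (g n)) (md_ge0 _) (Hvs _ ltac:(apply/mapP; exists n => //; by rewrite mem_cat nn)).
      move=> hh1; apply: le_trans hh1 _.
      by have := md_dist (g n ^+ m) (KC ^+ m); rewrite mKC mdX.
    move=> hG1; apply: le_trans hG1 _; rewrite Eh // mdM -[leRHS]mul1r ler_wpM2r ?md_ge0 //.
    by apply: bprod_le1 => //; exact: ltW.
  have l1 : m%:R * lKA - ln 4 <= ln (modulus (h n)).
    have : ln (K ^+ m / (4 * A ^+ m)) <= ln (modulus (h n)).
      by rewrite ler_ln ?posrE ?divr_gt0 ?mulr_gt0 // (lt_le_trans _ hnn) // divr_gt0 // mulr_gt0.
    have -> : K ^+ m / (4 * A ^+ m) = K ^+ m / A ^+ m / 4 by field; rewrite gt_eqF.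
    by rewrite (ln_div (x := K ^+ m / A ^+ m)) ?posrE ?divr_gt0 // lnKA.
  have l2 := lip n x nr xr; rewrite mdC in l2.
  have : m%:R * Lam * modulus (x - n) <= m%:R.
    rewrite -mulrA -[leRHS]mulr1 ler_wpM2l // mulrC -ler_pdivlMr // mul1r.
    exact: xn.
  move: l1 l2; rewrite /lb; clear; lra.
(* A lower bound for [|h|], so that [k = beta / h] is bounded by 1. *)
pose beta := expR lb.
have beta0 : 0 < beta by exact: expR_gt0.
pose k x := ((beta%:C)%C : C) * (h x)^-1.
have kn x : modulus x < th2 -> k x != 0.
  move=> xr; rewrite mulf_neq0 ?invr_eq0 ?hn' //; last by apply: lt_trans t23.
  by rewrite -md_gt0 md_real gtr0_norm.
have hpos x : modulus x <= th2 -> 0 < modulus (h x).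
  by move=> xr; rewrite md_gt0 hn' //; apply: le_lt_trans t23.
have mk x : modulus (k x) = beta / modulus (h x) by rewrite /k mdM mdV md_real gtr0_norm.
have k1' x : modulus x < th2 -> modulus (k x) <= 1.
  move=> xr; rewrite mk ler_pdivrMr ?hpos ?(ltW xr) // mul1r.
  by rewrite -[leRHS]lnK ?posrE ?hpos ?(ltW xr) // ler_expR hlow // ltW.
have hk : holo k th2.
  move=> x xr; apply: cdiffM; first exact: cdiff_cst.
  by apply: cdiffV; [apply: hn'; apply: lt_trans t23|apply: hh3; apply: lt_trans t23].
have lnk x : modulus x <= th2 -> ln (modulus (k x)) = lb - ln (modulus (h x)).
  by move=> xr; rewrite mk ln_div ?posrE ?hpos // /beta expRK.
have e1 : th = th / th2 * th2 by rewrite mulfVK // gt_eqF.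
have z2 : modulus z <= th2 by apply: le_trans zth (ltW t12).
have := @log_modulus_lipschitz R k th2 (th / th2) 0 z th20 k1 hk kn k1'.
rewrite -e1 md0 => /(_ (ltW t0) zth); rewrite sub0r mdN -/C1 !lnk ?md0 ?(ltW th20) // => hz.
set B0 := - (lb - ln (modulus (h 0))) in hz.
have B0hi : B0 <= m%:R * p%:R * c3.
  have l44 : ln 4 <= 2 :> R.
    have -> : 4 = 2 * 2 :> R by ring.
    rewrite lnM ?posrE //; have := ln_le_sub1 (ltr0n R 2); clear; lra.
  have pm : 1 <= m%:R * p%:R :> R by rewrite -[leLHS]mulr1 ler_pM.
  have mp : m%:R <= m%:R * p%:R :> R by rewrite ler_peMr.
  move: lh0hi l44 pm mp; rewrite /B0 /lb /c3; clear; lra.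
have B0lo : 0 <= B0.
  by have := hlow 0; rewrite md0 => /(_ (ltW th20)); rewrite /B0; clear; lra.
have zr : modulus z / th2 <= 1 by rewrite ler_pdivrMr // mul1r.
have hz2 : ln (modulus (h z)) <= lb + (1 + C1) * B0.
  have : C1 * B0 * (modulus z / th2) <= C1 * B0 by rewrite ler_piMr // mulr_ge0 // ltW.
  move: hz; rewrite /B0; clear; lra.
(* The terms [m * lKA] are the only ones that depend on [A]; they are removed by the
   normalization of [G]. *)
have hz3 : ln (modulus (h z)) <= m%:R * lKA + m%:R * (E * p%:R) - ln 4.
  have : (1 + C1) * B0 <= (1 + C1) * (m%:R * p%:R * c3) by rewrite ler_wpM2l //; apply: addr_ge0 => //; exact: ltW.
  have -> : (1 + C1) * (m%:R * p%:R * c3) = m%:R * (E * p%:R) by rewrite /E; ring.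
  move: hz2 (ler0n R m); rewrite /lb; clear; lra.
have z1 : modulus z < 1 by apply: le_lt_trans zth t1.
have hz4 : modulus (h z) <= K ^+ m / A ^+ m * expR (m%:R * (E * p%:R)) / 4.
  have X0 : 0 < K ^+ m / A ^+ m by rewrite divr_gt0.
  have Y0 : 0 < K ^+ m / A ^+ m * expR (m%:R * (E * p%:R)) by rewrite mulr_gt0 ?expR_gt0.
  rewrite -ler_ln ?posrE; [|exact: hpos|exact: divr_gt0].
  rewrite (ln_div (y := 4)) ?posrE // lnM ?posrE ?expR_gt0 //.
  by rewrite expRK lnKA.
have Gz : modulus (G z) <= modulus (h z).
  rewrite Eh // mdM -[leRHS]mul1r ler_wpM2r ?md_ge0 //.
  by apply: bprod_le1 => //; exact: ltW.
have gz : modulus (g z ^+ m - KC ^+ m) <= K ^+ m * expR (m%:R * (E * p%:R)).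
  have := le_trans Gz hz4; rewrite mG ler_pdivrMr // => hgz; apply: le_trans hgz _.
  have -> : K ^+ m / A ^+ m * expR (m%:R * (E * p%:R)) / 4 * (2 * A ^+ m) =
    K ^+ m * expR (m%:R * (E * p%:R)) / 2 by field; rewrite gt_eqF.
  have : 0 < K ^+ m * expR (m%:R * (E * p%:R)) by rewrite mulr_gt0 ?expR_gt0.
  clear; lra.
have gz2 : modulus (g z) ^+ m <= (2 * K * expR (E * p%:R)) ^+ m.
  rewrite -mdX -[g z ^+ m](subrK (KC ^+ m)); apply: le_trans (mdD _ _) _.
  rewrite mKC !exprMn.
  have -> : expR (E * p%:R) ^+ m = expR (m%:R * (E * p%:R)) by rewrite -expRM_natl.
  have e1' : 1 <= expR (m%:R * (E * p%:R)).
    apply: le_trans (expR_ge1Dx _); rewrite lerDl mulr_ge0 //.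
    by apply: mulr_ge0 => //; exact: ltW.
  have k4 : K ^+ m <= K ^+ m * expR (m%:R * (E * p%:R)) by rewrite ler_peMr // ltW.
  have two : 2 <= 2 ^+ m :> R.
    rewrite -(prednK m0) exprS -[leLHS]mulr1 ler_pM2l // exprn_ege1 //; clear; lra.
  have kp : 0 < K ^+ m * expR (m%:R * (E * p%:R)) by rewrite mulr_gt0 ?expR_gt0.
  have := ler_wpM2r (ltW kp) two.
  move: gz k4; move: (2 ^+ m) (K ^+ m) (expR (m%:R * _)) (modulus _) => a b c d; clear; lra.
have gz3 : modulus (g z) <= 2 * K * expR (E * p%:R).
  move: gz2; rewrite ler_pXn2r ?nnegrE ?md_ge0 //.
  by rewrite !mulr_ge0 ?expR_ge0 // ltW.
apply: le_trans gz3 _.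
have -> : (E + 3) * p%:R = E * p%:R + 3 * p%:R by ring.
rewrite expRD.
have e8p : 8 <= expR (3 * p%:R) :> R.
  have : expR 3 <= expR (3 * p%:R) :> R by rewrite ler_expR; move: p1; clear; lra.
  exact: le_trans e8.
have ep := expR_gt0 (E * p%:R).
have a1 := ler_wpM2l (ltW ep) K3.
have MX : 0 < M * expR (E * p%:R) by rewrite mulr_gt0.
have a2 := ler_wpM2l (ltW MX) e8p.
move: MX a1 a2; move: (expR (E * _)) (expR (3 * _)) => a b; clear; lra.
Qed.

End DoublingTheorem.

(** * Lebesgue length and the Remez inequality for polynomials *)

Section Length.
Variable R : realType.
Implicit Types (A B W J : set R) (a b d s x y : R).

Lemma len_le A B : A `<=` B -> (len A <= len B)%E.
Proof. by move=> AB; exact: (@le_outer_measure R _ ((wlength (@idfun R))^*)%mu A B AB). Qed.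

Lemma lenU A B : (len (A `|` B) <= len A + len B)%E.
Proof. exact: outer_measureU2. Qed.

Lemma len_cc a b : a <= b -> len `[a, b]%classic = (b - a)%:E.
Proof.
move=> ab; rewrite (_ : len _ = lebesgue_measure `[a, b]%classic) // lebesgue_measure_itv /=.
rewrite lte_fin; case: ltP => // ba.
by rewrite (_ : b - a = 0) //; apply/eqP; rewrite subr_eq0 eq_le ba ab.
Qed.

Lemma len0 : len (set0 : set R) = 0%E.
Proof. exact: outer_measure0. Qed.

(** Greedy choice from the left: a point of [W] is chosen close to the infimum, and the
    points at distance less than [d] to its right are discarded, which lowers the length
    by [d] and an arbitrarily small amount. *)
Lemma separated_points (q : nat) (d : R) W : 0 <= d -> (exists b, forall x, W x -> b <= x) ->
  ((q%:R * d)%:E < len W)%E -> exists x : nat -> R,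
    (forall i, (i <= q)%N -> W (x i)) /\ (forall i, (i < q)%N -> x i + d <= x i.+1).
Proof.
move=> d0; elim: q W => [|q IH] W [b Wb] hW.
  have [x Wx] : exists x, W x.
    apply: contrapT => nW; move: hW; rewrite mul0r.
    rewrite (_ : W = set0) ?len0 ?ltxx //.
    by rewrite -subset0 => x Wx; apply: nW; exists x.
  by exists (fun=> x).
have [e e0 he] : exists2 e, 0 < e & (((q.+1%:R * d + e)%:E) < len W)%E.
  case: (len W) hW => [m| |] //=; last by exists 1; rewrite ?ltry.
  rewrite lte_fin => h; exists ((m - q.+1%:R * d) / 2); first lra.
  by rewrite lte_fin; lra.
have W0 : W !=set0.
  apply/set0P/negP => /eqP W0; move: hW; rewrite W0 len0 lte_fin ltNge.
  by rewrite mulr_ge0 // ler0n.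
have hinf : has_inf W by split => //; exists b => x /Wb.
have [x0 Wx0 x0e] := inf_adherent e0 hinf.
pose W' := W `&` [set x | x0 + d <= x].
have hW' : ((q%:R * d)%:E < len W')%E.
  have h1 : (len W <= (d + e)%:E + len W')%E.
    have sub : W `<=` `[inf W, x0 + d]%classic `|` W'.
      move=> x Wx; case: (leP (x0 + d) x) => h; first by right.
      left; rewrite /= in_itv /= (ltW h) andbT; apply: ge_inf => //.
      by exists b => y /Wb.
    apply: le_trans (len_le sub) _; apply: le_trans (lenU _ _) _.
    rewrite leeD2r //; have := ge_inf (hinf.2) Wx0 => h2.
    by rewrite len_cc; rewrite ?lee_fin; lra.
  have h2 := lt_le_trans he h1.
  case: (len W') h2 => [m| |] //=; rewrite ?ltry //.
  by rewrite -EFinD !lte_fin -natr1; lra.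
have [|x [hx1 hx2]] := IH W' _ hW'; first by exists b => x [/Wb].
exists (fun i => if i is i'.+1 then x i' else x0); split.
  by case=> [//|i] iq; have [] := hx1 i iq.
case=> [|i] iq; first by have [_] := hx1 0%N isT.
exact: hx2.
Qed.

End Length.

Section Lagrange.
Variable R : realType.
Local Notation C := R[i].

Lemma prod_dist (q j : nat) : (j <= q)%N ->
  (\prod_(i < q.+1 | i != j :> nat) (maxn i j - minn i j) = j`! * (q - j)`!)%N.
Proof.
elim: q => [|q IH]; rewrite leq_eqVlt => /predU1P[jq|].
- by rewrite jq big_mkcond big_ord1.
- by [].
- rewrite jq subnn fact0 muln1 big_mkcond big_ord_recr /= eqxx muln1.
  rewrite fact_prod big_add1 /= big_mkord (reindex_inj rev_ord_inj) /=.
  apply: eq_bigr => i _; have iq := ltn_ord i.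
  rewrite (_ : ((q.+1 - i.+1)%N != q.+1) = true); last by apply/eqP; lia.
  have -> : maxn (q.+1 - i.+1)%N q.+1 = q.+1 by apply/maxn_idPr; lia.
  have -> : minn (q.+1 - i.+1)%N q.+1 = (q.+1 - i.+1)%N by apply/minn_idPl; lia.
  by lia.
rewrite ltnS => jq; rewrite big_mkcond big_ord_recr /= -big_mkcond IH //.
have -> : (q.+1 != j) by apply/eqP; lia.
have -> : maxn q.+1 j = q.+1 by apply/maxn_idPl; lia.
have -> : minn q.+1 j = j by apply/minn_idPr; lia.
by rewrite -mulnA subSn // factS [(_ * (q - j)`!)%N]mulnC.
Qed.

Lemma expR1_le4 : expR 1 <= 4 :> R.
Proof.
have h : 1 / 2 <= expR (- (1 / 2)) :> R by have := expR_ge1Dx (- (1 / 2) : R); lra.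
have : 1 / 4 <= expR (- 1) :> R.
  have -> : - 1 = - (1 / 2) + - (1 / 2) :> R by field.
  rewrite expRD; nra.
rewrite expRN => h2; rewrite -[leLHS]invrK -[leRHS]invrK lef_pV2 ?posrE ?invr_gt0 ?expR_gt0 //.
by apply: le_trans h2; lra.
Qed.

(** By induction, since [(1 + 1 / q.+1) ^+ q.+1 <= e <= 4]. *)
Lemma fact_growth (q : nat) : (q.+1%:R ^+ q : R) <= 8 ^+ q * (q`!)%:R.
Proof.
have e4 := expR1_le4.
elim: q => [|q IH]; first by rewrite !expr0 fact0 mul1r.
have q0 : 0 < q.+1%:R :> R by rewrite ltr0n.
have h1 : (q.+2%:R / q.+1%:R) ^+ q.+1 <= 4 :> R.
  apply: le_trans e4.
  have -> : expR 1 = expR (q.+1%:R^-1) ^+ q.+1 :> R.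
    by rewrite -expRM_natl divff // gt_eqF.
  apply: lerXn2r; rewrite ?nnegrE ?expR_ge0 ?divr_ge0 //.
  apply: le_trans (expR_ge1Dx _).
  have -> : q.+2%:R = q.+1%:R + 1 :> R by rewrite natr1.
  by rewrite mulrDl divff ?gt_eqF // mul1r.
have h2 : q.+2%:R ^+ q.+1 <= 4 * q.+1%:R ^+ q.+1 :> R.
  by rewrite -ler_pdivrMr ?exprn_gt0 // -expr_div_n.
apply: le_trans h2 _.
rewrite exprS factS natrM [8 ^+ _]exprS.
have : 4 * (q.+1%:R * q.+1%:R ^+ q) <= 4 * (q.+1%:R * (8 ^+ q * (q`!)%:R)) :> R.
  by rewrite ler_pM2l // ler_pM2l.
move=> h3; apply: le_trans h3 _.
have : 0 <= q.+1%:R * (8 ^+ q * (q`!)%:R) :> R by rewrite !mulr_ge0 ?exprn_ge0.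
lra.
Qed.

(** Lagrange interpolation: at the [j]-th node the denominator is at least
    [d ^+ q * j`! * (q - j)`!], and the binomial coefficients sum to [2 ^+ q]. *)
Lemma lagrange_bound (q : nat) (x : nat -> R) (d l S : R) (P : {poly C}) (z : C) :
  0 < d -> (forall i, (i < q)%N -> x i + d <= x i.+1) -> (size P <= q.+1)%N ->
  (forall i, (i <= q)%N -> modulus (z - (x i)%:C%C) <= l) ->
  (forall i, (i <= q)%N -> modulus (P.[(x i)%:C%C]) <= S) ->
  modulus P.[z] <= S * ((2 * l / d) ^+ q / (q`!)%:R).
Proof.
move=> d0 xd sP zl PS.
have S0 : 0 <= S by apply: le_trans (PS 0%N isT); exact: md_ge0.
have l0 : 0 <= l by apply: le_trans (zl 0%N isT); exact: md_ge0.
have gap i j : (i <= j)%N -> (j <= q)%N -> (j - i)%:R * d <= x j - x i.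
  move=> ij; elim: j ij => [|j IH].
    by rewrite leqn0 => /eqP -> _; rewrite subnn mul0r subrr.
  rewrite leq_eqVlt => /predU1P[->|]; first by rewrite subnn mul0r subrr.
  rewrite ltnS => ij jq; have := IH ij (ltnW jq); have := xd j jq.
  rewrite subSn // -natr1; lra.
have dist (i j : nat) : (i <= q)%N -> (j <= q)%N ->
    (maxn i j - minn i j)%:R * d <= modulus ((x j)%:C%C - (x i)%:C%C : C).
  move=> iq jq.
  have -> : (x j)%:C%C - (x i)%:C%C = (x j - x i)%:C%C :> C by rewrite rmorphB.
  rewrite md_real.
  case: (leqP i j) => ij.
    by apply: le_trans (gap i j ij jq) (ler_norm _).
  by rewrite distrC; apply: le_trans (gap j i (ltnW ij) iq) (ler_norm _).
pose X (i : 'I_q.+1) : C := (x i)%:C%C.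
pose L (j : 'I_q.+1) : {poly C} := \prod_(i | i != j) ('X - (X i)%:P).
have Xn (i j : 'I_q.+1) : i != j -> X j - X i != 0.
  move=> ij; rewrite -md_gt0.
  have iq : (i <= q)%N by rewrite -ltnS ltn_ord.
  have jq : (j <= q)%N by rewrite -ltnS ltn_ord.
  have ne : (i : nat) != j by [].
  have m0 : (0 < maxn i j - minn i j)%N.
    move: ne; rewrite neq_ltn => /orP[h|h].
      by rewrite (maxn_idPr (ltnW h)) (minn_idPl (ltnW h)) subn_gt0.
    by rewrite (maxn_idPl (ltnW h)) (minn_idPr (ltnW h)) subn_gt0.
  have := dist i j iq jq; rewrite /X; apply: lt_le_trans.
  by rewrite mulr_gt0 // ltr0n.
have Ljj (j : 'I_q.+1) : (L j).[X j] != 0.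
  rewrite horner_prod; apply/prodf_neq0 => i ij; rewrite !hornerE; exact: Xn.
have Lji (i j : 'I_q.+1) : i != j -> (L j).[X i] = 0.
  by move=> ij; rewrite horner_prod (bigD1 i) //= !hornerE subrr mul0r.
have cardj (j : 'I_q.+1) : #|[pred i | i != j]| = q.
  have h := cardC1 j; rewrite card_ord /= in h.
  by apply: etrans h; apply: eq_card => i; rewrite !inE.
have sL j : (size (L j) <= q.+1)%N.
  rewrite /L size_prod; last by move=> i _; rewrite polyXsubC_eq0.
  rewrite (eq_bigr (fun=> 2%N)); last by move=> i _; rewrite size_XsubC.
  rewrite sum_nat_const cardj; lia.
have PE : P = \sum_j (P.[X j] / (L j).[X j]) *: L j.
  apply/eqP; rewrite -subr_eq0; apply/eqP; set D := P - _.
  have sD : (size D <= q.+1)%N.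
    rewrite /D (leq_trans (size_polyD _ _)) // geq_max sP size_polyN /=.
    apply: leq_trans (size_sum _ _ _) _; apply/bigmax_leqP => j _.
    exact: leq_trans (size_scale_leq _ _) (sL j).
  have rD (i : 'I_q.+1) : root D (X i).
    rewrite /root /D !hornerE horner_sum (bigD1 i) //= big1 ?addr0.
      by rewrite hornerZ mulfVK // subrr.
    move=> j ji; have ij : i != j by rewrite eq_sym.
    by rewrite hornerZ (Lji _ _ ij) mulr0.
  apply: contraTeq sD => Dn; rewrite -ltnNge.
  have := max_poly_roots Dn (rs := map X (enum 'I_q.+1)).
  rewrite size_map size_enum_ord; apply.
    by apply/allP => _ /mapP[i _ ->]; exact: rD.
  rewrite map_inj_uniq ?enum_uniq // => i j Xij; apply/eqP; apply: contrapT => /negP ij.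
  by have := Xn i j ij; rewrite Xij subrr eqxx.
rewrite {1}PE horner_sum; apply: le_trans (md_sum _ _ _) _.
have bound (j : 'I_q.+1) : modulus ((P.[X j] / (L j).[X j]) *: L j).[z] <=
    S * ((l / d) ^+ q / (q`!)%:R) * 'C(q, j)%:R.
  have jq : (j <= q)%N by rewrite -ltnS ltn_ord.
  have f0 : 0 < (j`! * (q - j)`!)%:R :> R by rewrite ltr0n muln_gt0 !fact_gt0.
  have h1 : modulus (L j).[z] <= l ^+ q.
    rewrite horner_prod.
    have -> : modulus (\prod_(i | i != j) ('X - (X i)%:P).[z]) = \prod_(i | i != j) modulus (z - X i).
      elim/big_rec2: _ => [|i a b _ <-]; first by rewrite md1.
      by rewrite mdM !hornerE.
    apply: le_trans (_ : \prod_(i < q.+1 | i != j) l <= _); last by rewrite prodr_const cardj.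
    by apply: ler_prod => i _; rewrite md_ge0 zl // -ltnS ltn_ord.
  have h2 : d ^+ q * (j`! * (q - j)`!)%:R <= modulus (L j).[X j].
    rewrite horner_prod.
    have -> : modulus (\prod_(i | i != j) ('X - (X i)%:P).[X j]) = \prod_(i | i != j) modulus (X j - X i).
      elim/big_rec2: _ => [|i a b _ <-]; first by rewrite md1.
      by rewrite mdM !hornerE.
    rewrite -(prod_dist jq) natr_prod.
    have -> : d ^+ q = \prod_(i < q.+1 | i != j) d by rewrite prodr_const cardj.
    rewrite -big_split /=; apply: ler_prod => i _; rewrite mulr_ge0 ?(ltW d0) //=.
    by rewrite mulrC dist // -ltnS ltn_ord.
  have Lp : 0 < modulus (L j).[X j] by rewrite md_gt0.
  have dq : 0 < d ^+ q by rewrite exprn_gt0.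
  rewrite hornerZ mdM mdM mdV.
  have -> : S * ((l / d) ^+ q / (q`!)%:R) * 'C(q, j)%:R =
      S * (d ^+ q * (j`! * (q - j)`!)%:R)^-1 * l ^+ q.
    rewrite -(bin_fact jq) natrM expr_div_n.
    have c0 : 'C(q, j)%:R != 0 :> R by rewrite pnatr_eq0 -lt0n bin_gt0.
    move: c0 (lt0r_neq0 f0) (lt0r_neq0 dq).
    move: ('C(q, j)%:R) ((j`! * (q - j)`!)%:R) (d ^+ q) => a b c a0 b0 c0.
    by field; rewrite a0 b0 c0.
  apply: ler_pM => //; rewrite ?md_ge0 //.
    by apply: mulr_ge0; rewrite ?invr_ge0 md_ge0.
  apply: ler_pM; rewrite ?invr_ge0 ?md_ge0 //.
    by apply: PS; rewrite -ltnS ltn_ord.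
  by rewrite lef_pV2 ?posrE // mulr_gt0.
apply: le_trans (ler_sum _ (fun j _ => bound j)) _.
rewrite -mulr_sumr.
have -> : \sum_(i < q.+1) ('C(q, i)%:R : R) = 2 ^+ q.
  have -> : 2 = 1 + 1 :> R by ring.
  by rewrite exprDn; apply: eq_bigr => i _; rewrite !expr1n mul1r.
have -> : 2 * l / d = 2 * (l / d) by rewrite mulrA.
rewrite [(2 * _) ^+ q]exprMn le_eqVlt; apply/orP; left; apply/eqP.
by move: (2 ^+ q) ((l / d) ^+ q) => a b; ring.
Qed.

(** Interpolation at [q + 1] points of [W] whose mutual distances are multiples of
    [mu / (2 (q + 1))]; by [fact_growth] the factorial absorbs the power of [q + 1]. *)
Theorem polynomial_remez (q : nat) (W : set R) (mu l S : R) (P : {poly C}) (z : C) :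
  0 < mu -> len W = mu%:E -> (exists b, forall x, W x -> b <= x) -> (size P <= q.+1)%N ->
  (forall x, W x -> modulus (z - x%:C%C) <= l) -> (forall x, W x -> modulus P.[x%:C%C] <= S) ->
  modulus P.[z] <= S * (32 * l / mu) ^+ q.
Proof.
move=> mu0 lW bW sP zl PS.
pose d := mu / (2 * q.+1%:R).
have q0 : 0 < q.+1%:R :> R by rewrite ltr0n.
have d0 : 0 < d by rewrite divr_gt0 // mulr_gt0.
have [|x [x1 x2]] := @separated_points R q d W (ltW d0) bW.
  rewrite lW lte_fin.
  have : q.+1%:R * d = mu / 2 by rewrite /d; field; rewrite gt_eqF.
  rewrite -natr1; lra.
have := @lagrange_bound q x d l S P z d0 x2 sP (fun i iq => zl _ (x1 i iq)) (fun i iq => PS _ (x1 i iq)).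
have S0 : 0 <= S by apply: le_trans (PS _ (x1 0%N isT)); exact: md_ge0.
have l0 : 0 <= l by apply: le_trans (zl _ (x1 0%N isT)); exact: md_ge0.
move=> h; apply: le_trans h _; rewrite ler_wpM2l //.
have -> : 2 * l / d = (4 * l / mu) * q.+1%:R by rewrite /d; field; rewrite !gt_eqF.
have -> : 32 * l / mu = (4 * l / mu) * 8 by field; rewrite gt_eqF.
rewrite !exprMn -!mulrA; rewrite !ler_wpM2l ?exprn_ge0 ?invr_ge0 ?(ltW mu0) //.
by rewrite ler_pdivrMr ?ltr0n ?fact_gt0 // fact_growth.
Qed.

End Lagrange.

(** * The Chebyshev inequality for a valent function *)

Section Chebyshev.
Variable R : realType.
Local Notation C := R[i].
Implicit Types (g h q : C -> C) (M rho s : R) (c x y z w : C) (zs : seq C).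

(** A function that vanishes on a disc takes the value 0 more than [p] times. *)
Lemma valent_nonzero g p (s : R) : 0 < s <= 1 -> valent g p ->
  exists2 z : C, modulus z < s & g z != 0.
Proof.
move=> /andP[s0 s1] vg; apply: contrapT => nz.
pose f (k : nat) : C := (s * (k%:R / p.+2%:R))%:C%C.
have p0 : 0 < p.+2%:R :> R by rewrite ltr0n.
have : (size [seq f k | k <- iota 0 p.+1] <= p)%N.
  apply: (vg 0).
    rewrite map_inj_uniq ?iota_uniq // => i j /complexI.
    move/(mulfI (lt0r_neq0 s0)) => /(mulIf (invr_neq0 (lt0r_neq0 p0))) /eqP.
    by rewrite eqr_nat => /eqP.
  move=> z /mapP[k]; rewrite mem_iota add0n => /andP[_ kp] ->.
  have fk : modulus (f k) < s.
    rewrite /f md_real ger0_norm; last by rewrite mulr_ge0 ?divr_ge0 // ltW.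
    rewrite -[ltRHS]mulr1 ltr_pM2l // ltr_pdivrMr // mul1r ltr_nat.
    by apply: leq_trans kp _.
  split; first exact: lt_le_trans s1.
  by apply/eqP; apply: contrapT => /negP h; apply: nz; exists (f k).
by rewrite size_map size_iota ltnn.
Qed.

(** Divide [g] by the bound [N = M exp (A p)] of [valent_doubling], where [M] is the
    supremum of [|g|] on a small disc. The quotient is bounded by 1 and at some point
    near the origin it is at least [exp (- A p) / 2]. Every zero costs a fixed factor
    there, so there are [O (p)] of them; the factor without zeros satisfies
    [- ln |h| = O (p)] at that point, hence near the origin, and Harnack's inequality
    bounds the oscillation of [ln |h|]. *)
Lemma valent_factorization (th0 : R) : 0 < th0 < 1 ->
  exists rho th B E : R, [/\ [/\ th0 < rho, rho < 1, 0 <= th & th < 1], 0 < B, 0 < E &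
  forall g p s1, 1 < s1 -> holo g s1 -> (0 < p)%N -> valent g p ->
  exists (N : R) zs h, [/\ 0 < N, (size zs)%:R <= B * p%:R,
    forall c, c \in zs -> modulus c <= th,
    forall z, modulus z <= th0 / rho ->
      h z != 0 /\ g (rho%:C%C * z) = N%:C%C * (bprod zs z * h z) &
    forall x y, modulus x <= th0 / rho -> modulus y <= th0 / rho ->
      ln (modulus (h x)) - ln (modulus (h y)) <= E * p%:R]].
Proof.
move=> /andP[t00 t01].
pose tG := (1 + th0) / 2; pose rho := (1 + tG) / 2.
have [h1 h2 h3] : [/\ th0 < tG, tG < rho & rho < 1] by rewrite /rho /tG; split; lra.
have tG0 : 0 < tG by lra.
have r0 : 0 < rho by lra.
pose th := tG / rho.
have th01 : 0 <= th < 1.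
  by apply/andP; split; [apply: divr_ge0; exact: ltW|rewrite ltr_pdivrMr // mul1r].
have th0' : 0 < th by rewrite divr_gt0.
pose s := tG / 32.
have s01 : 0 < s < 1 by rewrite /s; apply/andP; split; lra.
have rho01 : 0 < rho < 1 by rewrite r0.
have [A A0 HA] := valent_doubling s01 rho01.
pose kap := th / 32.
have kap01 : 0 <= kap < 1 by case/andP: th01 => *; rewrite /kap; apply/andP; split; lra.
have /andP[b0 b1] := bbound01 th01 kap01.
have lb : ln (bbound th kap) < 0 by rewrite ln_lt0 // b0.
pose B := (2 * A + 2) / - ln (bbound th kap).
have B0 : 0 < B by rewrite divr_gt0 // ?oppr_gt0 //; lra.
pose kap2 := th0 / tG.
have k201 : 0 <= kap2 < 1.
  by apply/andP; split; [apply: divr_ge0; exact: ltW|rewrite ltr_pdivrMr // mul1r].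
have k2p : 0 < 8 / (1 - kap2) ^+ 2.
  by case/andP: k201 => _ k; rewrite divr_gt0 // exprn_gt0 // subr_gt0.
pose E := 8 / (1 - kap2) ^+ 2 * (2 * (A + 1)) * 2.
have E0 : 0 < E by rewrite /E mulr_gt0 // mulr_gt0 //; lra.
exists rho, th, B, E; split => //.
  by split; [exact: lt_trans h2|by []|case/andP: th01|case/andP: th01].
move=> g p s1 s11 hg p0 vg.
have p1 : 1 <= p%:R :> R by rewrite ler1n.
have [s0 s1'] := andP s01.
have lt1 x : modulus x <= 1 -> modulus x < s1 by move=> h; apply: le_lt_trans s11.
have [M0 M00 HM0] := cdiff_bounded ltr01 (fun x xr => hg x (lt1 x xr)).
pose V := [set modulus (g z) | z in [set z : C | modulus z <= s]].
have [z1 z1s gz1] := valent_nonzero (introT andP (conj s0 (ltW s1'))) vg.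
have V1 : V (modulus (g z1)) by exists z1 => //=; exact: ltW.
have hsup : has_sup V.
  split; first by exists (modulus (g z1)).
  by exists M0 => _ [z /= zs <-]; apply: HM0; apply: le_trans zs (ltW s1').
pose M := sup V.
have Mge v : V v -> v <= M by move=> Vv; apply: ub_le_sup => //; exact: hsup.2.
have M_gt0 : 0 < M by apply: lt_le_trans (Mge _ V1); rewrite md_gt0.
have [_ [z0 /= z0s <-] z0M] := sup_adherent (ltac:(lra) : 0 < M / 2) hsup.
have {}z0M : M / 2 < modulus (g z0) by move: z0M; rewrite -/M; lra.
have dbl := HA g p s1 M s11 hg p0 vg M_gt0 (fun z zz => Mge _ (ex_intro2 _ _ z zz erefl)).
pose N := M * expR (A * p%:R).
have N0 : 0 < N by rewrite mulr_gt0 ?expR_gt0.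
have NC0 : (N%:C)%C != 0 :> C by rewrite -md_gt0 md_real gtr0_norm.
have rC0 : (rho%:C)%C != 0 :> C by rewrite -md_gt0 md_real gtr0_norm.
pose H z := (N%:C)%C^-1 * g ((rho%:C)%C * z + 0).
have mrz z : modulus ((rho%:C)%C * z + 0) = rho * modulus z.
  by rewrite addr0 mdM md_real gtr0_norm.
have hH : holo H 1.
  move=> z zz; apply: cdiffM; first exact: cdiff_cst.
  apply: cdiff_affine; apply: hg; apply: lt1; rewrite mrz.
  by rewrite mulr_ile1 ?md_ge0 // ltW.
have H1 z : modulus z < 1 -> modulus (H z) <= 1.
  move=> zz; rewrite /H mdM mdV md_real gtr0_norm // mulrC ler_pdivrMr // mul1r.
  by apply: dbl; rewrite mrz ler_piMr ?ltW.
pose z0' := z0 / (rho%:C)%C.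
have z0k : modulus z0' <= kap.
  rewrite /z0' mdM mdV md_real gtr0_norm // ler_pdivrMr //.
  by have -> : kap * rho = s by rewrite /kap /th /s; field; rewrite gt_eqF.
have gz0 : g ((rho%:C)%C * z0' + 0) = g z0 by rewrite addr0 /z0' mulrC mulfVK.
have Hz0 : expR (- (A * p%:R)) / 2 <= modulus (H z0').
  rewrite /H gz0 mdM mdV md_real gtr0_norm // [leRHS]mulrC ler_pdivlMr // /N.
  have -> : expR (- (A * p%:R)) / 2 * (M * expR (A * p%:R)) =
    M / 2 * (expR (- (A * p%:R)) * expR (A * p%:R)) by ring.
  by rewrite -expRD addrC subrr expR0 mulr1 ltW.
have Hpos : 0 < modulus (H z0') by apply: lt_le_trans Hz0; rewrite divr_gt0 ?expR_gt0.
have Hn0 : H z0' != 0 by rewrite -md_gt0.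
have [zs [h [hh hh1 zst Eh hn]]] := zero_factorization th01 kap01 hH H1 z0k Hn0.
have thlt : th < 1 by case/andP: th01.
have zs1 c : c \in zs -> modulus c < 1 by move=> /zst ct; apply: le_lt_trans thlt.
have z01 : modulus z0' < 1 by case/andP: kap01 => _; apply: le_lt_trans.
have ln2 : ln 2 <= 1 :> R by have := ln_le_sub1 (ltr0n R 2); lra.
have lH : - (A * p%:R) - 1 <= ln (modulus (H z0')).
  have : ln (expR (- (A * p%:R)) / 2) <= ln (modulus (H z0')).
    by rewrite ler_ln ?posrE // divr_gt0 ?expR_gt0.
  rewrite ln_div ?posrE ?expR_gt0 // expRK; move: ln2; clear; lra.
have szs : (size zs)%:R <= B * p%:R.
  have hb : modulus (H z0') <= modulus (bprod zs z0').
    by rewrite Eh // mdM -[leRHS]mulr1 ler_wpM2l ?md_ge0 // hh1.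
  have bpos : 0 < modulus (bprod zs z0') by apply: lt_le_trans hb.
  have hb2 := bprod_bound th01 kap01 zst z0k.
  have : ln (modulus (bprod zs z0') ^+ 2) <= ln (bbound th kap ^+ size zs).
    by rewrite ler_ln ?posrE ?exprn_gt0.
  rewrite !lnXn // -[ln (bbound _ _) *+ _]mulr_natl => h4.
  have h5 : ln (modulus (H z0')) <= ln (modulus (bprod zs z0')) by rewrite ler_ln ?posrE.
  rewrite /B mulrAC ler_pdivlMr ?oppr_gt0 //.
  move: h4 h5 lH p1; rewrite mulr2n; clear; lra.
have hh3 : holo h th by move=> x xr; apply: hh; apply: lt_trans thlt.
have hn' x : modulus x < th -> h x != 0 by move=> xr; apply: hn; exact: ltW.
have h13 x : modulus x < th -> modulus (h x) <= 1.
  by move=> xr; apply: hh1; apply: lt_trans thlt.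
pose L := - ln (modulus (h 0)).
have hpos x : modulus x < th -> 0 < modulus (h x) by move=> xr; rewrite md_gt0 hn'.
have L0 : 0 <= L.
  rewrite /L oppr_ge0; apply: le_trans (ln_le_sub1 _) _; first by apply: hpos; rewrite md0.
  by rewrite subr_le0 h13 // md0.
have z0th : modulus z0' <= 1 / 32 * th by apply: le_trans z0k _; rewrite /kap; clear; lra.
have z0lt : modulus z0' < th by apply: le_lt_trans z0th _; move: th0'; clear; lra.
have LA : L <= 2 * (A + 1) * p%:R.
  have k32 : 0 <= (1 / 32 : R) < 1 by apply/andP; split; clear; lra.
  have := @log_modulus_lipschitz R h th (1 / 32) z0' 0 th0' k32 hh3 hn' h13 z0th.
  rewrite md0 subr0 -/L => /(_ ltac:(apply: mulr_ge0 => //; exact: ltW)) hl.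
  have hz : ln (modulus (H z0')) <= ln (modulus (h z0')).
    rewrite ler_ln ?posrE ?hpos // Eh // mdM -[leRHS]mul1r ler_wpM2r ?md_ge0 //.
    by apply: bprod_le1 => //; exact: ltW.
  have zr : modulus z0' / th <= 1 / 32 by rewrite ler_pdivrMr.
  have c8 : 8 / (1 - 1 / 32) ^+ 2 <= 9 :> R.
    have -> : 8 / (1 - 1 / 32) ^+ 2 = 8192 / 961 :> R by field.
    by clear -R; lra.
  have c80 : 0 <= 8 / (1 - 1 / 32) ^+ 2 :> R by rewrite divr_ge0 ?sqr_ge0.
  have zr0 : 0 <= modulus z0' / th by rewrite divr_ge0 ?md_ge0 // ltW.
  have hl2 : 8 / (1 - 1 / 32) ^+ 2 * L * (modulus z0' / th) <= 9 * L * (1 / 32).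
    apply: ler_pM => //; first exact: mulr_ge0.
    exact: ler_wpM2r.
  move: hl hl2 hz lH L0 p1; rewrite /L; clear.
  by move: (8 / _ * _ * _) => a; lra.
exists N, zs, h; split => //.
  move=> z zt; have zth : modulus z < th.
    by apply: le_lt_trans zt _; rewrite /th ltr_pM2r // invr_gt0.
  split; first exact: hn'.
  rewrite -Eh; last by apply: lt_trans thlt.
  by rewrite /H mulrA divff // mul1r addr0.
move=> x y xt yt.
have e2 : th0 / rho = kap2 * th by rewrite /kap2 /th; field; rewrite !gt_eqF.
have := @log_modulus_lipschitz R h th kap2 x y th0' k201 hh3 hn' h13.
rewrite -e2 => /(_ xt yt); rewrite -/L => hl; apply: le_trans hl _.
have xy : modulus (x - y) / th <= 2.
  have hle : th0 / rho <= th by rewrite /th ler_pM2r ?invr_gt0 // ltW.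
  rewrite ler_pdivrMr //; have := mdB x y; move: hle xt yt; clear; lra.
have xy0 : 0 <= modulus (x - y) / th by rewrite divr_ge0 ?md_ge0 // ltW.
have -> : E * p%:R = 8 / (1 - kap2) ^+ 2 * (2 * (A + 1) * p%:R) * 2 by rewrite /E; ring.
apply: ler_pM => //; first by apply: mulr_ge0 => //; exact: ltW.
by apply: ler_wpM2l => //; exact: ltW.
Qed.

(** At points of the unit disc the denominators of the Blaschke factors have modulus
    between [1 - th] and 2, and the numerators are the factors of [P]. *)
Lemma bprod_poly zs (u : R) (a0 : C) (t : R) (th : R) : 0 < u ->
  let f (t : R) : C := u%:C%C * (t%:C%C - a0) in
  (forall c, c \in zs -> modulus c <= th) -> th < 1 -> modulus (f t) <= 1 ->
  let P := u%:C%C ^+ size zs *: \prod_(c <- zs) ('X - (c / u%:C%C + a0)%:P) in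
  (1 - th) ^+ size zs * modulus (bprod zs (f t)) <= modulus P.[t%:C%C] /\
  modulus P.[t%:C%C] <= 2 ^+ size zs * modulus (bprod zs (f t)).
Proof.
move=> u0 f zst t1 ft P.
have un : (u%:C)%C != 0 :> C by rewrite -md_gt0 md_real gtr0_norm.
have PE : P.[t%:C%C] = \prod_(c <- zs) (f t - c).
  rewrite /P hornerZ; elim: (zs) => [|c l IH] /=.
    by rewrite !big_nil expr0 mul1r hornerC.
  rewrite !big_cons hornerM exprS mulrACA IH; congr (_ * _).
  by rewrite !hornerE /f; field.
rewrite PE; elim: (zs) zst => [|c l IH] zst.
  by rewrite /bprod !big_nil !expr0 !mul1r.
have [|i1 i2] := IH; first by move=> c' c'z; apply: zst; rewrite inE c'z orbT.
rewrite /bprod !big_cons (mdM (blaschke c (f t))) (mdM (f t - c)).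
have cth : modulus c <= th by apply: zst; rewrite mem_head.
have c1 : modulus c < 1 by apply: le_lt_trans t1.
have /andP[d1 d2] := blaschke_den c1 ft.
have dn := blaschke_den_neq0 c1 ft.
have dp : 0 < modulus (1 - c^*%C * f t) by rewrite md_gt0.
have fE : modulus (f t - c) = modulus (1 - c^*%C * f t) * modulus (blaschke c (f t)).
  by rewrite /blaschke !mdM mdV mulrCA divff ?mulr1 // gt_eqF.
have b0 := md_ge0 (blaschke c (f t)).
have t10 : 0 <= 1 - th by rewrite subr_ge0 ltW.
rewrite fE /= !exprS; split.
  rewrite [leLHS]mulrACA; apply: ler_pM; [by apply: mulr_ge0| | |exact: i1].
    by apply: mulr_ge0; [exact: exprn_ge0|exact: md_ge0].
  by rewrite ler_wpM2r //; lra.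
rewrite [leRHS]mulrACA; apply: ler_pM; [|exact: md_ge0| |exact: i2].
  by apply: mulr_ge0 => //; exact: md_ge0.
by rewrite ler_wpM2r.
Qed.

(** Factor [g] by [valent_factorization]. The polynomial [P] with the zeros of [g] is
    bounded on [W] by the bound for [g], divided by the zero-free factor; Remez' inequality
    carries the bound to [J], and the oscillation of the zero-free factor costs
    [exp (E p)]. *)
Theorem valent_chebyshev (th0 : R) : 0 < th0 < 1 ->
  exists2 c : R, 0 < c & forall g p s1, 1 < s1 -> holo g s1 -> (0 < p)%N -> valent g p ->
  forall (u : R) (a0 : C) (J W : set R), 0 < u ->
  is_interval J -> W `<=` J -> (0 < len W)%E ->
  (forall t, J t -> modulus (u%:C%C * (t%:C%C - a0)) <= th0) ->
  1 <= 4 * fine (len J) / fine (len W) /\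
  forall t (S : R), J t -> (forall x : R, W x -> modulus (g (u%:C%C * (x%:C%C - a0))) <= S) ->
    modulus (g (u%:C%C * (t%:C%C - a0))) <=
      (4 * fine (len J) / fine (len W)) `^ (c * p%:R) * S.
Proof.
move=> th01; have [rho [th [B [E [[r1 r2 t0 t1] B0 E0 HF]]]]] := valent_factorization th01.
have /andP[th0p th0l] := th01.
have r0 : 0 < rho by apply: lt_trans r1.
have t1' : 0 < 1 - th by rewrite subr_gt0.
pose Y := 16 / (1 - th).
have Y1 : 1 <= Y by rewrite /Y ler_pdivlMr //; lra.
have lY : 0 <= ln Y by exact: ln_ge0.
pose c := E + B * (ln Y + 1).
have c0 : 0 < c by rewrite addr_gt0 // mulr_gt0 //; lra.
exists c => // g p s1 s11 hg p0 vg u a0 J W u0 iJ WJ W0 Jth.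
have [N [zs [h [N0 szs zst gE hosc]]]] := HF g p s1 s11 hg p0 vg.
have Jb t : J t -> `|t - complex.Re a0| <= u^-1.
  move=> /Jth; rewrite mdM md_real gtr0_norm // => ht.
  have : modulus (t%:C%C - a0) <= u^-1.
    by rewrite -[leRHS]mul1r ler_pdivlMr // mulrC; apply: le_trans ht (ltW th0l).
  apply: le_trans; apply: le_trans (md_Re _).
  by case: (a0) => ? ? /=.
have lenJ : (len J <= (2 / u)%:E)%E.
  have sub : J `<=` `[complex.Re a0 - u^-1, complex.Re a0 + u^-1]%classic.
    by move=> t /Jb; rewrite /= in_itv /= ler_norml => /andP[? ?]; apply/andP; split; lra.
  have ui : 0 < u^-1 by rewrite invr_gt0.
  apply: le_trans (len_le sub) _; rewrite len_cc ?lee_fin; lra.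
have WleJ := len_le WJ.
have [l lE] : exists l : R, len J = l%:E.
  case: (len J) lenJ WleJ => [l _ _| |]; first by exists l.
    by rewrite leye_eq.
  by move=> _; rewrite leeNy_eq => /eqP W00; rewrite W00 in W0.
have [mu muE] : exists mu : R, len W = mu%:E.
  case: (len W) W0 WleJ => [m _ _| |]; [by exists m| |by []].
  by rewrite lE leye_eq.
have mu0 : 0 < mu by move: W0; rewrite muE lte_fin.
have mul' : mu <= l by move: WleJ; rewrite muE lE lee_fin.
rewrite lE muE /=; set X := 4 * l / mu.
have X4 : 4 <= X by rewrite /X ler_pdivlMr //; lra.
split; first lra.
move=> t S Jt WS.
have [x0 Wx0] : W !=set0.
  by apply/set0P/negP => /eqP W00; move: W0; rewrite W00 len0 ltxx.
have S0 : 0 <= S by apply: le_trans (WS _ Wx0); exact: md_ge0.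
pose u' := u / rho.
have u'0 : 0 < u' by rewrite divr_gt0.
have rC0 : (rho%:C)%C != 0 :> C by rewrite -md_gt0 md_real gtr0_norm.
pose f (t : R) : C := u'%:C%C * (t%:C%C - a0).
have fE (x : R) : u%:C%C * (x%:C%C - a0) = rho%:C%C * f x.
  rewrite /f /u' mulrA -rmorphM /=; congr (_%:C%C * _).
  by field; rewrite gt_eqF.
have fth (x : R) : J x -> modulus (f x) <= th0 / rho.
  move=> /Jth; rewrite fE mdM md_real gtr0_norm // => hx.
  by rewrite ler_pdivlMr // mulrC.
have f1 (x : R) : J x -> modulus (f x) <= 1.
  by move=> /fth hx; apply: le_trans hx _; rewrite ler_pdivrMr // mul1r ltW.
set n := size zs in szs *.
pose P : {poly C} := u'%:C%C ^+ size zs *: \prod_(c <- zs) ('X - (c / u'%:C%C + a0)%:P).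
have Pb (x : R) : J x -> (1 - th) ^+ n * modulus (bprod zs (f x)) <= modulus P.[x%:C%C] /\
    modulus P.[x%:C%C] <= 2 ^+ n * modulus (bprod zs (f x)).
  by move=> Jx; apply: (@bprod_poly zs u' a0 x th u'0 zst t1 (f1 x Jx)).
have sP : (size P <= n.+1)%N.
  by apply: leq_trans (size_scale_leq _ _) _; rewrite size_prod_XsubC.
have mg (x : R) : J x -> modulus (g (u%:C%C * (x%:C%C - a0))) =
    N * (modulus (bprod zs (f x)) * modulus (h (f x))).
  by move=> Jx; have [_] := gE _ (fth x Jx); rewrite fE => ->; rewrite !mdM md_real gtr0_norm.
have hp (x : R) : J x -> 0 < modulus (h (f x)).
  by move=> Jx; have [hx _] := gE _ (fth x Jx); rewrite md_gt0.
have ht := hp t Jt.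
pose S' := 2 ^+ n * (S / (N * modulus (h (f t))) * expR (E * p%:R)).
have PW (x : R) : W x -> modulus P.[x%:C%C] <= S'.
  move=> Wx; have Jx := WJ x Wx; have [_ h2] := Pb x Jx.
  apply: le_trans h2 _; rewrite /S' ler_wpM2l ?exprn_ge0 //.
  have := WS x Wx; rewrite mg // => hS.
  have hx := hp x Jx.
  have hth : modulus (h (f t)) <= modulus (h (f x)) * expR (E * p%:R).
    rewrite -ler_ln ?posrE ?mulr_gt0 ?expR_gt0 // lnM ?posrE ?expR_gt0 // expRK.
    have := hosc (f t) (f x) (fth t Jt) (fth x Jx); clear; lra.
  rewrite mulrAC ler_pdivlMr ?mulr_gt0 //.
  have b0 := md_ge0 (bprod zs (f x)).
  apply: le_trans (_ : modulus (bprod zs (f x)) * (N * (modulus (h (f x)) * expR (E * p%:R))) <= _).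
    by rewrite ler_wpM2l // ler_pM2l.
  have -> : modulus (bprod zs (f x)) * (N * (modulus (h (f x)) * expR (E * p%:R))) =
    N * (modulus (bprod zs (f x)) * modulus (h (f x))) * expR (E * p%:R) by ring.
  by rewrite ler_wpM2r // expR_ge0.
have Wl (x : R) : W x -> modulus (t%:C%C - x%:C%C : C) <= l.
  move=> Wx; have Jx := WJ x Wx.
  have -> : (t%:C)%C - (x%:C)%C = (t - x)%:C%C :> C by rewrite rmorphB.
  rewrite md_real -lee_fin -lE.
  case: (leP x t) => xt.
    rewrite ger0_norm ?subr_ge0 // -len_cc //; apply: len_le => y /=.
    by rewrite in_itv /= => yt; apply: iJ yt.
  rewrite ltr0_norm ?subr_lt0 // opprB -(len_cc (ltW xt)); apply: len_le => y /=.
  by rewrite in_itv /= => yt; apply: iJ yt.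
have bW : exists b : R, forall x : R, W x -> b <= x.
  exists (complex.Re a0 - u^-1) => x /WJ /Jb; rewrite ler_norml => /andP[]; clear; lra.
have rem := @polynomial_remez R n W mu l S' P (t%:C)%C mu0 muE bW sP Wl PW.
have [h1 _] := Pb t Jt.
rewrite mg //.
have th1n : 0 < (1 - th) ^+ n by rewrite exprn_gt0.
have final : N * (modulus (bprod zs (f t)) * modulus (h (f t))) <=
    S * expR (E * p%:R) * (Y * X) ^+ n.
  have -> : S * expR (E * p%:R) * (Y * X) ^+ n =
      N * modulus (h (f t)) * (S' * (32 * l / mu) ^+ n / (1 - th) ^+ n).
    rewrite /S'.
    have -> : Y * X = 2 * (32 * l / mu) / (1 - th) by rewrite /Y /X; field; rewrite !gt_eqF.
    rewrite [(2 * _ / _) ^+ n]expr_div_n [(2 * _) ^+ n]exprMn.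
    move: (2 ^+ n) ((32 * l / mu) ^+ n) (expR _) => a b e.
    by field; rewrite !gt_eqF.
  have NH : 0 <= N * modulus (h (f t)) by apply: mulr_ge0; exact: ltW.
  have -> : N * (modulus (bprod zs (f t)) * modulus (h (f t))) =
    N * modulus (h (f t)) * modulus (bprod zs (f t)) by ring.
  apply: ler_wpM2l => //.
  by rewrite ler_pdivlMr // mulrC; apply: le_trans h1 rem.
apply: le_trans final _.
rewrite -mulrA mulrC ler_wpM2r //.
have X0 : 0 < X by apply: lt_le_trans X4.
have Y0 : 0 < Y by apply: lt_le_trans Y1.
(* Constants to the power [p] are absorbed in powers of [X], because [X >= 4 > e]. *)
have lX : 1 <= ln X.
  rewrite -[leLHS](@expRK R 1) ler_ln ?posrE ?expR_gt0 //.
  exact: le_trans (expR1_le4 R) X4.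
have -> : (Y * X) ^+ n = expR (n%:R * (ln Y + ln X)).
  by rewrite expRM_natl expRD !lnK ?posrE.
rewrite -expRD /powR gt_eqF // ler_expR.
have q1 : E * p%:R <= E * p%:R * ln X by rewrite ler_peMr // mulr_ge0 // ltW.
have n0 : 0 <= n%:R :> R by [].
have q2 : n%:R * (ln Y + ln X) <= n%:R * ((ln Y + 1) * ln X).
  by apply: ler_wpM2l => //; have := ler_peMr lY lX; clear; lra.
have q3 : n%:R * ((ln Y + 1) * ln X) <= B * p%:R * ((ln Y + 1) * ln X).
  by apply: ler_wpM2r => //; apply: mulr_ge0; [move: lY | move: lX]; clear; lra.
move: q1 q2 q3; rewrite /c; clear; lra.
Qed.

End Chebyshev.

(** * Complex lines in the Hermitian space *)

Section AbstractDerivative.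
Variables (K : numFieldType) (n : nat).

Lemma differentiable_along D (f : 'rV[K]_n -> K) (z v : 'rV[K]_n) :
  differentiable_on D f -> D z ->
  exists l : K, forall e : K, 0 < e -> exists2 d : K, 0 < d &
    forall h : K, `|h| < d -> `|f (z + h *: v) - f z - l * h| <= e * `|h|.
Proof.
move=> /[apply] df; have dv := @diff_derivable K _ K^o f z v df.
exists ('D_v (f : 'rV[K]_n -> K^o) z) => e e0.
have /cvgrPdist_le/(_ e e0) := dv.
move=> [d /= d0 Hd]; exists d => // h hd.
have [->|h0] := eqVneq h 0.
  by rewrite scale0r addr0 subrr mulr0 subrr normr0 mulr0.
have := Hd h; rewrite /= sub0r normrN => /(_ hd h0).
rewrite /shift /= -/('D_v (f : 'rV[K]_n -> K^o) z) distrC [h *: v + z]addrC.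
set dd := 'D_v _ _; move=> H.
have -> : f (z + h *: v) - f z - dd * h = (h^-1 *: ((f (z + h *: v) : K^o) - f z) - dd) * h.
  rewrite mulrBl; congr (_ - _).
  by rewrite /GRing.scale /= mulrC mulrA divff // mul1r.
by rewrite normrM ler_pM2r ?normr_gt0.
Qed.

Lemma differentiable_bounded D (f : 'rV[K]_n -> K) (z : 'rV[K]_n) :
  differentiable_on D f -> D z ->
  exists2 d : K, 0 < d & forall y : 'rV[K]_n, (forall i, `|z ord0 i - y ord0 i| < d) -> `|f y| <= `|f z| + 1.
Proof.
move=> /[apply] df; have cf := @differentiable_continuous K _ K^o z f df.
have /cvgrPdist_le/(_ 1 ltr01) := cf.
move=> /nbhs_ballP[d /= d0 Hd]; exists d => // y yd.
have := Hd y; move=> /(_ _) H.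
have {}H : `|f z - f y| <= 1.
  by apply: H; split=> // i j; rewrite (ord1 i); exact: yd.
rewrite -[f y](subrK (f z)); apply: le_trans (ler_normD _ _) _.
by rewrite addrC lerD2l distrC.
Qed.

End AbstractDerivative.

Section Lines.
Variable R : realType.
Local Notation C := R[i].

Lemma norm_md (z : C) : `|z| = (modulus z)%:C%C.
Proof. by rewrite normc_def; case: z. Qed.

Lemma real_pos (d : C) : 0 < d -> exists2 r : R, 0 < r & d = r%:C%C.
Proof.
case: d => a b; rewrite ltcE /= => /andP[/eqP -> a0]; by exists a.
Qed.

Lemma cdiff_along n D (f : 'rV[C]_n -> C) (x v : 'rV[C]_n) (a : C) :
  differentiable_on (K := C) D f -> D (x + a *: v) -> cdiff (fun b => f (x + b *: v)) a.
Proof.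
move=> df Dz; have [l Hl] := @differentiable_along _ n D f (x + a *: v) v df Dz.
exists l => e e0.
have eC : 0 < e%:C%C :> C by rewrite ltcR.
have [d d0 Hd] := Hl _ eC; have [r r0 dE] := real_pos d0.
exists r => // b br.
have := Hd (b - a); rewrite !norm_md dE ltcR => /(_ br).
rewrite -rmorphM /= lecR.
have -> : x + a *: v + (b - a) *: v = x + b *: v.
  by rewrite -addrA -scalerDl [a + _]addrC subrK.
by [].
Qed.

Lemma locally_bounded n D (f : 'rV[C]_n -> C) (z : 'rV[C]_n) :
  differentiable_on (K := C) D f -> D z ->
  exists2 d : R, 0 < d & forall y : 'rV[C]_n, (forall i, modulus (z ord0 i - y ord0 i) < d) ->
    modulus (f y) <= modulus (f z) + 1.
Proof.
move=> df Dz; have [d d0 Hd] := @differentiable_bounded _ n D f z df Dz.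
have [r r0 dE] := real_pos d0; exists r => // y yr.
have := Hd y; rewrite !norm_md -(rmorph1 (real_complex R)) -rmorphD /= lecR; apply.
by move=> i; rewrite norm_md dE ltcR.
Qed.

Section Space.
Variable n : nat.
Implicit Types (f : 'rV[C]_n -> C) (x v : 'rV[C]_n).

Lemma enorm_sq x : enorm x ^+ 2 = \sum_(i < n) modulus (x ord0 i) ^+ 2.
Proof. by rewrite sqr_sqrtr // sumr_ge0 // => i _; exact: sqr_ge0. Qed.

Lemma enorm_ge0 x : 0 <= enorm x.
Proof. exact: sqrtr_ge0. Qed.

Lemma enorm_lt x (t : R) : 0 < t -> (enorm x < t) = (enorm x ^+ 2 < t ^+ 2).
Proof. by move=> t0; rewrite ltr_sqr ?nnegrE ?enorm_ge0 // ltW. Qed.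

Lemma enorm_gt0 v : v != 0 -> 0 < enorm v.
Proof.
move=> vn; rewrite lt0r enorm_ge0 andbT; apply: contra vn => /eqP e0.
apply/eqP/rowP => i; rewrite mxE; apply/eqP; rewrite -md_eq0.
have : \sum_(i < n) modulus (v ord0 i) ^+ 2 = 0 by rewrite -enorm_sq e0 expr0n.
move=> /eqP; rewrite psumr_eq0 => [|j _]; last exact: sqr_ge0.
by move=> /allP/(_ i (mem_index_enum _)); rewrite /= sqrf_eq0.
Qed.

Lemma enormZ (a : C) v : enorm (a *: v) = modulus a * enorm v.
Proof.
apply/eqP; rewrite -(@eqrXn2 _ 2) ?enorm_ge0 ?mulr_ge0 ?md_ge0 ?enorm_ge0 //.
rewrite exprMn !enorm_sq mulr_sumr; apply/eqP; apply: eq_bigr => i _.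
by rewrite mxE mdM exprMn.
Qed.

(** Pythagoras' theorem: [a0] is the coordinate of the foot of the perpendicular from
    the origin, and [Q] is the square of its norm. *)
Lemma line_sq x v : enorm v = 1 -> exists (a0 : C) (Q : R), 0 <= Q /\
  forall a : C, enorm (x + a *: v) ^+ 2 = Q + modulus (a - a0) ^+ 2.
Proof.
move=> v1; pose s := \sum_(i < n) (v ord0 i)^*%C * x ord0 i.
have E (a : C) : enorm (x + a *: v) ^+ 2 = (enorm x ^+ 2 - modulus s ^+ 2) + modulus (a - - s) ^+ 2.
  have h (p q : C) : modulus (p + q) ^+ 2 = modulus p ^+ 2 + modulus q ^+ 2 + 2 * complex.Re (q^*%C * p).
    by rewrite !md_sq; case: p => a1 a2; case: q => b1 b2 /=; ring.
  rewrite opprK [a + s]addrC h enorm_sq.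
  rewrite (eq_bigr (fun i : 'I_n => modulus (x ord0 i) ^+ 2 + modulus a ^+ 2 * modulus (v ord0 i) ^+ 2 +
      2 * complex.Re (a^*%C * ((v ord0 i)^*%C * x ord0 i)))); last first.
    by move=> i _; rewrite !mxE h mdM exprMn rmorphM /= mulrA.
  rewrite !big_split /= -!mulr_sumr -!enorm_sq v1 expr1n mulr1.
  have -> : \sum_(i < n) complex.Re (a^*%C * ((v ord0 i)^*%C * x ord0 i)) = complex.Re (a^*%C * s).
    by rewrite /s mulr_sumr (raddf_sum (@complex.Re R)).
  ring.
exists (- s), (enorm x ^+ 2 - modulus s ^+ 2); split=> //.
have := E (- s); rewrite subrr md0 expr0n addr0 => <-; exact: sqr_ge0.
Qed.

Lemma holo_line f r x v (a0 : C) (Q T s : R) : holomorphic_on_ball r f ->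
  (forall a : C, enorm (x + a *: v) ^+ 2 = Q + modulus (a - a0) ^+ 2) ->
  0 < r -> 0 < T -> Q + (T * s) ^+ 2 <= r ^+ 2 ->
  holo (fun z => f (x + (T%:C%C * z + a0) *: v)) s.
Proof.
move=> hf E r0 T0 Qs z zs.
apply: (@cdiff_affine R (fun b => f (x + b *: v)) T%:C%C a0 z).
apply: (cdiff_along hf); rewrite /cball /= enorm_lt // E addrK mdM md_real gtr0_norm //.
apply: lt_le_trans Qs; rewrite ltrD2l.
have s0 : 0 < s by apply: le_lt_trans zs; exact: md_ge0.
rewrite ltr_sqr ?nnegrE ?mulr_ge0 ?md_ge0 ?(ltW T0) ?(ltW s0) //.
by rewrite ltr_pM2l.
Qed.

End Space.

Lemma card_uniq_seq (T : choiceType) (A : set T) (p : nat) (s : seq T) :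
  (A #<= `I_p)%card -> uniq s -> (forall z, z \in s -> A z) -> (size s <= p)%N.
Proof.
move=> Ap us sA; rewrite -card_le_II; apply: card_le_trans Ap.
case: s us sA => [|z0 s] us sA; first by rewrite II0 card_ge0.
apply: card_le_trans (subset_card_le (A := [set` z0 :: s]) _); last by move=> z /=; exact: sA.
have inj : {in `I_(size (z0 :: s)) &, injective (nth z0 (z0 :: s))}.
  move=> i j; rewrite !inE /= => hi hj /eqP; rewrite nth_uniq // => /eqP.
  exact.
apply: (card_le_trans _ (subset_card_le (A := nth z0 (z0 :: s) @` `I_(size (z0 :: s))) _)); last first.
  by move=> _ [i /= hi <-] /=; exact: mem_nth.
by have /card_eqPle[_ h] := inj_card_eq inj; exact: h.
Qed.

Lemma card_le_of_seqs (T : choiceType) (A : set T) (p : nat) :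
  (forall s : seq T, uniq s -> (forall z, z \in s -> A z) -> (size s <= p)%N) ->
  (A #<= `I_p)%card.
Proof.
move=> H.
have [n An] : finite_set A.
  apply: contrapT => infA; have [B BA BE] := infinite_set_fset p.+1 infA.
  by have := H (finmap.enum_fset B) (finmap.fset_uniq B) BA; rewrite leqNgt BE.
have fA : finite_set A by exists n.
have /card_eqPle[h _] := An; apply: card_le_trans h _; rewrite card_le_II -(card_fset_set An).
apply: H => [|z]; first exact: finmap.fset_uniq.
by rewrite in_fset_set // inE.
Qed.
End Lines.

(** * From the valency to the Chebyshev degree *)

Section Chebyshev.
Variable R : realType.
Local Notation C := R[i].
Local Notation "x %:C" := (x%:C)%C.

Section Space.
Variable n : nat.
Implicit Types (f : 'rV[C]_n -> C) (x v : 'rV[C]_n) (D : set 'rV[C]_n).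

Lemma valency_ge0 f D : (0 <= valency f D)%E.
Proof. by apply: le_ereal_inf_tmp => _ [p _ <-]; rewrite lee_fin. Qed.

(** An infimum of natural numbers is attained. *)
Lemma valency_bound f D (v : R) : (valency f D <= v%:E)%E ->
  exists p : nat, p%:R <= v /\ (p_valent f D p \/ p = 0%N /\ constant_on f D).
Proof.
move=> vv; have v0 : 0 <= v by rewrite -lee_fin; apply: le_trans vv; exact: valency_ge0.
have /ereal_inf_lt[_ [p hp <-] plt] : (valency f D < ((Num.truncn v).+1%:R : R)%:E)%E.
  by apply: le_lt_trans vv _; rewrite lte_fin truncnS_gt.
exists p; split=> //; move: plt; rewrite lte_fin ltr_nat ltnS -(ler_nat R) => h.
by apply: le_trans h _; rewrite truncn_le.
Qed.

Lemma valent_id : valent (fun z : C => z) 1.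
Proof.
move=> w [|z1 [|z2 zs]] // /= /andP[]; rewrite inE negb_or => /andP[/eqP ne _] _ H.
have [_ e1] := H z1 (mem_head _ _).
have [_ e2] : modulus z2 < 1 /\ z2 = w by apply: H; rewrite !inE eqxx orbT.
by case: ne; rewrite e1 e2.
Qed.

Definition span_line x v : set 'rV[C]_n := [set x + a *: v | a in [set: C]].

(** The conclusion of [valent_chebyshev], as a property of the constant. *)
Definition chebyshev_constant (th0 c : R) : Prop := forall (g : C -> C) p s1, 1 < s1 -> holo g s1 ->
  (0 < p)%N -> valent g p ->
  forall (u : R) (a0 : C) (J W : set R), 0 < u -> is_interval J -> W `<=` J -> (0 < len W)%E ->
  (forall t : R, J t -> modulus (u%:C * (t%:C - a0)) <= th0) ->
  1 <= 4 * fine (len J) / fine (len W) /\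
  forall (t S : R), J t -> (forall x : R, W x -> modulus (g (u%:C * (x%:C - a0))) <= S) ->
  modulus (g (u%:C * (t%:C - a0))) <= (4 * fine (len J) / fine (len W)) `^ (c * p%:R) * S.

Lemma len_neq0 (W : set R) : (0 < len W)%E -> W !=set0.
Proof.
move=> W0; apply/set0P/eqP => WE; by move: W0; rewrite WE len0 ltxx.
Qed.

Lemma enorm_unit_neq0 v : enorm v = 1 -> v != 0.
Proof.
move=> v1; apply/eqP => v0; move: v1; rewrite v0 => /eqP; rewrite -(scale0r 0) enormZ md0 mul0r eq_sym.
by rewrite oner_eq0.
Qed.

(** With [Q] the squared distance from the origin to the line, the line cuts the ball of
    radius [s] in a disc of radius the square root of [s ^+ 2 - Q]. Since [Q >= 0], the
    ratios of these radii for [1], [t] and [r] are at least the ratios for the balls. *)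
Lemma line_disc (r t : R) f x v : 1 <= t -> t < r -> holomorphic_on_ball r f -> enorm v = 1 ->
  (exists a : C, enorm (x + a *: v) < t) ->
  exists (a0 : C) (T : R), [/\ 0 < T, T <= t,
    forall a : C, (enorm (x + a *: v) < t) = (modulus (a - a0) < T),
    forall a : C, enorm (x + a *: v) < 1 -> modulus (a - a0) <= T / t &
    holo (fun z => f (x + (T%:C * z + a0) *: v)) (r / t)].
Proof.
move=> t1 tr hf v1 [a1 a1t]; have t0 : 0 < t by apply: lt_le_trans t1.
have r0 : 0 < r by apply: lt_trans tr.
have [a0 [Q [Q0 E]]] := line_sq x v1.
have Qt : Q < t ^+ 2.
  by move: a1t; rewrite enorm_lt // E; apply: le_lt_trans; rewrite lerDl sqr_ge0.
have T20 : 0 < t ^+ 2 - Q by rewrite subr_gt0.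
pose T := Num.sqrt (t ^+ 2 - Q).
have T0 : 0 < T by rewrite sqrtr_gt0.
have TE : T ^+ 2 = t ^+ 2 - Q by rewrite sqr_sqrtr // ltW.
have tt : 1 <= t ^+ 2 by rewrite exprn_ege1.
exists a0, T; split=> // [|a|a|].
- by rewrite -ler_sqr ?nnegrE ?(ltW T0) ?(ltW t0) // TE gerBl.
- by rewrite enorm_lt // E -(@ltr_sqr _ (modulus _)) ?nnegrE ?md_ge0 ?(ltW T0) // TE ltrBrDl.
- rewrite enorm_lt // E expr1n => h.
  rewrite -ler_sqr ?nnegrE ?md_ge0 ?divr_ge0 ?(ltW T0) ?(ltW t0) // expr_div_n TE.
  rewrite ler_pdivlMr ?exprn_gt0 //.
  have h1 : modulus (a - a0) ^+ 2 <= 1 - Q by move: h; clear; lra.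
  have h2 : modulus (a - a0) ^+ 2 * t ^+ 2 <= (1 - Q) * t ^+ 2 by rewrite ler_wpM2r // sqr_ge0.
  have : Q <= Q * t ^+ 2 by rewrite ler_peMr.
  by move: h2; clear; lra.
apply: (holo_line hf E) => //.
rewrite exprMn TE expr_div_n.
have -> : Q + (t ^+ 2 - Q) * (r ^+ 2 / t ^+ 2) = r ^+ 2 - Q * (r ^+ 2 / t ^+ 2 - 1).
  by field; rewrite gt_eqF.
by rewrite gerBl mulr_ge0 // subr_ge0 ler_pdivlMr ?exprn_gt0 // mul1r ler_sqr ?nnegrE ?ltW.
Qed.

Lemma chebyshev_on_line (r t c d : R) f (p : nat) x v (J W : set R) :
  1 < t -> t < r -> chebyshev_constant t^-1 c -> holomorphic_on_ball r f ->
  cball 1 x -> enorm v = 1 ->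
  (p_valent f (span_line x v `&` cball t) p \/
     p = 0%N /\ constant_on f (span_line x v `&` cball t)) ->
  0 <= d -> c * p%:R <= d ->
  is_interval J -> real_line x v @` J `<=` cball 1 -> W `<=` J -> (0 < len W)%E ->
  (sup_abs f (real_line x v @` J) <=
      ((4 * fine (len J) / fine (len W)) `^ d)%:E * sup_abs f (real_line x v @` W))%E.
Proof.
move=> t1 tr hc hf x1 v1 hp d0 cpd Ji J1 WJ W0.
have t0 : 0 < t by apply: lt_trans t1.
have [|a0 [T [T0 _ inT in1 hG]]] := line_disc (ltW t1) tr hf v1 (x := x).
  by exists 0; rewrite scale0r addr0; exact: lt_trans x1 t1.
have u0 : 0 < T^-1 by rewrite invr_gt0.
have vn := enorm_unit_neq0 v1.
have Jth s : J s -> modulus (T^-1%:C * (s%:C - a0)) <= t^-1.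
  move=> Js; rewrite mdM md_real gtr0_norm // mulrC ler_pdivrMr // mulrC.
  by apply: in1; exact: J1 _ (imageP _ Js).
pose G z := f (x + (T%:C * z + a0) *: v).
have s1 : 1 < r / t by rewrite ltr_pdivlMr // mul1r.
have Gs (s : R) : G (T^-1%:C * (s%:C - a0)) = f (real_line x v s).
  rewrite /G mulrA -rmorphM /= divff ?gt_eqF // mul1r subrK //.
(* The inequality for the 1-valent function [id] shows that the base is at least 1, which
   settles the case of a constant function. *)
have [X1 _] := hc id 1%N _ s1 (fun z _ => cdiff_id z) isT valent_id T^-1 a0 J W u0 Ji WJ W0 Jth.
set X := 4 * _ / _ in X1 *.
have [w0 Ww0] := len_neq0 W0.
have Xd1 : 1 <= X `^ d by rewrite -(powRr0 X) ler_powR.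
have Xd0 : 0 < X `^ d by apply: lt_le_trans Xd1.
have pt s S : J s -> (forall y, W y -> modulus (f (real_line x v y)) <= S) ->
    modulus (f (real_line x v s)) <= X `^ d * S.
  move=> Js HS.
  have S0 : 0 <= S by apply: le_trans (HS _ Ww0); exact: md_ge0.
  have inD y : J y -> (span_line x v `&` cball t) (real_line x v y).
    move=> Jy; split; first by exists y%:C.
    by have := J1 _ (imageP _ Jy); rewrite /cball /= => h; apply: lt_trans h t1.
  case: hp => [pv|[_ [w fw]]]; last first.
    have -> : f (real_line x v s) = f (real_line x v w0).
      by rewrite (fw _ (inD _ Js)) (fw _ (inD _ (WJ _ Ww0))).
    by apply: le_trans (HS _ Ww0) _; rewrite ler_peMl.
  have vG : valent G p.
    move=> w zs uz zw.
    pose phi z := x + (T%:C * z + a0) *: v.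
    have phi_inj : injective phi.
      move=> z1 z2 /addrI /eqP; rewrite -subr_eq0 -scalerBl scaler_eq0 (negbTE vn) orbF.
      rewrite opprD addrACA subrr addr0 -mulrBr mulf_eq0 -md_eq0 md_real gtr0_norm // gt_eqF //=.
      by rewrite subr_eq0 => /eqP.
    rewrite -(size_map phi); apply: (card_uniq_seq (pv w)); first by rewrite map_inj_uniq.
    move=> _ /mapP[z /zw[z1 zE] ->]; split; last exact: zE.
    split; first by exists (T%:C * z + a0).
    by rewrite /cball /= inT addrK mdM md_real gtr0_norm // gtr_pMr.
  have p0 : (0 < p)%N.
    rewrite lt0n; apply/eqP => pE; have := vG (G 0) [:: 0] isT.
    rewrite pE => /(_ _) h; suff : (size [:: (0%R : C)] <= 0)%N by [].
    by apply: h => z; rewrite inE => /eqP ->; rewrite md0.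
  have [_ /(_ s S Js)] := hc G p _ s1 hG p0 vG T^-1 a0 J W u0 Ji WJ W0 Jth.
  rewrite Gs => h; apply: le_trans (h _) _; first by move=> y Wy; rewrite Gs; exact: HS.
  by rewrite ler_wpM2r // ler_powR.
move: (X `^ d) pt Xd0 {Xd1} => Y pt Y0.
clear -pt Y0 Ww0.
apply: ge_ereal_sup => _ [_ [s Js <-] <-].
have lb : ((modulus (f (real_line x v w0)))%:E <= sup_abs f (real_line x v @` W))%E.
  by apply: ereal_sup_ubound; exists (real_line x v w0) => //; exists w0.
move: lb; case ES : (sup_abs f (real_line x v @` W)) => [S| |] lb.
- rewrite -EFinM lee_fin; apply: (pt s S Js) => y Wy; rewrite -lee_fin -ES.
  by apply: ereal_sup_ubound; exists (real_line x v y) => //; exists y.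
- suff -> : (Y%:E * +oo)%E = +oo%E by exact: leey.
  by apply: gt0_muley; rewrite lte_fin.
- by rewrite leeNy_eq in lb.
Qed.

Lemma span_line_valency f x v (t : R) : v != 0 -> span_line x v `&` cball t !=set0 ->
  (valency f (span_line x v `&` cball t) <= ball_valency f t)%E.
Proof.
move=> vn ne; apply: ereal_sup_ubound; exists (span_line x v) => //.
by split=> //; exists x, v.
Qed.

Lemma ball_valency_ge0 f (t : R) : (0 < n)%N -> 0 < t -> (0 <= ball_valency f t)%E.
Proof.
move=> n0 t0; pose v : 'rV[C]_n := const_mx 1.
have vn : v != 0.
  by apply/eqP => /rowP/(_ (Ordinal n0)); rewrite !mxE => /eqP; rewrite oner_eq0.
apply: le_trans (@span_line_valency f 0 v t vn _); first exact: valency_ge0.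
exists 0; split; first by exists 0 => //; rewrite scale0r addr0.
by rewrite /cball /= -(scale0r 0) enormZ md0 mul0r.
Qed.

Lemma chebyshev_degree_le (r t c : R) f : (0 < n)%N ->
  1 < t -> t < r -> 0 < c -> chebyshev_constant t^-1 c -> holomorphic_on_ball r f ->
  (chebyshev_degree f <= c%:E * ball_valency f t)%E.
Proof.
move=> n0 t1 tr c0 hc hf.
have t0 : 0 < t by apply: lt_trans t1.
have := ball_valency_ge0 f n0 t0.
case EV : (ball_valency f t) => [V| |] // V0; last by rewrite gt0_muley ?lte_fin // leey.
rewrite lee_fin in V0.
have Hline x v : cball 1 x -> enorm v = 1 -> exists p : nat, p%:R <= V /\
    (p_valent f (span_line x v `&` cball t) p \/ p = 0%N /\ constant_on f (span_line x v `&` cball t)).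
  move=> x1 v1; apply: valency_bound; rewrite -EV; apply: span_line_valency.
    exact: enorm_unit_neq0.
  exists x; split; first by exists 0 => //; rewrite scale0r addr0.
  by move: x1; rewrite /cball /= => h; apply: lt_trans t1.
have bd d : 0 <= d -> (forall p : nat, p%:R <= V -> c * p%:R <= d) -> chebyshev_bound f d.
  move=> d0 Hd x v x1 v1 J W Ji J1 WJ _ W0; have [p [pV hp]] := Hline x v x1 v1.
  by apply: (chebyshev_on_line t1 tr hc hf x1 v1 hp) => //; exact: Hd.
rewrite -EFinM.
(* Admissible exponents are positive, and the valency may be 0. *)
apply/lee_addgt0Pr => e e0; rewrite -EFinD.
apply: ereal_inf_lbound; exists (c * V + e) => //.
have d0 : 0 < c * V + e by rewrite ltr_wpDl // mulr_ge0 // ltW.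
split=> //; apply: bd => [|p pV]; first exact: ltW.
by rewrite -[c * p%:R]addr0 lerD ?ler_pM2l // ltW.
Qed.

End Space.

Lemma chebyshev_part (r : R) : 1 < r -> exists c : R, 0 < c /\
  forall n (f : 'rV[C]_n -> C), (0 < n)%N -> holomorphic_on_ball r f ->
  (chebyshev_degree f <= c%:E * ball_valency f ((1 + r) / 2))%E.
Proof.
move=> r1; set t := (1 + r) / 2.
have t1 : 1 < t by rewrite /t; lra.
have tr : t < r by rewrite /t; lra.
have [|c c0 hc] := @valent_chebyshev R t^-1.
  have t0 : 0 < t by apply: lt_trans t1.
  by rewrite invr_gt0 t0 invf_lt1.
exists c; split=> // n f n0 hf; apply: (chebyshev_degree_le n0 t1 tr c0 hc hf).
Qed.

End Chebyshev.

(** * Smooth numbers as monomials *)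

Section Monomials.

Definition cofactor_at (p n : nat) : nat := n %/ p ^ logn p n.

(** A monomial in variables indexed by the primes of [ps] is encoded by the product of
    the powers of these primes with the same exponents. The order of the integers
    is a monomial order in which every element has finitely many predecessors. *)
Fixpoint smooth (ps : seq nat) (n : nat) : bool :=
  if ps is p :: qs then smooth qs (cofactor_at p n) else n == 1%N.

Lemma cofactor_at0 p : cofactor_at p 0 = 0%N.
Proof. by rewrite /cofactor_at div0n. Qed.

Lemma cofactor_atE p n : (0 < n)%N -> n = (p ^ logn p n * cofactor_at p n)%N.
Proof. by move=> n0; rewrite mulnC divnK // pfactor_dvdnn. Qed.

Lemma cofactor_at_gt0 p n : (0 < n)%N -> (0 < cofactor_at p n)%N.
Proof.
by move=> n0; have := n0; rewrite {1}(cofactor_atE p n0) muln_gt0 => /andP[].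
Qed.

Lemma cofactor_atM p m n : prime p -> (0 < m)%N -> (0 < n)%N ->
  cofactor_at p (m * n) = (cofactor_at p m * cofactor_at p n)%N.
Proof.
move=> pp m0 n0; rewrite {1}/cofactor_at lognM //.
rewrite {1}(cofactor_atE p m0) {1}(cofactor_atE p n0) mulnACA -expnD mulKn //.
by rewrite expn_gt0 prime_gt0.
Qed.

Lemma smooth_gt0 ps n : smooth ps n -> (0 < n)%N.
Proof.
elim: ps n => [|p qs IH] n /=; first by move=> /eqP ->.
by move=> /IH; case: n => [|n] //; rewrite cofactor_at0.
Qed.

Lemma smoothM ps m n : all prime ps -> (0 < m)%N -> (0 < n)%N ->
  smooth ps (m * n) = smooth ps m && smooth ps n.
Proof.
elim: ps m n => [|p qs IH] m n /=; first by move=> _ _ _; rewrite muln_eq1.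
by move=> /andP[pp qp] m0 n0; rewrite cofactor_atM // IH // cofactor_at_gt0.
Qed.

Lemma smooth_not_dvd ps n p : prime p -> all prime ps -> p \notin ps -> smooth ps n -> ~~ (p %| n)%N.
Proof.
move=> pp; elim: ps n => [|q qs IH] n /=; first by move=> _ _ /eqP ->; rewrite dvdn1; case: p pp => [|[]].
move=> /andP[qp qsp]; rewrite inE negb_or => /andP[pq pqs] sm.
have n0 : (0 < n)%N.
  by move/smooth_gt0: sm; case: n => [|n] //; rewrite cofactor_at0.
rewrite (cofactor_atE q n0) Euclid_dvdM // negb_or (IH _ qsp pqs sm) andbT.
rewrite Euclid_dvdX //; apply/negP => /andP[]; rewrite dvdn_prime2 // => /eqP pE _.
by rewrite pE eqxx in pq.
Qed.

(** Dickson's lemma, by induction on the primes. A finite basis of the cofactors at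
    [p] bounds the exponents of [p] for which a separate basis has to be added. *)
Lemma dickson (ps : seq nat) (A : nat -> Prop) : all prime ps ->
  (forall n, A n -> smooth ps n) ->
  exists s : seq nat, (forall b, b \in s -> A b) /\
    forall a, A a -> exists2 b, b \in s & (b %| a)%N.
Proof.
move=> pps; elim: ps pps A => [|p qs IH] /= pps A As.
  have [A1|A1] := pselect (A 1%N).
    exists [:: 1%N]; split=> [b|a _]; first by rewrite inE => /eqP ->.
    by exists 1%N; rewrite ?inE // dvd1n.
  exists [::]; split=> // a /[dup] Aa /As /eqP aE; by case: A1; rewrite -aE.
have /andP[pp qp] := pps.
have sq e m : A (p ^ e * m)%N -> (0 < m)%N. 
  by move=> /As /= h; case: m h => // /=; rewrite muln0 cofactor_at0 => /smooth_gt0.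
pose proj m := smooth qs m /\ exists e, A (p ^ e * m)%N.
have [s [sA sB]] := IH qp proj (fun m h => h.1).
have exE : forall m, exists e, m \in s -> A (p ^ e * m)%N.
  move=> m; have [/sA[_ [e he]]|_] := boolP (m \in s); first by exists e.
  by exists 0%N.
have [ex exP] := choice exE.
have slice : forall e, exists t : seq nat, (forall b, b \in t -> smooth qs b /\ A (p ^ e * b)%N) /\
    forall a, smooth qs a /\ A (p ^ e * a)%N -> exists2 b, b \in t & (b %| a)%N.
  by move=> e; exact: (IH qp (fun m => smooth qs m /\ A (p ^ e * m)%N) (fun m h => h.1)).
have [tt ttP] := choice slice.
pose E := \max_(m <- s) ex m.
exists ([seq (p ^ ex m * m)%N | m <- s] ++
  flatten [seq [seq (p ^ e * b)%N | b <- tt e] | e <- iota 0 E]); split=> [b|a Aa].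
  rewrite mem_cat => /orP[/mapP[m ms ->]|/flattenP[_ /mapP[e _ ->] /mapP[m mt ->]]].
    exact: exP.
  by have [/(_ m mt)[]] := ttP e.
have a0 : (0 < a)%N by exact: smooth_gt0 (As _ Aa : smooth (p :: qs) a).
have aE := cofactor_atE p a0; set e := logn p a in aE; set m := cofactor_at p a in aE.
have sm : smooth qs m by exact: As Aa.
have [eE|eE] := ltnP e E.
  have [_ /(_ m)] := ttP e; rewrite -aE => /(_ (conj sm Aa))[b bt bm].
  exists (p ^ e * b)%N; last by rewrite aE dvdn_mul.
  rewrite mem_cat; apply/orP; right; apply/flattenP; exists [seq (p ^ e * b)%N | b <- tt e].
    by apply/mapP; exists e => //; rewrite mem_iota.
  by apply/mapP; exists b.
have [|b bs bm] := sB m; first by split=> //; exists e; rewrite -aE.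
exists (p ^ ex b * b)%N; first by rewrite mem_cat; apply/orP; left; apply/mapP; exists b.
rewrite aE dvdn_mul // dvdn_exp2l //; apply: leq_trans eE.
by rewrite /E (big_rem b) /= ?leq_maxl.
Qed.

(** Passing from [N] to [N.+1] adds to the right-hand side the terms with
    [p ^ k %| N.+1], and they vanish but for the one with [k = logn p N.+1]. *)
Lemma reindex_cofactor (V : zmodType) (p N K : nat) (F : nat -> nat -> V) : prime p -> (N < K)%N ->
  (forall k m, (p %| m)%N -> F k m = 0) ->
  \sum_(i < N.+1) F (logn p i) (cofactor_at p i) =
  \sum_(k < K) \sum_(m < (N %/ p ^ k).+1) F k m.
Proof.
move=> pp NK F0; elim: N NK => [|N IH] NK.
  rewrite big_ord1 /= cofactor_at0 F0 ?dvdn0 // big1 // => k _.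
  by rewrite div0n big_ord1 /= F0 ?dvdn0.
rewrite big_ord_recr /= IH; last exact: ltnW.
have E (k : nat) : \sum_(m < (N.+1 %/ p ^ k).+1) F k m = \sum_(m < (N %/ p ^ k).+1) F k m +
   (if (p ^ k %| N.+1)%N then F k (N.+1 %/ p ^ k)%N else 0).
  rewrite divnS ?expn_gt0 ?prime_gt0 //; case: ifP => h; last by rewrite addr0 add0n.
  by rewrite ?h add1n big_ord_recr /= ?h ?add1n.
rewrite [in RHS](eq_bigr _ (fun (k : 'I_K) _ => E k)) big_split /=; congr (_ + _).
have lK : (logn p N.+1 < K)%N by apply: ltn_trans NK; exact: ltn_logl.
rewrite (bigD1 (Ordinal lK)) //= pfactor_dvdnn big1 ?addr0 // => k kne.
case: ifP => // h; apply: F0.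
have kl : (k < logn p N.+1)%N.
  rewrite ltn_neqAle -pfactor_dvdn // h andbT; apply: contraNneq kne => kE.
  by apply/eqP/val_inj.
move: kl; rewrite -(pfactor_dvdn _ pp) // expnS => kl.
by rewrite dvdn_divRL // mulnC; rewrite mulnC in kl.
Qed.

End Monomials.

(** * Power series in several variables *)

Section Expansion.
Variable R : realType.
Local Notation C := R[i].
Implicit Types (g : C -> C) (lam mu : nat -> C) (ps qs : seq nat) (G : (nat -> C) -> C).

(** The value at [lam] of the monomial encoded by [n]; zero if [n] is not smooth. *)
Fixpoint chi lam ps (n : nat) : C :=
  if ps is p :: qs then lam p ^+ logn p n * chi lam qs (cofactor_at p n) else (n == 1%N)%:R.

Lemma chi0 lam ps : chi lam ps 0 = 0.
Proof. by elim: ps => //= p qs IH; rewrite cofactor_at0 IH mulr0. Qed.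

Lemma chiM lam ps m n : all prime ps -> chi lam ps (m * n) = chi lam ps m * chi lam ps n.
Proof.
case: (posnP m) => [->|m0]; first by rewrite mul0n chi0 mul0r.
case: (posnP n) => [->|n0]; first by rewrite muln0 chi0 mulr0.
elim: ps m n m0 n0 => [|p qs IH] m n m0 n0 /=; first by rewrite muln_eq1 -natrM mulnb.
by move=> /andP[pp qp]; rewrite lognM // cofactor_atM // IH ?cofactor_at_gt0 // exprD mulrACA.
Qed.

Lemma chi_le lam ps n (s : nat) : (forall p, p \in ps -> modulus (lam p) <= (p%:R^-1) ^+ s) ->
  modulus (chi lam ps n) <= (n%:R^-1) ^+ s.
Proof.
case: (posnP n) => [->|n0]; first by move=> _; rewrite chi0 md0 exprn_ge0 // invr_ge0.
elim: ps n n0 => [|p qs IH] n n0 H /=.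
  by case: eqP => [->|_]; rewrite ?md1 ?invr1 ?expr1n // md0 exprn_ge0 // invr_ge0.
rewrite mdM mdX [in leRHS](cofactor_atE p n0) natrM natrX invfM exprMn.
apply: ler_pM; rewrite ?exprn_ge0 ?md_ge0 //.
  rewrite -exprVn exprAC lerXn2r ?nnegrE ?md_ge0 ?exprn_ge0 ?invr_ge0 //.
  by apply: H; rewrite mem_head.
by apply: IH => [|q qi]; [exact: cofactor_at_gt0 | apply: H; rewrite inE qi orbT].
Qed.

Lemma unit_psum g : holo g 2 -> (forall z, modulus z < 2 -> modulus (g z) <= 1) ->
  exists a, psum a g 1 1.
Proof.
move=> hg g1; have [|a [M ha]] := @holo_psum R g 2 1 _ hg.
  by rewrite ltr01 ltr1n.
have est := cauchy_est ltr01 ha (B := 1).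
exists a; apply: psum_intro => // [k|z z1].
  by apply: est => z z1; apply: g1; apply: lt_trans z1 _; rewrite ltr1n.
exact: psum_cconv ha z1.
Qed.

(** The coefficients are selected from the function alone, so that they agree for
    parameters that define the same function. *)
Lemma taylor_coefficients : exists coef : (C -> C) -> nat -> C, forall g,
  holo g 2 -> (forall z, modulus z < 2 -> modulus (g z) <= 1) -> psum (coef g) g 1 1.
Proof.
suff : forall g, exists a, holo g 2 -> (forall z, modulus z < 2 -> modulus (g z) <= 1) -> psum a g 1 1.
  by move=> /choice[coef coefP]; exists coef.
move=> g; have [[h1 h2]|H] := pselect (holo g 2 /\ forall z, modulus z < 2 -> modulus (g z) <= 1).
  by have [a ha] := unit_psum h1 h2; exists a.
by exists (fun=> 0) => h1 h2; case: H.
Qed.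

Lemma cdiff_sum n (F : nat -> C -> C) z : (forall i, cdiff (F i) z) ->
  cdiff (fun x => \sum_(i < n) F i x) z.
Proof.
move=> dF; elim: n => [|n IH].
  have -> : (fun x => \sum_(i < 0) F i x) = fun=> 0 by apply/funext => x; rewrite big_ord0.
  exact: cdiff_cst.
have -> : (fun x => \sum_(i < n.+1) F i x) = fun x => \sum_(i < n) F i x + F n x.
  by apply/funext => x; rewrite big_ord_recr.
exact: cdiffD.
Qed.

(** A coefficient is the uniform limit of averages over roots of unity, which are finite
    combinations of functions holomorphic in the parameter. *)
Lemma coef_holo (H : C -> C -> C) (a : C -> nat -> C) k :
  (forall z, modulus z < 2 -> psum (a z) (H z) 1 1) ->
  (forall x, modulus x < 2 -> holo (fun z => H z x) 2) ->
  holo (fun z => a z k) 2.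
Proof.
move=> ha hH; have [w wP] := choice (@prim_root_pow2 R).
pose s : R := 1 / 2; have s0 : 0 < s by rewrite divr_gt0.
have s1 : 0 < s < 1 by rewrite s0 /s ltr_pdivrMr // mul1r ltr1n.
pose N j := (2 ^ j.+1)%N.
pose h j z := (s%:C%C ^+ k)^-1 * avg (H z) s (w j) (N j) (N j - k).
have sk0 : 0 < s ^+ k by rewrite exprn_gt0.
have skn : s%:C%C ^+ k != 0 :> C by rewrite expf_neq0 // -md_eq0 md_real gtr0_norm // gt_eqF.
apply: (@holo_limit R h _ 2) => //.
  move=> j z z2; apply: cdiffM; first exact: cdiff_cst.
  apply: cdiffM; first exact: cdiff_cst.
  apply: (@cdiff_sum (N j) (fun i z => H z (s%:C%C * w j ^+ i) * (w j ^+ i) ^+ (N j - k))) => i.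
  apply: cdiffM; last exact: cdiff_cst.
  apply: hH => //; rewrite mdM mdX (wP j).2 expr1n mulr1 md_real gtr0_norm //.
  by case/andP: s1 => _ h1; apply: lt_trans h1 _; rewrite ltr1n.
move=> e e0.
have [M HM] : exists N0, forall n, (N0 <= n)%N -> s ^+ n <= e * s ^+ k * (1 - s).
  apply: geo_small; first by case/andP: s1 => h1 h2; rewrite ltW.
  by case/andP: s1 => h1 h2; rewrite !mulr_gt0 // subr_gt0.
exists (maxn M k) => j; rewrite geq_max => /andP[Mj kj] z z2.
have jN : (j < N j)%N by exact: pow2_ge.
rewrite /h -(mulKf skn (a z k)) -mulrBr mdM mdV mdX md_real gtr0_norm // ler_pdivrMl //.
have kN : (k < N j)%N by exact: leq_ltn_trans kj jN.
have := avg_coef (ha z z2) s1 (wP j).1 kN (wP j).2.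
rewrite mul1r divr1 [a z k * _]mulrC => h1; apply: le_trans h1 _.
rewrite ler_pdivrMr ?subr_gt0; last by case/andP: s1.
have -> : s ^+ k * e * (1 - s) = e * s ^+ k * (1 - s) by ring.
by apply: HM; apply: leq_trans Mj (ltnW jN).
Qed.

Definition upd lam p z : nat -> C := fun q => if q == p then z else lam q.

Lemma geo_half_sum n (p : nat) : (1 < p)%N -> \sum_(k < n) (p%:R^-1 : R) ^+ k <= 2.
Proof.
move=> p1; have q : 0 <= (p%:R^-1 : R) < 1.
  by rewrite invr_ge0 ler0n invf_lt1 ?ltr0n ?ltr1n // ltnW.
have := geo_partial q (leq0n n); rewrite big_mkord expr0 => h; apply: le_trans h _.
rewrite ler_pdivrMr ?subr_gt0; last by case/andP: q.
have : (p%:R^-1 : R) <= 2^-1 by rewrite lef_pV2 ?posrE ?ltr0n // ?ler_nat // ltnW.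
by move: q; set u := _^-1; lra.
Qed.

(** Induction on the variables: in the expansion with respect to the first
    variable, the coefficients are functions of the other variables that satisfy the same
    hypotheses. The rate of convergence in [1 / N] is what reproduces itself: truncating
    at [N] the sum over all monomials means truncating at [N %/ p ^ k] the coefficient
    of the [k]-th power of the first variable, and the loss [p ^ k] is compensated
    by that power, which is at most [p ^ (- 2 k)]. *)
Theorem expansion ps G : all prime ps -> uniq ps ->
  (forall lam mu, (forall p, p \in ps -> lam p = mu p) -> G lam = G mu) ->
  (forall lam, (forall p, p \in ps -> modulus (lam p) < 2) -> modulus (G lam) <= 1) ->
  (forall lam p, p \in ps -> (forall q, q \in ps -> q != p -> modulus (lam q) < 2) ->
     holo (fun z => G (upd lam p z)) 2) ->
  exists c : nat -> C, [/\ forall n, modulus (c n) <= 1, forall n, ~~ smooth ps n -> c n = 0 &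
    forall lam, (forall p, p \in ps -> modulus (lam p) <= (p%:R^-1) ^+ 2) -> forall N,
    modulus (G lam - \sum_(i < N.+1) c i * chi lam ps i) <= 2 ^+ size ps / N.+1%:R].
Proof.
elim: ps G => [|p qs IH] G /=.
  move=> _ _ Gd G1 _; exists (fun n => if n == 1%N then G (fun=> 0) else 0); split.
  - by move=> n; case: eqP => _; [exact: G1 | rewrite md0].
  - by move=> n /negbTE ->.
  move=> lam _ N; rewrite (Gd lam (fun=> 0)) //.
  case: N => [|N].
    by rewrite big_ord1 /= mulr0 subr0 expr0 divr1; exact: G1.
  rewrite !big_ord_recl /= big1 ?addr0 ?mulr0 ?add0r ?mulr1 ?subrr ?md0 //.
move=> /andP[pp qp] /andP[pq uq] Gd G1 Gh.
pose g lam := fun z => G (upd lam p z).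
have updN lam z q : q != p -> upd lam p z q = lam q by rewrite /upd => /negbTE ->.
have updE lam z : upd lam p z p = z by rewrite /upd eqxx.
have qne q : q \in qs -> q != p by move=> qi; apply: contraNneq pq => <-.
have [coef coefP] := taylor_coefficients.
have gok lam : (forall q, q \in qs -> modulus (lam q) < 2) -> psum (coef (g lam)) (g lam) 1 1.
  move=> ld; apply: coefP.
    apply: Gh => [|q]; first exact: mem_head.
    by rewrite inE => /orP[/eqP -> /eqP //|qi _]; exact: ld.
  move=> z z2; apply: G1 => q; rewrite inE => /orP[/eqP ->|qi]; first by rewrite updE.
  by rewrite updN ?ld ?qne.
have exk : forall k, exists c : nat -> C, [/\ forall n, modulus (c n) <= 1,
    forall n, ~~ smooth qs n -> c n = 0 &
    forall lam, (forall q, q \in qs -> modulus (lam q) <= (q%:R^-1) ^+ 2) -> forall N,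
    modulus (coef (g lam) k - \sum_(i < N.+1) c i * chi lam qs i) <= 2 ^+ size qs / N.+1%:R].
  move=> k; apply: IH => //.
  - move=> lam mu E; congr (coef _ k); apply/funext => z; apply: Gd => q.
    rewrite inE => /orP[/eqP ->|qi]; first by rewrite !updE.
    by rewrite !updN ?qne // E.
  - by move=> lam ld; have := (gok lam ld).1 k; rewrite expr1n mulr1.
  move=> lam q qi ld; apply: (@coef_holo (fun z => g (upd lam q z)) (fun z => coef (g (upd lam q z)))).
    move=> z z2; apply: gok => q' q'i; rewrite /upd; case: eqP => [//|/eqP ne]; exact: ld.
  move=> x x2.
  have -> : (fun z => g (upd lam q z) x) = fun z => G (upd (upd lam p x) q z).
    apply/funext => z; apply: Gd => q' _; rewrite /upd; case: eqP => [->|//].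
    by rewrite eq_sym (negbTE (qne _ qi)).
  apply: Gh => [|q']; first by rewrite inE qi orbT.
  rewrite inE => /orP[/eqP -> _|q'i ne]; first by rewrite updE.
  by rewrite updN ?qne // ld.
have [c cP] := choice exk.
exists (fun n => c (logn p n) (cofactor_at p n)); split.
- by move=> n; have [h _ _] := cP (logn p n).
- by move=> n sn; have [_ h _] := cP (logn p n); exact: h.
move=> lam ld N.
have p1 : (1 < p)%N by exact: prime_gt1.
have inv4 : (p%:R^-1 : R) <= 2^-1 by rewrite lef_pV2 ?posrE ?ltr0n // ?ler_nat // ltnW.
have iv0 : 0 < (p%:R^-1 : R) by rewrite invr_gt0 ltr0n ltnW.
have zp : modulus (lam p) <= (p%:R^-1) ^+ 2 by apply: ld; exact: mem_head.
have ldq q : q \in qs -> modulus (lam q) <= (q%:R^-1) ^+ 2.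
  by move=> qi; apply: ld; rewrite inE qi orbT.
have le1 (n : nat) : ((n%:R^-1 : R) ^+ 2) <= 1.
  case: n => [|n]; first by rewrite invr0 expr0n.
  by rewrite exprn_ile1 // ?invr_ge0 // invf_le1 ?ler1n.
have ldq2 q : q \in qs -> modulus (lam q) < 2.
  by move=> qi; apply: le_lt_trans (ldq q qi) _; apply: le_lt_trans (le1 q) _; rewrite ltr1n.
have GE : G lam = g lam (lam p).
  by apply: Gd => q _; rewrite /upd; case: eqP => [->|].
have z14 : modulus (lam p) <= 2^-1.
  apply: le_trans zp _; apply: (le_trans _ inv4); rewrite expr2 ler_piMl ?ltW //.
  by apply: (le_lt_trans inv4); rewrite invf_lt1 ?ltr1n.
have z1 : modulus (lam p) < 1 by apply: le_lt_trans z14 _; rewrite invf_lt1 ?ltr1n.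
pose cc := coef (g lam).
have Gser n : modulus (G lam - \sum_(k < n) cc k * lam p ^+ k) <=
    modulus (lam p) ^+ n / (1 - modulus (lam p)).
  by have [_ /(_ _ z1 n)] := gok lam ldq2; rewrite divr1 mul1r -GE.
have key (K : nat) : (N < K)%N ->
    modulus (G lam - \sum_(i < N.+1) c (logn p i) (cofactor_at p i) * (lam p ^+ logn p i * chi lam qs (cofactor_at p i))) <=
    2 ^+ (size qs).+1 / N.+1%:R + 2 * modulus (lam p) ^+ K.
  move=> NK.
  pose F k m := c k m * (lam p ^+ k * chi lam qs m).
  rewrite (@reindex_cofactor _ p N K F) //; last first.
    move=> k m pm; rewrite /F; have [_ h _] := cP k; rewrite h ?mul0r //.
    by apply/negP => /(smooth_not_dvd pp qp pq); rewrite pm.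
  rewrite -(subrK (\sum_(k < K) cc k * lam p ^+ k) (G lam)) -addrA.
  apply: le_trans (mdD _ _) _; rewrite [leRHS]addrC; apply: lerD; last first.
    rewrite -sumrB; apply: le_trans (md_sum _ _ _) _.
    apply: (@le_trans _ _ (\sum_(k < K) (2 ^+ size qs / N.+1%:R) * (p%:R^-1) ^+ k)).
      apply: ler_sum => k _.
      have -> : \sum_(m < (N %/ p ^ k).+1) F k m =
          (\sum_(m < (N %/ p ^ k).+1) c k m * chi lam qs m) * lam p ^+ k.
        by rewrite mulr_suml; apply: eq_bigr => m _; rewrite /F; ring.
      rewrite -mulrBl mdM mdX.
      have [_ _ /(_ lam ldq (N %/ p ^ k)%N) h] := cP k.
      apply: (@le_trans _ _ (2 ^+ size qs / (N %/ p ^ k).+1%:R * ((p%:R^-1) ^+ 2) ^+ k)).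
        apply: ler_pM; rewrite ?exprn_ge0 ?md_ge0 //.
        by rewrite lerXn2r ?nnegrE ?md_ge0 ?exprn_ge0 // ltW.
      rewrite -!mulrA ler_wpM2l ?exprn_ge0 // -exprM mulSn mul1n exprD mulrA ler_wpM2r ?exprn_ge0 ?invr_ge0 //.
      rewrite exprVn -invfM lef_pV2 ?posrE ?ltr0n // -?natrX -?natrM ?ltr0n ?muln_gt0 ?expn_gt0 ?(ltnW p1) //.
      by rewrite ler_nat ltn_ceil // expn_gt0 ltnW.
    have -> : 2 ^+ (size qs).+1 / N.+1%:R = 2 ^+ size qs / N.+1%:R * 2 :> R.
      by rewrite exprS; ring.
    rewrite -mulr_sumr ler_wpM2l ?divr_ge0 ?exprn_ge0 //.
    exact: geo_half_sum.
  apply: le_trans (Gser K) _; rewrite mulrC ler_wpM2r ?exprn_ge0 ?md_ge0 //.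
  rewrite invf_ple ?posrE ?subr_gt0 // ; move: z14; lra.
rewrite leNgt; apply/negP => lt.
set X := modulus _ in lt key; set Y := _ / _ in lt key.
have [K HK] : exists K, forall n, (K <= n)%N -> modulus (lam p) ^+ n <= (X - Y) / 4.
  apply: geo_small; first by rewrite md_ge0 z1.
  by rewrite divr_gt0 // subr_gt0.
have := key (maxn K N.+1); rewrite leq_max ltnSn orbT => /(_ isT).
have := HK (maxn K N.+1); rewrite leq_maxl => /(_ isT).
by move: lt; clear; lra.
Qed.

End Expansion.

(** * Division of power series with bounds *)

Section Division.
Variable R : realType.
Local Notation C := R[i].
Implicit Types (f g : nat -> C) (x : nat -> C) (e m n N : nat) (al w : C).

Definition wt e n : R := (n%:R^-1) ^+ e.

Lemma wt_ge0 e n : 0 <= wt e n.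
Proof. by rewrite exprn_ge0 // invr_ge0. Qed.

Lemma wtM e m n : wt e (m * n) = wt e m * wt e n.
Proof. by rewrite /wt natrM invfM exprMn. Qed.

Lemma wt_gt0 e n : (0 < n)%N -> 0 < wt e n.
Proof. by move=> n0; rewrite exprn_gt0 // invr_gt0 ltr0n. Qed.

Lemma inv_nat01 n : 0 <= (n%:R^-1 : R) <= 1.
Proof. by case: n => [|n]; rewrite ?invr0 ?lexx ?ler01 // invr_ge0 ler0n invf_le1 ?ler1n ?ltr0n. Qed.

Lemma wt_le e e' n : (e <= e')%N -> wt e' n <= wt e n.
Proof. by move=> ee; rewrite /wt ler_wiXn2l //; have /andP[] := inv_nat01 n. Qed.

Lemma wt_anti e m n : (0 < m)%N -> (m <= n)%N -> wt e n <= wt e m.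
Proof.
move=> m0 mn; have n0 : (0 < n)%N by exact: leq_trans mn.
by rewrite /wt lerXn2r ?nnegrE ?invr_ge0 // lef_pV2 ?posrE ?ltr0n // ler_nat.
Qed.

Lemma sum_wt2 N : \sum_(i < N.+1) wt 2 i <= 3.
Proof.
suff H : \sum_(i < N.+1) wt 2 i <= 3 - 2 / N.+1%:R.
  by apply: le_trans H _; rewrite gerBl divr_ge0.
elim: N => [|N IH]; first by rewrite big_ord1 /wt invr0 expr0n /= divr1; lra.
rewrite big_ord_recr /=; apply: le_trans (lerD IH (lexx _)) _.
rewrite /wt -[N.+2%:R]natr1.
have : 1 <= (N.+1%:R : R) by rewrite ler1n.
move: (N.+1%:R : R) => t t1; rewrite expr2 -subr_ge0.
have -> : 3 - 2 / (t + 1) - (3 - 2 / t + t^-1 * t^-1) = (t - 1) / (t * t * (t + 1)).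
  by field; apply/andP; split; apply: lt0r_neq0; move: t1; lra.
by rewrite divr_ge0 ?mulr_ge0 ?subr_ge0 //; move: t1; lra.
Qed.

(** Coefficients of the product of the series [g] by the monomial encoded by [m]. *)
Definition shift (V : nmodType) m (g : nat -> V) n : V := if (m %| n)%N then g (n %/ m)%N else 0.

Lemma sum_shift (V : comNzRingType) (w g : nat -> V) m N : (0 < m)%N ->
  (forall i j, w (i * j)%N = w i * w j) ->
  \sum_(i < N.+1) shift m g i * w i = w m * \sum_(i < (N %/ m).+1) g i * w i.
Proof.
move=> m0 wM; elim: N => [|N IH].
  rewrite div0n !big_ord1 /shift dvdn0 div0n /=.
  have w0 : w m * w 0%N = w 0%N by rewrite -wM muln0.
  by rewrite mulrCA w0.
rewrite big_ord_recr /= IH divnS // /shift; case: ifP => h; last by rewrite mul0r addr0.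
rewrite add1n [in RHS]big_ord_recr /= mulrDr; congr (_ + _).
have E : (N.+1 %/ m)%N = (N %/ m).+1 by rewrite divnS // h.
by rewrite -{2}(divnK h) E mulnC wM; ring.
Qed.

(** Partial sums of the l1-norm with weights [wt e]. *)
Definition nsum f e N : R := \sum_(i < N.+1) modulus (f i) * wt e i.
Definition partial f x N : C := \sum_(i < N.+1) f i * x i.
Definition value f x : C := xget 0 [set w | cconv (partial f x) w].
(** The multiplicative functions bounded by the weight play the part of the points of a
    polydisc, whose radii decrease when [e] grows. *)
Definition mchar e x : Prop :=
  (forall m n, x (m * n)%N = x m * x n) /\ forall n, modulus (x n) <= wt e n.

Lemma mchar_le e e' x : (e <= e')%N -> mchar e' x -> mchar e x.
Proof. by move=> ee [h1 h2]; split=> // n; apply: le_trans (h2 n) _; exact: wt_le. Qed.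

Lemma nsum_ge0 f e N : 0 <= nsum f e N.
Proof. by apply: sumr_ge0 => i _; rewrite mulr_ge0 ?md_ge0 ?wt_ge0. Qed.

Lemma nsum_mono f e m n : (m <= n)%N -> nsum f e m <= nsum f e n.
Proof.
move=> mn; rewrite -subr_ge0 /nsum (sum_nat_sub (fun i => modulus (f i) * wt e i)) //.
by apply: sumr_ge0 => i _; rewrite mulr_ge0 ?md_ge0 ?wt_ge0.
Qed.

Lemma partial_diff f x e m n : mchar e x -> (m <= n)%N ->
  modulus (partial f x n - partial f x m) <= nsum f e n - nsum f e m.
Proof.
move=> [_ h] mn; rewrite /nsum /partial.
rewrite (sum_nat_sub (fun i => modulus (f i) * wt e i)) // (sum_nat_sub (fun i => f i * x i)) //.
apply: le_trans (md_sum _ _ _) _; apply: ler_sum => i _.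
by rewrite mdM ler_wpM2l ?md_ge0.
Qed.

Lemma value_unique f x w : cconv (partial f x) w -> value f x = w.
Proof.
move=> h; apply: (@cconv_unique R (partial f x)) => //.
exact: (xgetI 0 (h : [set w | cconv (partial f x) w] w)).
Qed.

Lemma value_cconv f x e (M : R) : (forall N, nsum f e N <= M) -> mchar e x ->
  cconv (partial f x) (value f x).
Proof.
move=> fM xe; suff [l hl] : exists l, cconv (partial f x) l by rewrite (value_unique hl).
apply: ccauchy => d d0.
pose S := sup [set nsum f e N | N in [set: nat]].
have hs : has_sup [set nsum f e N | N in [set: nat]].
  split; first by exists (nsum f e 0), 0%N.
  by exists M => _ [N _ <-].
have [_ [N _ <-] hN] := sup_adherent d0 hs.
have ub n : nsum f e n <= S by apply: sup_upper_bound => //; exists n.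
have main m n : (N <= m)%N -> (m <= n)%N -> modulus (partial f x n - partial f x m) <= d.
  move=> Nm mn; apply: le_trans (partial_diff f xe mn) _.
  have := ub n; have := nsum_mono f e Nm; move: hN; rewrite -/S; lra.
exists N => m n Nm Nn; case: (leqP m n) => mn; first by rewrite mdC; exact: main.
by apply: main => //; exact: ltnW.
Qed.

Lemma cconv_le (u : nat -> C) l (X : R) : cconv u l -> (forall n, modulus (u n) <= X) -> modulus l <= X.
Proof.
move=> ul uX; apply/ler_addgt0Pr => d d0; have [N /(_ _ (leqnn N)) h] := ul d d0.
rewrite -(subrK (u N) l) addrC; apply: le_trans (mdD _ _) _.
by rewrite lerD ?uX // mdC.
Qed.

Lemma nsum_shift m g e N : (0 < m)%N -> nsum (shift m g) e N = wt e m * nsum g e (N %/ m).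
Proof.
move=> m0; rewrite /nsum -(sum_shift (fun i => modulus (g i)) N m0 (wtM e)).
by apply: eq_bigr => i _; rewrite /shift; case: ifP => // _; rewrite md0.
Qed.

Lemma nsum_sub f g al e N :
  nsum (fun n => f n - al * g n) e N <= nsum f e N + modulus al * nsum g e N.
Proof.
rewrite /nsum mulr_sumr -big_split /=; apply: ler_sum => i _.
rewrite mulrA -mulrDl ler_wpM2r ?wt_ge0 // -mdM; exact: mdB.
Qed.

Lemma value_step f g al m e x (M M' : R) : (0 < m)%N -> mchar e x ->
  (forall N, nsum f e N <= M) -> (forall N, nsum g e N <= M') ->
  value (fun n => f n - al * shift m g n) x = value f x - al * (x m * value g x).
Proof.
move=> m0 xe fM gM; apply: value_unique.
have hf := value_cconv fM xe; have hg := value_cconv gM xe.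
move=> d d0.
pose t := modulus (al * x m) + 1; have t0 : 0 < t by rewrite ltr_wpDl ?md_ge0.
have [N1 h1] := hf (d / 2) (divr_gt0 d0 (ltr0n _ 2)).
have [N2 h2] := hg (d / 2 / t) (divr_gt0 (divr_gt0 d0 (ltr0n _ 2)) t0).
exists (maxn N1 (N2 * m)) => n; rewrite geq_max => /andP[n1 n2].
have -> : partial (fun n => f n - al * shift m g n) x n = partial f x n - al * (x m * partial g x (n %/ m)).
  rewrite /partial -(sum_shift g n m0 xe.1) mulr_sumr -sumrB; apply: eq_bigr => i _; ring.
have n3 : (N2 <= n %/ m)%N by rewrite leq_divRL.
have -> : partial f x n - al * (x m * partial g x (n %/ m)) - (value f x - al * (x m * value g x)) =
  (partial f x n - value f x) - al * x m * (partial g x (n %/ m) - value g x) by ring.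
apply: le_trans (mdB _ _) _.
have := h1 n n1; have := h2 _ n3; rewrite mdM.
set u := modulus (partial g x _ - _); set v := modulus (partial f x n - _).
rewrite ler_pdivlMr // /t; have := md_ge0 (al * x m); have : 0 <= u by exact: md_ge0.
by set a := modulus (al * x m); clear; nra.
Qed.

Definition leads g b : Prop := g b != 0 /\ forall n, (n < b)%N -> g n = 0.

(** For [n > b] the ratio of the weights of [n] and [b] is at most
    [(b / b.+1) ^+ e], which tends to 0 when [e] grows. *)
Lemma leading_dominates g b (M : R) : (0 < b)%N -> leads g b -> (forall N, nsum g 2 N <= M) ->
  exists e0, (2 <= e0)%N /\ forall e, (e0 <= e)%N -> forall N,
    nsum g e N <= 3 / 2 * (modulus (g b) * wt e b).
Proof.
move=> b0 [gb gn] gM.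
have M0 : 0 <= M by apply: le_trans (gM 0%N); exact: nsum_ge0.
have gb0 : 0 < modulus (g b) by rewrite md_gt0.
pose q : R := b%:R / b.+1%:R.
have q01 : 0 <= q < 1 by rewrite divr_ge0 //= ltr_pdivrMr ?ltr0n // mul1r ltr_nat.
have [E HE] : exists E, forall n, (E <= n)%N -> q ^+ n <= modulus (g b) * wt 2 b / 2 / (M + 1).
  have M1 : 0 < M + 1 by move: M0; clear; lra.
  apply: geo_small => //; apply: divr_gt0 => //; apply: divr_gt0 => //.
  by apply: mulr_gt0 => //; exact: wt_gt0.
exists (E + 2)%N; split=> [|e eE N]; first by rewrite leq_addl.
have [e' eE'] : exists e', e = (e' + 2)%N by exists (e - 2)%N; lia.
have Ee' : (E <= e')%N by lia.
have wtD n : wt e n = wt 2 n * wt e' n by rewrite /wt eE' addnC exprD.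
case: (ltnP N b) => [Nb|bN].
  rewrite /nsum big1 ?mulr_ge0 ?md_ge0 ?wt_ge0 // => i _.
  by rewrite gn ?md0 ?mul0r //; apply: leq_trans (ltn_ord i) _.
have bN1 : (b < N.+1)%N by [].
rewrite /nsum (bigD1 (Ordinal bN1)) //=.
have H : \sum_(i < N.+1 | i != Ordinal bN1) modulus (g i) * wt e i <= M * wt e' b.+1.
  apply: (@le_trans _ _ (\sum_(i < N.+1 | i != Ordinal bN1) modulus (g i) * wt 2 i * wt e' b.+1)).
    apply: ler_sum => i ib; rewrite wtD mulrA.
    case: (ltngtP i b) => [h|h|h]; last by case/eqP: ib; exact: val_inj.
      by rewrite gn // md0 !mul0r.
    by rewrite ler_wpM2l ?mulr_ge0 ?md_ge0 ?wt_ge0 // wt_anti.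
  rewrite -mulr_suml ler_wpM2r ?wt_ge0 //; apply: le_trans (gM N).
  rewrite /nsum [leRHS](bigD1 (Ordinal bN1)) //= lerDr mulr_ge0 ?md_ge0 ?wt_ge0 //.
have H2 : M * wt e' b.+1 <= modulus (g b) * wt e b / 2.
  have := HE e' Ee'; rewrite ler_pdivlMr ?ltr_wpDl // => h.
  have qE : wt e' b.+1 = q ^+ e' * wt e' b.
    rewrite /wt -exprMn /q; congr (_ ^+ _).
    by rewrite mulrAC divff ?mul1r // pnatr_eq0 -lt0n.
  rewrite qE wtD; have := wt_ge0 e' b; have : 0 <= q ^+ e' by rewrite exprn_ge0 //; case/andP: q01.
  move: h; set u := q ^+ e'; set v := wt e' b; set w2 := modulus _ * wt 2 b => h u0 v0.
  have -> : modulus (g b) * (wt 2 b * v) / 2 = w2 / 2 * v by rewrite /w2; ring.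
  rewrite mulrA ler_wpM2r //; apply: le_trans h; rewrite mulrC ler_wpM2l // lerDl //.
by move: (le_trans H H2); set A := \sum_(i < _ | _) _; set B := modulus _ * _; clear; lra.
Qed.

Section Ideal.
Variables (ps : seq nat) (a : nat -> nat -> C).
Hypothesis pps : all prime ps.
Hypothesis a1 : forall k n, modulus (a k n) <= 1.
Hypothesis as0 : forall k n, ~~ smooth ps n -> a k n = 0.

(** These series form an ideal that contains all the [a j]; it is the leading indices of
    its elements to which Dickson's lemma is applied. *)
Definition controlled f : Prop := [/\ forall n, ~~ smooth ps n -> f n = 0,
  exists M : R, forall N, nsum f 2 N <= M &
  exists J (B : R), 0 <= B /\ forall x, mchar 2 x ->
    modulus (value f x) <= B * \sum_(j < J) modulus (value (a j) x)].

Lemma nsum_a k e N : (2 <= e)%N -> nsum (a k) e N <= 3.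
Proof.
move=> e2; apply: le_trans (sum_wt2 N); apply: ler_sum => i _.
apply: le_trans (wt_le i e2); rewrite ler_piMl ?wt_ge0 //.
Qed.

Lemma controlled_a k : controlled (a k).
Proof.
split; first exact: as0.
  by exists 3 => N; exact: nsum_a.
exists k.+1, 1; split=> // x _; rewrite mul1r big_ord_recr /= lerDr.
by apply: sumr_ge0 => i _; exact: md_ge0.
Qed.

Lemma sum_mono J J' x : (J <= J')%N ->
  \sum_(j < J) modulus (value (a j) x) <= \sum_(j < J') modulus (value (a j) x).
Proof.
move=> JJ; rewrite -subr_ge0 (sum_nat_sub (fun j => modulus (value (a j) x))) //.
by apply: sumr_ge0 => i _; exact: md_ge0.
Qed.

Lemma sum_value_ge0 J x : 0 <= \sum_(j < J) modulus (value (a j) x).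
Proof. by apply: sumr_ge0 => i _; exact: md_ge0. Qed.

Lemma controlled_step f g al m : controlled f -> controlled g -> smooth ps m ->
  controlled (fun n => f n - al * shift m g n).
Proof.
move=> [fs [M fM] [J [B [B0 fB]]]] [gs [M' gM] [J' [B' [B0' gB]]]] sm.
have m0 := smooth_gt0 sm.
split.
- move=> n sn; rewrite fs // /shift; case: ifP => mn; last by rewrite mulr0 subrr.
  case: (posnP n) => [n0|n0].
    by rewrite n0 div0n gs ?mulr0 ?subrr //; apply/negP => /smooth_gt0.
  rewrite gs ?mulr0 ?subrr //; apply: contra sn => h.
  rewrite -(divnK mn) smoothM //; last by rewrite divn_gt0 // dvdn_leq.
  by rewrite h.
- exists (M + modulus al * (wt 2 m * M')) => N; apply: le_trans (nsum_sub _ _ _ _ _) _.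
  by rewrite lerD // ler_wpM2l ?md_ge0 // nsum_shift // ler_wpM2l ?wt_ge0.
exists (maxn J J'), (B + modulus al * B'); split=> [|x x2].
  by rewrite addr_ge0 // mulr_ge0 ?md_ge0.
rewrite (value_step al m0 x2 fM gM); apply: le_trans (mdB _ _) _; rewrite mulrDl lerD //.
  by apply: le_trans (fB _ x2) _; rewrite ler_wpM2l // sum_mono // leq_maxl.
rewrite !mdM -mulrA ler_wpM2l ?md_ge0 //.
have xm : modulus (x m) <= 1.
  apply: le_trans (x2.2 m) _; rewrite /wt exprn_ile1 //; by have /andP[] := inv_nat01 m.
apply: (@le_trans _ _ (modulus (value g x))); first by rewrite ler_piMl ?md_ge0.
by apply: le_trans (gB _ x2) _; rewrite ler_wpM2l // sum_mono // leq_maxr.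
Qed.

Lemma sum_mem_le (T : eqType) (s : seq T) (F : T -> R) t : (forall t, 0 <= F t) -> t \in s ->
  F t <= \sum_(u <- s) F u.
Proof.
by move=> F0 ts; rewrite (big_rem t) //= lerDl; apply: sumr_ge0.
Qed.

(** By Dickson's lemma the leading indices of the controlled series are the multiples of
    finitely many of them, attained by series [g b]. For a steep weight each [g b] has a
    tail of norm at most half of its leading term. Subtracting a multiple of a
    suitable shift of [g b] removes the leading term of a controlled series; the result
    is again controlled, and its norm drops by at least half of the norm of the term
    removed. Hence the multipliers used in all the steps have a bounded total norm, and the
    series that remains after [j] steps, whose terms have index at least [j], has a value
    that tends to 0. *)
Theorem division : exists N e (D : R), [/\ (2 <= e)%N, 0 <= D &
  forall x, mchar e x -> forall k,
    modulus (value (a k) x) <= D * \sum_(j < N) modulus (value (a j) x)].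
Proof.
pose A b := exists f, controlled f /\ leads f b.
have As b : A b -> smooth ps b.
  move=> [f [[fs _ _] [fb _]]]; apply: contraNT fb => sb; by rewrite fs.
have [s [sA sB]] := dickson pps As.
have exg : forall b, exists z : (nat -> C) * nat * nat * R, b \in s ->
   let '(g, e0, J, B) := z in [/\ leads g b, controlled g, (2 <= e0)%N /\
     forall e, (e0 <= e)%N -> forall N, nsum g e N <= 3 / 2 * (modulus (g b) * wt e b),
     0 <= B & forall x, mchar 2 x -> modulus (value g x) <= B * \sum_(j < J) modulus (value (a j) x)].
  move=> b; have [bs|_] := boolP (b \in s); last by exists (fun=> 0, 0%N, 0%N, 0).
  have [g [cg lg]] := sA b bs; have b0 := smooth_gt0 (As b (sA b bs)).
  have [gs [M gM] [J [B [B0 gB]]]] := cg.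
  have [e0 [e2 he]] := leading_dominates b0 lg gM.
  by exists (g, e0, J, B).
have [z zP] := choice exg.
pose g b := (z b).1.1.1; pose e0 b := (z b).1.1.2; pose J b := (z b).1.2; pose B b := (z b).2.
have gP b : b \in s -> [/\ leads (g b) b, controlled (g b), (2 <= e0 b)%N /\
     forall e, (e0 b <= e)%N -> forall N, nsum (g b) e N <= 3 / 2 * (modulus (g b b) * wt e b),
     0 <= B b & forall x, mchar 2 x -> modulus (value (g b) x) <= B b * \sum_(j < J b) modulus (value (a j) x)].
  by move=> /zP; rewrite /g /e0 /J /B; case: (z b) => [[[? ?] ?] ?].
pose e := (2 + \sum_(b <- s) e0 b)%N.
pose N := (\sum_(b <- s) J b)%N.
pose BB := \sum_(b <- s) `|B b|.
(* [Kc] bounds the ratio of the norm of a multiplier to that of the term it removes. *)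
pose Kc : R := 1 + \sum_(b <- s) `|(modulus (g b b) * wt e b)^-1|.
have Kc0 : 0 < Kc by rewrite ltr_pwDl // sumr_ge0.
have BB0 : 0 <= BB by rewrite sumr_ge0.
pose S x := BB * \sum_(j < N) modulus (value (a j) x).
have S0 x : 0 <= S x by rewrite mulr_ge0 // sum_value_ge0.
have e2 : (2 <= e)%N by rewrite leq_addr.
have gS b x : b \in s -> mchar e x -> modulus (value (g b) x) <= S x.
  move=> bs xe; have [_ _ _ B0 gB] := gP b bs.
  apply: le_trans (gB _ (mchar_le e2 xe)) _; apply: ler_pM => //; first exact: sum_value_ge0.
    rewrite -[B b]ger0_norm //; exact: (sum_mem_le (F := fun b => `|B b|)).
  by apply: sum_mono; rewrite /N (big_rem b) //= leq_addr.
have gK b : b \in s -> (modulus (g b b) * wt e b)^-1 <= Kc.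
  move=> bs; apply: (le_trans (ler_norm _)).
  apply: le_trans (sum_mem_le (F := fun b => `|(modulus (g b b) * wt e b)^-1|) _ bs) _ => //.
  by rewrite lerDr.
have gT b n : b \in s -> nsum (g b) e n <= 3 / 2 * (modulus (g b b) * wt e b).
  move=> bs; have [_ _ [_ h] _ _] := gP b bs; apply: h.
  by rewrite /e (big_rem b) //= addnCA leq_addr.
(* [K] is the total norm of the multipliers used so far; the last clause says that the norm
   of [f'] has decreased accordingly. *)
have reduce f (M : R) : controlled f -> (forall n, nsum f e n <= M) -> forall j,
    exists f' (K : R), [/\ controlled f', forall n, (n < j)%N -> f' n = 0, 0 <= K,
      forall x, mchar e x -> modulus (value f x) <= modulus (value f' x) + K * S x &
      forall n, (j <= n)%N -> K + 2 * Kc * nsum f' e n <= 2 * Kc * M].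
  move=> cf fM; elim=> [|j [f' [K [cf' f'0 K0 ff' Kn]]]].
    exists f, 0; split=> // [x _|n _]; first by rewrite mul0r addr0.
    by rewrite add0r ler_wpM2l // mulr_ge0 // ltW.
  have [fj|fj] := eqVneq (f' j) 0.
    exists f', K; split=> // [n|n jn]; last by apply: Kn; exact: ltnW.
    by rewrite ltnS leq_eqVlt => /orP[/eqP -> //|]; exact: f'0.
  have Aj : A j by exists f'.
  have [b bs bj] := sB j Aj.
  have sj := As j Aj; have j0 := smooth_gt0 sj.
  have b0 : (0 < b)%N by exact: dvdn_gt0 bj.
  pose m := (j %/ b)%N; have jE : j = (m * b)%N by rewrite divnK.
  have m0 : (0 < m)%N by rewrite divn_gt0 // dvdn_leq.
  have sm : smooth ps m by move: sj; rewrite jE smoothM // => /andP[].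
  have [[gb gn] cg _ _ _] := gP b bs.
  pose al := f' j / g b b.
  pose h n := f' n - al * shift m (g b) n.
  have hj : shift m (g b) j = g b b by rewrite /shift jE dvdn_mulr // mulKn.
  have ch : controlled h by exact: controlled_step.
  have gb0 : 0 < modulus (g b b) by rewrite md_gt0.
  have alE : modulus al * modulus (g b b) = modulus (f' j) by rewrite -mdM /al divfK.
  have wj : wt e j = wt e m * wt e b by rewrite jE wtM.
  have alK : modulus al * wt e m <= Kc * (modulus (f' j) * wt e j).
    apply: (@le_trans _ _ ((modulus (g b b) * wt e b)^-1 * (modulus (f' j) * wt e j))).
      rewrite -alE wj le_eqVlt; apply/orP; left; apply/eqP; field.
      by rewrite !gt_eqF // wt_gt0.
    by rewrite ler_wpM2r ?gK // mulr_ge0 ?md_ge0 ?wt_ge0.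
  exists h, (K + modulus al * wt e m); split=> //.
  - move=> n; rewrite ltnS leq_eqVlt => /orP[/eqP ->|nj].
      by rewrite /h hj /al divfK // subrr.
    rewrite /h f'0 // /shift; case: ifP => mn; last by rewrite mulr0 subrr.
    rewrite gn ?mulr0 ?subrr //; rewrite ltn_divLR //; by rewrite mulnC -jE.
  - by rewrite addr_ge0 // mulr_ge0 ?md_ge0 ?wt_ge0.
  - move=> x xe; have x2 := mchar_le e2 xe.
    have [_ [M1 f'M] _] := cf'; have [_ [M2 gM] _] := cg.
    apply: le_trans (ff' x xe) _.
    have := value_step al m0 x2 f'M gM; rewrite -/h => hE.
    have -> : value f' x = value h x + al * (x m * value (g b) x) by rewrite hE subrK.
    apply: le_trans (lerD (mdD _ _) (lexx _)) _; rewrite mulrDl (mdM al) (mdM (x m)).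
    have : modulus al * (modulus (x m) * modulus (value (g b) x)) <= modulus al * wt e m * S x.
      rewrite -mulrA ler_wpM2l ?md_ge0 //; apply: ler_pM; rewrite ?md_ge0 ?gS //; exact: xe.2.
    by clear; lra.
  move=> n jn; have jn' := ltnW jn.
  (* The removed term is counted with coefficient 1 in the norm of [f'] and again in that
     of the shifted series, whose other terms add up to half as much. *)
  have : nsum h e n <= nsum f' e n - modulus (f' j) * wt e j / 2.
    have jn1 : (j < n.+1)%N by exact: leq_trans jn _.
    apply: (@le_trans _ _ (nsum f' e n + modulus al * nsum (shift m (g b)) e n - 2 * (modulus (f' j) * wt e j))).
      rewrite /nsum mulr_sumr -big_split /= [leLHS](bigD1 (Ordinal jn1)) //= [in leRHS](bigD1 (Ordinal jn1)) //=.
      rewrite {1}/h hj /al divfK // subrr md0 mul0r add0r -/al mulrA alE.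
      have -> : forall p q : R, p + p + q - 2 * p = q by move=> p q; ring.
      apply: ler_sum => i _; rewrite mulrA -mulrDl ler_wpM2r ?wt_ge0 // -mdM; exact: mdB.
    rewrite nsum_shift //.
    have : modulus al * (wt e m * nsum (g b) e (n %/ m)) <= 3 / 2 * (modulus (f' j) * wt e j).
      apply: (@le_trans _ _ (modulus al * (wt e m * (3 / 2 * (modulus (g b b) * wt e b))))).
        by rewrite ler_wpM2l ?md_ge0 // ler_wpM2l ?wt_ge0 // gT.
      by rewrite -alE wj le_eqVlt; apply/orP; left; apply/eqP; ring.
    by clear; lra.
  have := Kn n jn'; move: alK (Kc0); set F := modulus (f' j) * _; set P := modulus al * _.
  by set n1 := nsum h e n; set n2 := nsum f' e n; clear; nra.
exists N, e.+1, (6 * Kc * BB); split=> [||x xe k]; first exact: leqW.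
  by rewrite !mulr_ge0 // ltW.
have xe' := mchar_le (leqnSn e) xe.
rewrite -mulrA -/(S x); apply/ler_addgt0Pr => d d0.
have [n0 hn0] : exists n0 : nat, 3 / d < n0%:R by exists (Num.truncn (3 / d)).+1; exact: truncnS_gt.
have n00 : 0 < (n0%:R : R) by apply: lt_trans hn0; rewrite divr_gt0.
have [f' [K [cf' f'0 K0 ff' Kn]]] := reduce (a k) 3 (controlled_a k) (fun n => nsum_a k n e2) n0.
apply: le_trans (ff' x xe') _.
have b1 : nsum f' e n0 <= 3.
  by have := Kn n0 (leqnn _); move: K0 Kc0; clear; nra.
have Kb n : (n0 <= n)%N -> nsum f' e n <= 3 by move=> /Kn; move: K0 Kc0; clear; nra.
have K6 : K <= 6 * Kc.
  by have := Kn n0 (leqnn _); have := nsum_ge0 f' e n0; move: Kc0; clear; nra.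
have v1 : modulus (value f' x) <= 3 / n0%:R.
  have [_ [M f'M] _] := cf'.
  apply: (cconv_le (value_cconv f'M (mchar_le e2 xe'))) => n.
  apply: le_trans (md_sum _ _ _) _.
  apply: (@le_trans _ _ (nsum f' e n / n0%:R)).
    rewrite /nsum mulr_suml; apply: ler_sum => i _; rewrite mdM.
    case: (ltnP i n0) => hi; first by rewrite f'0 // md0 !mul0r.
    rewrite -mulrA ler_wpM2l ?md_ge0 //; apply: le_trans (xe.2 i) _.
    rewrite /wt exprS mulrC ler_wpM2l ?exprn_ge0 ?invr_ge0 // lef_pV2 ?posrE //.
      by rewrite ler_nat.
    by apply: lt_le_trans n00 _; rewrite ler_nat.
  rewrite ler_wpM2r ?invr_ge0 //; apply: le_trans (nsum_mono f' e (leq_maxr n0 n)) _.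
  by apply: Kb; exact: leq_maxl.
have : 3 / n0%:R <= d.
  by move: hn0; rewrite ltr_pdivrMr // ler_pdivrMr // mulrC => /ltW.
have : K * S x <= 6 * Kc * S x by rewrite ler_wpM2r.
by move: v1; clear; lra.
Qed.

End Ideal.
End Division.

(** * Zeros of a series dominated by finitely many coefficients *)

Section FewZeros.
Variable R : realType.
Local Notation C := R[i].
Implicit Types (b : nat -> C) (g : C -> C) (x y z w : C) (zs : seq C).

Lemma psum_cst w : psum (fun k => if k == 0%N then w else 0) (fun=> w) (modulus w) 1.
Proof.
apply: psum_intro => // [k|z z1].
  by case: eqP => _; rewrite ?md0 ?mul0r ?md_ge0 // expr1n mulr1.
move=> e e0; exists 1%N => -[//|n] _.
by rewrite big_ord_recl /= expr0 mulr1 big1 ?addr0 ?subrr ?md0 ?ltW // => i _; rewrite mul0r.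
Qed.

(** Cauchy estimates for [g - w] on the disc of radius 1/4, where the constant [w]
    affects the coefficient of index 0 only. *)
Lemma coef_from_values b g w (N : nat) (X : R) : psum b g 1 1 -> 0 <= X ->
  (forall y, modulus y < 1 / 4 -> modulus (g y - w) <= X) ->
  \sum_(j < N) modulus (b j.+1) <= N%:R * 4 ^+ N * X.
Proof.
move=> hb X0 gX.
have h := psumB ltr01 hb (psum_cst w).
have q0 : 0 < 1 / 4 :> R by rewrite divr_gt0.
have q1 : 1 / 4 <= 1 :> R by rewrite ler_pdivrMr // mul1r ler1n.
have est := cauchy_est q0 (psum_shrink q0 q1 h) gX.
apply: (@le_trans _ _ (\sum_(j < N) 4 ^+ N * X)).
  apply: ler_sum => j _; have := est j.+1; rewrite /= subr0 mul1r exprVn.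
  rewrite ler_pdivrMr ?exprn_gt0 // => h1; apply: le_trans h1 _.
  by rewrite mulrC ler_wpM2r // ler_weXn2l // ler1n.
by rewrite sumr_const card_ord -[_ *+ N]mulr_natl mulrA.
Qed.

(** Let [S] be the sum of the first [N] coefficients in modulus. If [S = 0] then [g] is
    constant. Otherwise [g - w] is at most a constant times [S] on a disc, as soon as [w] is
    a value of [g]. If it had many zeros in a smaller disc, their Blaschke product would
    make it much smaller than [S] there, and the Cauchy estimates would make the first [N]
    coefficients add up to less than [S]. *)
Lemma few_zeros (D : R) (N : nat) : exists P : nat, forall b g, psum b g 1 1 ->
  (forall k, modulus (b k.+1) <= D * \sum_(j < N) modulus (b j.+1)) ->
  (forall z, modulus z < 1 -> g z = g 0) \/
  forall w zs, uniq zs -> (forall z, z \in zs -> modulus z <= 1 / 4 /\ g z = w) -> (size zs <= P)%N.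
Proof.
pose D' := `|D| + 1; have D0 : 0 < D' by rewrite ltr_wpDl.
pose bb := bbound (1 / 2 : R) (1 / 2).
have half01 : 0 <= (1 / 2 : R) < 1 by apply/andP; split; lra.
have /andP[bb0 bb1] : 0 < bb < 1 by apply: bbound01.
pose A := N%:R * 4 ^+ N * (2 * D').
have A0 : 0 <= A by rewrite !mulr_ge0 ?exprn_ge0 // ltW.
have [P HP] : exists P, forall n, (P <= n)%N -> bb ^+ n <= 1 / (A ^+ 2 + 1) / 2.
  apply: geo_small; first by rewrite ltW.
  by rewrite !divr_gt0 // ltr_wpDl // sqr_ge0.
exists P => b g hb bD; set S := \sum_(j < N) modulus (b j.+1) in bD.
have S0 : 0 <= S by apply: sumr_ge0 => i _; exact: md_ge0.
have bD' k : modulus (b k.+1) <= D' * S.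
  apply: le_trans (bD k) _; rewrite ler_wpM2r // /D'; apply: le_trans (ler_norm D) _.
  by rewrite lerDl.
have near x : modulus x < 1 / 2 -> modulus (g x - b 0%N) <= D' * S.
  move=> x2; have x1 : modulus x < 1 by apply: lt_trans x2 _; lra.
  have h := psum_cconv (psumB ltr01 hb (psum_cst (b 0%N))) x1.
  apply: (cconv_le h) => -[|n]; first by rewrite big_ord0 md0 mulr_ge0 // ltW.
  rewrite big_ord_recl /= subrr mul0r add0r; apply: le_trans (md_sum _ _ _) _.
  apply: (@le_trans _ _ (\sum_(i < n) D' * S * (1 / 2) ^+ i.+1)).
    apply: ler_sum => i _; rewrite subr0 mdM mdX /bump /= add1n; apply: ler_pM.
    - exact: md_ge0.
    - by rewrite exprn_ge0 // md_ge0.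
    - exact: bD'.
    by rewrite lerXn2r ?nnegrE ?md_ge0 // ltW.
  rewrite -mulr_sumr ler_piMr ?mulr_ge0 ?(ltW D0) //.
  under eq_bigr do rewrite exprS.
  rewrite -mulr_sumr; have := geo_partial half01 (leq0n n); rewrite big_mkord expr0.
  rewrite ler_pdivlMr; last by lra.
  by set t := \sum_(i < n) _; lra.
have [S1|S1] := eqVneq S 0.
  left=> z z1; have zero x : modulus x < 1 -> g x = b 0%N.
    move=> x1; apply: (cconv_unique (psum_cconv hb x1)) => e e0; exists 1%N => -[//|n] _.
    rewrite big_ord_recl /= expr0 mulr1 big1 ?addr0 ?subrr ?md0 ?ltW // => i _.
    have : modulus (b (bump 0 i)) <= 0 by have := bD' i; rewrite S1 mulr0.
    by rewrite le_eqVlt ltNge md_ge0 orbF md_eq0 => /eqP ->; rewrite mul0r.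
  by rewrite !zero // md0.
right=> w zs uz zw; case: zs uz zw => [//|z1 zs] uz zw.
have {}S0 : 0 < S by rewrite lt0r S1.
have [z14 gz1] := zw z1 (mem_head _ _).
(* [w] is the value of [g] at a point of the disc of radius 1/2, so that [g - w] is at
   most [B] on that disc. *)
pose B := 2 * D' * S; have B0 : 0 < B by rewrite !mulr_gt0.
pose h x := (g ((1 / 2)%:C%C * x + 0) + (- w)) * (B^-1)%:C%C.
have md2 x : modulus ((1 / 2)%:C%C * x + 0) = modulus x / 2.
  by rewrite addr0 mdM md_real ger0_norm //; ring.
have hE x : modulus (h x) = modulus (g ((1 / 2)%:C%C * x + 0) - w) / B.
  by rewrite /h mdM md_real ger0_norm // invr_ge0 ltW.
have hh : holo h 1.
  move=> x x1; apply: cdiffM; last exact: cdiff_cst.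
  apply: cdiffD; last exact: cdiff_cst.
  apply: cdiff_affine; apply: (psum_cdiff hb); rewrite md2; move: x1; lra.
have h1 x : modulus x < 1 -> modulus (h x) <= 1.
  move=> x1; rewrite hE ler_pdivrMr // [1 * B]mul1r.
  apply: le_trans (md_tri _ (b 0%N) _) _.
  have -> : B = D' * S + D' * S by rewrite /B; ring.
  apply: lerD; first by apply: near; rewrite md2; move: x1; lra.
  by rewrite mdC -gz1; apply: near; move: z14; lra.
have back y : h (2 * y) = (g y - w) * (B^-1)%:C%C.
  rewrite /h addr0 mulrA; congr ((g _ - w) * _).
  have -> : (2 : C) = (2 : R)%:C%C by rewrite rmorph_nat.
  by rewrite -rmorphM /= divfK ?mul1r // pnatr_eq0.
have [z0 z02 hz0] : exists2 z0, modulus z0 <= 1 / 2 & h z0 != 0.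
  apply: contrapT => H.
  have : S <= N%:R * 4 ^+ N * 0.
    apply: (@coef_from_values b g w N 0 hb) => // y y4.
    have [/eqP E|ne] := boolP (h (2 * y) == 0); last first.
      by case: H; exists (2 * y) => //; rewrite mdM md_natr; move: y4; lra.
    have : modulus (h (2 * y)) = 0 by rewrite E md0.
    rewrite back mdM md_real gtr0_norm ?invr_gt0 // => /eqP.
    by rewrite mulf_eq0 invr_eq0 (gt_eqF B0) orbF => /eqP ->.
  by rewrite mulr0 leNgt S0.
have [cs [k [hk k1 csb hfac kn0]]] := zero_factorization half01 half01 hh h1 z02 hz0.
have sub : (size (z1 :: zs) <= size cs)%N.
  rewrite -(size_map (fun z => 2 * z)); apply: uniq_leq_size.
    rewrite map_inj_uniq // => p q /mulfI; apply; by rewrite pnatr_eq0.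
  move=> _ /mapP[z zi ->]; have [z4 gz] := zw z zi.
  have m2 : modulus (2 * z) <= 1 / 2 by rewrite mdM md_natr; move: z4; lra.
  have m1 : modulus (2 * z) < 1 by apply: le_lt_trans m2 _; lra.
  rewrite -(bprod_eq0 _ (ltW m1)); last by move=> c /csb h2; apply: le_lt_trans h2 _; lra.
  have := hfac _ m1; rewrite back gz subrr mul0r => /esym/eqP.
  by rewrite mulf_eq0 (negbTE (kn0 _ m2)) orbF.
rewrite leqNgt; apply/negP => Pzs.
have Pcs : (P <= size cs)%N by apply: leq_trans sub; exact: ltnW.
pose be := Num.sqrt (bb ^+ size cs).
have be2 : be ^+ 2 = bb ^+ size cs by rewrite sqr_sqrtr // exprn_ge0 // ltW.
have be0 : 0 <= be by exact: sqrtr_ge0.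
have hb2 x : modulus x <= 1 / 2 -> modulus (h x) <= be.
  move=> x2; have x1 : modulus x < 1 by apply: le_lt_trans x2 _; lra.
  rewrite hfac // mdM.
  apply: (@le_trans _ _ (modulus (bprod cs x))); first by rewrite ler_piMr ?md_ge0 ?k1.
  rewrite -ler_sqr ?nnegrE ?md_ge0 // be2; exact: bprod_bound.
have : S <= N%:R * 4 ^+ N * (be * B).
  apply: (@coef_from_values b g w N _ hb); first by rewrite mulr_ge0 // ltW.
  move=> y y4; have := hb2 (2 * y); rewrite back (mdM (g y - w)) md_real gtr0_norm ?invr_gt0 //.
  by rewrite ler_pdivrMr // => H; apply: H; rewrite mdM md_natr; move: y4; lra.
have -> : N%:R * 4 ^+ N * (be * B) = A * be * S by rewrite /A /B; ring.
rewrite -{1}[S]mul1r ler_pM2r // => A1.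
have A2 : 1 <= A ^+ 2 * bb ^+ size cs.
  by rewrite -be2 -exprMn -[1](expr1n _ 2) ler_sqr ?nnegrE // mulr_ge0.
have A3 : 0 < A ^+ 2 + 1 by rewrite ltr_wpDl // sqr_ge0.
have := HP _ Pcs; rewrite ler_pdivlMr // ler_pdivlMr // => H.
have := sqr_ge0 A; have : 0 <= bb ^+ size cs by rewrite exprn_ge0 // ltW.
by move: A2 H; set a2 := A ^+ 2; set t := bb ^+ _; clear; nra.
Qed.

End FewZeros.

(** * Local uniform valency *)

Section Local.
Variable R : realType.
Local Notation C := R[i].

Lemma prime_sequence : exists pr : nat -> nat, injective pr /\ forall j, prime (pr j).
Proof.
have h m : exists p, (m < p)%N && prime p by have [p mp pp] := prime_above m; exists p; rewrite mp.
have [nx nxP] := choice h.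
exists (fun j => iter j.+1 nx 0%N); split=> [|j]; last by rewrite iterS; case/andP: (nxP (iter j nx 0%N)).
have mono : {homo (fun j => iter j.+1 nx 0%N) : i j / (i < j)%N}.
  by apply: (homo_ltn ltn_trans) => i; rewrite [X in (_ < X)%N]iterS; case/andP: (nxP (iter i.+1 nx 0%N)).
move=> i j E; case: (ltngtP i j) => // /mono; by rewrite E ltnn.
Qed.

Section Space.
Variable n : nat.
Implicit Types (f : 'rV[C]_n -> C) (y v : 'rV[C]_n) (lam : nat -> C).

(** Continuity of the squared norm, with respect to the coordinates. *)
Lemma enorm_near y0 (e : R) : 0 < e -> exists2 d : R, 0 < d & forall y,
  (forall i, modulus (y0 ord0 i - y ord0 i) < d) -> `|enorm y ^+ 2 - enorm y0 ^+ 2| <= e.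
Proof.
move=> e0; pose V := \sum_(i < n) modulus (y0 ord0 i).
have V0 : 0 <= V by apply: sumr_ge0 => i _; exact: md_ge0.
pose D := n%:R * (2 * V + 1) + e.
have D0 : 0 < D by rewrite ltr_wpDl // mulr_ge0 //; move: V0; lra.
pose d := e / D; have d0 : 0 < d by rewrite divr_gt0.
have d1 : d <= 1.
  by rewrite ler_pdivrMr // mul1r lerDr mulr_ge0 //; move: V0; lra.
exists d => // y yd; rewrite !enorm_sq -sumrB.
apply: le_trans (ler_norm_sum _ _ _) _.
apply: (@le_trans _ _ (\sum_(i < n) d * (2 * V + 1))).
  apply: ler_sum => i _.
  have Vi : modulus (y0 ord0 i) <= V.
    by rewrite /V (bigD1 i) //= lerDl; apply: sumr_ge0 => j _; exact: md_ge0.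
  have := md_dist (y ord0 i) (y0 ord0 i); have := yd i; rewrite mdC.
  set p := modulus (y ord0 i); set q := modulus (y0 ord0 i) in Vi *.
  have p0 : 0 <= p by exact: md_ge0. have q0 : 0 <= q by exact: md_ge0.
  move=> h1 h2; have {h1 h2} : `|p - q| <= d by apply: le_trans h2 (ltW h1).
  rewrite !ler_norml => /andP[h1 h2]; apply/andP; split; move: Vi p0 q0 h1 h2 d1 d0 V0; clear; nra.
rewrite sumr_const card_ord -[_ *+ n]mulr_natl /d.
have -> : n%:R * (e / D * (2 * V + 1)) = e * (n%:R * (2 * V + 1) / D) by ring.
by rewrite ler_piMr ?(ltW e0) // ler_pdivrMr // mul1r /D lerDl ltW.
Qed.

(** Neither alternative can be dropped: a limit of lines on which [f] is not constant may
    be a line on which it is. *)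
Definition tame f (P : nat) (d : R) y v : Prop :=
  (forall a, modulus a < d -> f (y + a *: v) = f y) \/
  forall w zs, uniq zs -> (forall a, a \in zs -> modulus a < d /\ f (y + a *: v) = w) ->
    (size zs <= P)%N.

Section Coordinates.
Variables (pr : nat -> nat) (y0 v0 : 'rV[C]_n) (eta eta2 : R).
Hypotheses (pr_inj : injective pr) (pr_prime : forall j, prime (pr j)).

(** The variable at the [i]-th prime moves the [i]-th coordinate of the base point, the
    one at the [(n + i)]-th prime that of the direction; [x] is the coordinate along the line. *)
Definition chart lam (x : C) : 'rV[C]_n :=
  \row_i (y0 ord0 i + eta%:C%C * lam (pr i) +
          eta2%:C%C * x * (v0 ord0 i + lam (pr (n + i)))).

Lemma chart_upd lam p x : exists E, forall z,
  chart (upd lam p z) x = chart (upd lam p 0) x + z *: E.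
Proof.
exists (\row_i (eta%:C%C * (pr i == p)%:R + eta2%:C%C * x * (pr (n + i) == p)%:R)) => z.
have h (j : nat) : upd lam p z j = upd lam p 0 j + z * (j == p)%:R.
  by rewrite /upd; case: eqP => _; rewrite ?mulr1 ?add0r // mulr0 addr0.
by apply/rowP => i; rewrite !mxE !h; ring.
Qed.

Lemma chart_near lam x (d V : R) : (forall i, modulus (v0 ord0 i) <= V) -> 0 <= V -> 0 < d ->
  eta = d / 8 -> eta2 = d / (8 * (V + 2)) ->
  (forall j, (j < n + n)%N -> modulus (lam (pr j)) < 2) -> modulus x < 2 ->
  forall i, modulus (y0 ord0 i - chart lam x ord0 i) < d.
Proof.
move=> hV V0 d0 E1 E2 hl x2 i; rewrite mxE mdC.
rewrite [X in modulus X](_ : _ = eta%:C%C * lam (pr i) +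
  eta2%:C%C * x * (v0 ord0 i + lam (pr (n + i)%N))); last by ring.
have V2 : 0 < V + 2 by rewrite ltr_wpDl.
have e10 : 0 <= eta by rewrite E1 divr_ge0 // ltW.
have e20 : 0 <= eta2 by rewrite E2 divr_ge0 // ?mulr_ge0 // ltW.
apply: le_lt_trans (mdD _ _) _; rewrite !mdM !md_real !ger0_norm //.
have l1 := hl i (leq_trans (ltn_ord i) (leq_addr _ _)).
have l2 : modulus (lam (pr (n + i)%N)) < 2 by apply: hl; rewrite ltn_add2l.
have l3 : modulus (v0 ord0 i + lam (pr (n + i)%N)) <= V + 2.
  by apply: le_trans (mdD _ _) _; apply: lerD; [exact: hV | exact: ltW].
have e2 : eta2 * (V + 2) = d / 8 by rewrite E2; field; apply: lt0r_neq0.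
have : eta2 * modulus x * modulus (v0 ord0 i + lam (pr (n + i)%N)) <= eta2 * 2 * (V + 2).
  apply: ler_pM; rewrite ?mulr_ge0 ?md_ge0 //; by rewrite ler_wpM2l // ltW.
have : eta * modulus (lam (pr i)) <= eta * 2.
  by rewrite ler_wpM2l ?(ltW l1) // E1 divr_ge0 // ltW.
have -> : eta2 * 2 * (V + 2) = 2 * (eta2 * (V + 2)) by ring.
by rewrite e2 E1; move: d0; lra.
Qed.

Lemma chart_onto y v : (0 < eta) -> exists lam, (forall x, chart lam x = y + (eta2%:C%C * x) *: v) /\
  forall (i : 'I_n), modulus (lam (pr i)) = modulus (y ord0 i - y0 ord0 i) / eta /\
    modulus (lam (pr (n + i))) = modulus (v ord0 i - v0 ord0 i).
Proof.
move=> h0.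
pose u j : C := if (j < n)%N then (if insub j is Some i then (y ord0 i - y0 ord0 i) / eta%:C%C else 0)
  else (if insub (j - n)%N is Some i then v ord0 i - v0 ord0 i else 0).
pose lam p : C := u (xget 0%N [set j | pr j = p]).
have lamE j : lam (pr j) = u j.
  congr u; apply: pr_inj; exact: (xgetI 0%N (erefl : [set i | pr i = pr j] j)).
have u1 (i : 'I_n) : lam (pr i) = (y ord0 i - y0 ord0 i) / eta%:C%C.
  by rewrite lamE /u ltn_ord valK.
have u2 (i : 'I_n) : lam (pr (n + i)%N) = v ord0 i - v0 ord0 i.
  by rewrite lamE /u ltnNge leq_addr /= addKn valK.
have en : eta%:C%C != 0 :> C by rewrite -md_eq0 md_real gtr0_norm // gt_eqF.
exists lam; split=> [x|i].
  apply/rowP => i; rewrite !mxE u1 u2 mulrC divfK // [_ + (y _ _ - _)]addrC subrK.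
  by rewrite [v0 _ _ + _]addrC subrK.
by rewrite u1 u2 mdM mdV md_real gtr0_norm.
Qed.

End Coordinates.

(** After rescaling, [f] composed with [chart] is bounded by 1 and separately
    holomorphic in [lam] and [x] on the polydisc of radius 2. Its Taylor coefficients in
    [x] are functions of [lam] to which [expansion] and then [division] apply, and
    [few_zeros] concludes, with constants independent of [lam]. *)
Theorem local_tameness f (r : R) y0 v0 : 0 < r -> holomorphic_on_ball r f -> cball r y0 ->
  exists (P : nat) (d e : R), [/\ 0 < d, 0 < e & forall y v,
    (forall i, modulus (y0 ord0 i - y ord0 i) < e) ->
    (forall i, modulus (v0 ord0 i - v ord0 i) < e) -> tame f P d y v].
Proof.
move=> r0 hf y0r; have [pr [pr_inj pr_prime]] := prime_sequence.
have [d1 d10 fb] := locally_bounded hf y0r.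
have g0 : 0 < (r ^+ 2 - enorm y0 ^+ 2) / 2.
  by move: y0r; rewrite /cball /= enorm_lt // => h; rewrite divr_gt0 // subr_gt0.
have [d2 d20 nb] := enorm_near y0 g0.
pose d := Num.min d1 d2; have d0 : 0 < d by rewrite lt_min d10.
pose V := \sum_(i < n) modulus (v0 ord0 i).
have V0 : 0 <= V by apply: sumr_ge0 => i _; exact: md_ge0.
have hV i : modulus (v0 ord0 i) <= V.
  by rewrite /V (bigD1 i) //= lerDl; apply: sumr_ge0 => j _; exact: md_ge0.
pose eta := d / 8; pose eta2 := d / (8 * (V + 2)).
have eta0 : 0 < eta by rewrite divr_gt0.
have V2 : 0 < V + 2 by move: V0; clear; lra.
have eta20 : 0 < eta2 by rewrite divr_gt0 // mulr_gt0.
pose M := modulus (f y0) + 1; have M0 : 0 < M by rewrite ltr_wpDl ?md_ge0.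
pose ps := [seq pr j | j <- iota 0 (n + n)].
have psP p : p \in ps -> exists2 j, (j < n + n)%N & p = pr j.
  by move=> /mapP[j]; rewrite mem_iota => /andP[_ jn] ->; exists j.
have prps j : (j < n + n)%N -> pr j \in ps by move=> jn; rewrite map_f // mem_iota.
have pps : all prime ps by apply/allP => p /psP[j _ ->].
have ups : uniq ps by rewrite map_inj_uniq ?iota_uniq.
pose Y := chart pr y0 v0 eta eta2.
pose H lam x := f (Y lam x) * (M^-1)%:C%C.
pose dom lam := forall p, p \in ps -> modulus (lam p) < 2.
have near lam x : dom lam -> modulus x < 2 -> forall i, modulus (y0 ord0 i - Y lam x ord0 i) < d.
  by move=> ld x2; apply: (@chart_near pr y0 v0 eta eta2 lam x d V hV) => // j jn; apply: ld; exact: prps.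
have inball lam x : dom lam -> modulus x < 2 -> cball r (Y lam x).
  move=> ld x2; have : `|enorm (Y lam x) ^+ 2 - enorm y0 ^+ 2| <= (r ^+ 2 - enorm y0 ^+ 2) / 2.
    by apply: nb => i; apply: lt_le_trans (near lam x ld x2 i) _; rewrite ge_min lexx orbT.
  rewrite ler_norml => /andP[_ h]; rewrite /cball /= enorm_lt //; move: h g0; clear; lra.
have H1 lam x : dom lam -> modulus x < 2 -> modulus (H lam x) <= 1.
  move=> ld x2; rewrite mdM md_real gtr0_norm ?invr_gt0 // ler_pdivrMr // [1 * M]mul1r.
  by apply: fb => i; apply: lt_le_trans (near lam x ld x2 i) _; rewrite ge_min lexx.
have Hx lam : dom lam -> holo (H lam) 2.
  move=> ld x x2; apply: cdiffM; last exact: cdiff_cst.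
  pose w := \row_i (eta2%:C%C * (v0 ord0 i + lam (pr (n + i)%N))).
  have E z : Y lam z = Y lam 0 + z *: w.
    by apply/rowP => i; rewrite !mxE; ring.
  have -> : (fun z => f (Y lam z)) = (fun z => f (Y lam 0 + z *: w)) by apply/funext => z; rewrite -E.
  by apply: (cdiff_along hf); rewrite -E; exact: inball.
have Hl lam p x : p \in ps -> (forall q, q \in ps -> q != p -> modulus (lam q) < 2) ->
    modulus x < 2 -> holo (fun z => H (upd lam p z) x) 2.
  move=> pp ld x2 z z2; apply: cdiffM; last exact: cdiff_cst.
  have [w E] := chart_upd pr y0 v0 eta eta2 lam p x.
  have -> : (fun z => f (Y (upd lam p z) x)) = (fun z => f (Y (upd lam p 0) x + z *: w)).
    by apply/funext => z'; rewrite /Y -E.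
  apply: (cdiff_along hf); rewrite -E; apply: inball => // q qp.
  by rewrite /upd; case: eqP => [//|/eqP]; exact: ld.
have [coef coefP] := taylor_coefficients R.
have Hps lam : dom lam -> psum (coef (H lam)) (H lam) 1 1.
  by move=> ld; apply: coefP => [|z]; [exact: Hx | exact: H1].
have exk : forall k, exists c : nat -> C, [/\ forall m, modulus (c m) <= 1,
    forall m, ~~ smooth ps m -> c m = 0 &
    forall lam, (forall p, p \in ps -> modulus (lam p) <= (p%:R^-1) ^+ 2) -> forall N,
    modulus (coef (H lam) k - \sum_(i < N.+1) c i * chi lam ps i) <= 2 ^+ size ps / N.+1%:R].
  move=> k; apply: expansion => //.
  - move=> lam mu E; congr (coef _ k); apply/funext => x; congr (f _ * _).
    apply/rowP => i; rewrite !mxE !E ?prps ?ltn_add2l //.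
    exact: leq_trans (ltn_ord i) (leq_addr _ _).
  - by move=> lam ld; have := (Hps lam ld).1 k; rewrite expr1n mulr1.
  move=> lam p pp ld; apply: (@coef_holo R (fun z => H (upd lam p z)) (fun z => coef (H (upd lam p z)))).
    by move=> z z2; apply: Hps => q qi; rewrite /upd; case: eqP => [//|/eqP ne]; exact: ld.
  by move=> x x2; exact: Hl.
have [c cP] := choice exk.
have valE lam k : (forall p, p \in ps -> modulus (lam p) <= (p%:R^-1) ^+ 2) ->
    value (c k) (chi lam ps) = coef (H lam) k.
  move=> ld; apply: value_unique => e e0; have [_ _ /(_ lam ld) h] := cP k.
  pose N := Num.truncn (2 ^+ size ps / e); exists N => m Nm; rewrite mdC; apply: le_trans (h m) _.
  rewrite ler_pdivrMr // mulrC -ler_pdivrMr //; apply: (le_trans (ltW (truncnS_gt _))).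
  by rewrite ler_nat ltnS.
have [|k m sm|N [e [D [e2 D0 div]]]] := division (a := fun k => c k.+1) pps.
- by move=> k m; have [h _ _] := cP k.+1.
- by have [_ h _] := cP k.+1; exact: h.
have [P few] := few_zeros D N.
(* [Q] exceeds all the primes of [ps], so [e0] is at most each of the radii [p ^ (- e)]. *)
pose Q := (\sum_(p <- ps) p).+1; pose e0 : R := wt R e Q.
have e00 : 0 < e0 by exact: wt_gt0.
have e0p p : p \in ps -> e0 <= (p%:R^-1) ^+ e.
  move=> pp; apply: wt_anti; first by apply: prime_gt0; exact: (allP pps).
  by rewrite /Q (big_rem p) //= leqW // leq_addr.
exists P, (eta2 / 4), (Num.min (eta * e0) e0); split.
- by rewrite divr_gt0.
- by rewrite lt_min mulr_gt0.
move=> y v yn vn; have [lam [chE lamE]] := chart_onto y0 v0 eta2 pr_inj y v eta0.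
have le0 p : p \in ps -> modulus (lam p) <= e0.
  move=> /psP[j jn ->]; case: (ltnP j n) => h.
    have [/= -> _] := lamE (Ordinal h); rewrite ler_pdivrMr // mulrC ltW // mdC.
    by apply: lt_le_trans (yn _) _; rewrite ge_min lexx.
  have jn' : (j - n < n)%N by rewrite ltn_subLR.
  have [_ /=] := lamE (Ordinal jn'); rewrite subnKC // => ->; rewrite ltW // mdC.
  by apply: lt_le_trans (vn _) _; rewrite ge_min lexx orbT.
have lee p : p \in ps -> modulus (lam p) <= (p%:R^-1) ^+ e.
  by move=> pp; apply: le_trans (le0 p pp) _; exact: e0p.
have le2 p : p \in ps -> modulus (lam p) <= (p%:R^-1) ^+ 2.
  by move=> pp; apply: le_trans (lee p pp) _; exact: (@wt_le R 2 e p e2).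
have ld : dom lam.
  move=> p /le2 h; apply: le_lt_trans h _; apply: (@le_lt_trans _ _ 1); last by rewrite ltr1n.
  by rewrite exprn_ile1 //; have /andP[] := inv_nat01 R p.
have xe : mchar e (chi lam ps).
  split=> [i j|j]; first exact: chiM.
  exact: chi_le.
have est k : modulus (coef (H lam) k.+1) <= D * \sum_(j < N) modulus (coef (H lam) j.+1).
  have := div _ xe k; rewrite valE //; under eq_bigr do rewrite valE //.
  exact.
have Mn : (M^-1)%:C%C != 0 :> C by rewrite -md_eq0 md_real gtr0_norm ?invr_gt0 // gt_eqF ?invr_gt0.
have en : eta2%:C%C != 0 :> C by rewrite -md_eq0 md_real gtr0_norm // gt_eqF.
have fE a : f (y + a *: v) * (M^-1)%:C%C = H lam (a / eta2%:C%C).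
  by rewrite /H /Y chE [_ * (a / _)]mulrC divfK.
have mE (a : C) : modulus (a / eta2%:C%C) = modulus a / eta2.
  by rewrite mdM mdV md_real gtr0_norm.
case: (few _ _ (Hps lam ld) est) => [cst|fz].
  left=> a ad; apply: (mulIf Mn); rewrite fE cst.
    by rewrite -[X in H lam X](mul0r (eta2%:C%C^-1)) -fE scale0r addr0.
  by rewrite mE ltr_pdivrMr // mul1r; move: ad eta20; clear; lra.
right=> w zs uz zw; rewrite -(size_map (fun a => a / eta2%:C%C)).
apply: (fz (w * (M^-1)%:C%C)).
  by rewrite map_inj_uniq // => p q /mulIf; apply; rewrite invr_eq0.
move=> _ /mapP[a az ->]; have [ad fa] := zw a az; split; last by rewrite -fE fa.
by rewrite mE ler_pdivrMr // mulrC ltW // mulrA mulr1.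
Qed.

End Space.
End Local.

(** * Compactness *)

Section Uniform.
Variable R : realType.
Local Notation C := R[i].

(** A nonconstant function would have finitely many zeros in a smaller disc after
    subtraction of [g z1], by [zero_factorization], while all points close to [z1] are
    zeros. *)
Lemma identity_principle (g : C -> C) (s1 : R) (z1 : C) (d : R) : 1 < s1 -> holo g s1 ->
  modulus z1 < 1 -> 0 < d -> (forall z, modulus (z - z1) < d -> g z = g z1) ->
  forall z, modulus z < 1 -> g z = g z1.
Proof.
move=> s11 hg z11 d0 cst z0 z01; apply: contrapT => ne.
have [|B B0 gB] := @cdiff_bounded R g 1 ltr01.
  by move=> x x1; apply: hg; exact: le_lt_trans x1 s11.
pose h z := (g z - g z1) * ((2 * B)^-1)%:C%C.
have B2 : 0 < 2 * B by rewrite mulr_gt0.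
have hh : holo h 1.
  move=> z zl; apply: cdiffM; last exact: cdiff_cst.
  by apply: cdiffD; [apply: hg; exact: lt_trans zl s11 | exact: cdiff_cst].
have h1 z : modulus z < 1 -> modulus (h z) <= 1.
  move=> zl; rewrite mdM md_real gtr0_norm ?invr_gt0 // ler_pdivrMr // mul1r.
  apply: le_trans (mdB _ _) _; rewrite mulr_natl mulr2n.
  by apply: lerD; apply: gB; exact: ltW.
pose th := Num.max (modulus z0) ((1 + modulus z1) / 2).
have th01 : 0 <= th < 1.
  rewrite le_max md_ge0 /= gt_max z01 /=; move: z11; lra.
have hz0 : h z0 != 0.
  rewrite mulf_neq0 // ?subr_eq0; first exact/eqP.
  by rewrite -md_eq0 md_real gtr0_norm ?gt_eqF ?invr_gt0.
have z0th : modulus z0 <= th by rewrite le_max lexx.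
have [cs [k [_ _ csb hfac kn0]]] := zero_factorization th01 th01 hh h1 z0th hz0.
pose d' := Num.min d ((1 - modulus z1) / 2).
have d'0 : 0 < d' by rewrite lt_min d0 divr_gt0 // subr_gt0.
pose pt (j : nat) : C := z1 + (d' / j.+2%:R)%:C%C.
have ptd j : modulus (pt j - z1) < d'.
  rewrite addrC addKr md_real ger0_norm ?divr_ge0 ?(ltW d'0) //.
  by rewrite ltr_pdivrMr // ltr_pMr // ltr1n.
have pti : injective pt.
  move=> i j /addrI/(congr1 (@complex.Re R)) /= /(mulfI (lt0r_neq0 d'0)) /invr_inj /eqP.
  by rewrite eqr_nat !eqSS => /eqP.
have : (size [seq pt j | j <- iota 0 (size cs).+1] <= size cs)%N.
  apply: uniq_leq_size; first by rewrite map_inj_uniq ?iota_uniq.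
  move=> _ /mapP[j _ ->].
  have pth : modulus (pt j) <= th.
    rewrite le_max; apply/orP; right; rewrite -(subrK z1 (pt j)); apply: le_trans (mdD _ _) _.
    have := ptd j; rewrite lt_min => /andP[_]; lra.
  have pt1 : modulus (pt j) < 1 by apply: le_lt_trans pth _; case/andP: th01.
  have := hfac _ pt1; rewrite /h cst; last by apply: lt_le_trans (ptd j) _; rewrite ge_min lexx.
  rewrite subrr mul0r => /esym/eqP; rewrite mulf_eq0 (negbTE (kn0 _ pth)) orbF.
  rewrite bprod_eq0 //; last exact: ltW.
  by move=> c /csb h2; apply: le_lt_trans h2 _; case/andP: th01.
by rewrite size_map size_iota ltnn.
Qed.

Section Space.
Variable n : nat.
Implicit Types (f : 'rV[C]_n -> C) (x y v : 'rV[C]_n).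

Lemma tame_mono f (P P' : nat) (d d' : R) y v : (P <= P')%N -> d' <= d -> tame f P d y v ->
  tame f P' d' y v.
Proof.
move=> PP dd [cst|fz]; [left=> a ad; apply: cst|right=> w zs uz zw]; first exact: lt_le_trans dd.
apply: leq_trans PP; apply: (fz w) => // a /zw[ad fa]; split=> //; exact: lt_le_trans dd.
Qed.

Let m := (n + n + (n + n))%N.

Definition real_coord (p : 'rV[R]_m.+1) (j : nat) : R := p ord0 (inord j).
Definition base_of (p : 'rV[R]_m.+1) : 'rV[C]_n :=
  \row_i (real_coord p i +i* real_coord p (n + i))%C.
Definition dir_of (p : 'rV[R]_m.+1) : 'rV[C]_n :=
  \row_i (real_coord p (n + n + i) +i* real_coord p (n + n + (n + i)))%C.

Lemma coord_onto y v (t : R) : 0 <= t -> (forall i, modulus (y ord0 i) <= t) ->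
  (forall i, modulus (v ord0 i) <= t) ->
  exists p : 'rV[R]_m.+1, [/\ forall j, `|p ord0 j| <= t, base_of p = y & dir_of p = v].
Proof.
move=> t0 yt vt.
pose get (z : 'rV[C]_n) (j : nat) : C := if insub j is Some i then z ord0 i else 0.
have getE z (i : 'I_n) : get z i = z ord0 i by rewrite /get valK.
have get_le (z : 'rV[C]_n) j : (forall i, modulus (z ord0 i) <= t) -> modulus (get z j) <= t.
  by move=> zt; rewrite /get; case: insub => [i|]; rewrite ?md0.
pose q (j : nat) : R := if (j < n)%N then complex.Re (get y j)
  else if (j < n + n)%N then complex.Im (get y (j - n)%N)
  else if (j < n + n + n)%N then complex.Re (get v (j - (n + n))%N)
  else complex.Im (get v (j - (n + n + n))%N).
have q_le j : `|q j| <= t.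
  rewrite /q; do !case: ifP => _.
  - by apply: le_trans (md_Re _) _; exact: get_le.
  - by apply: le_trans (md_Im _) _; exact: get_le.
  - by apply: le_trans (md_Re _) _; exact: get_le.
  by apply: le_trans (md_Im _) _; exact: get_le.
exists (\row_j q j); split=> [j||]; first by rewrite mxE.
  apply/rowP => i; rewrite mxE /real_coord !mxE !inordK; try by rewrite /m; have := ltn_ord i; lia.
  have i1 := ltn_ord i.
  rewrite /q i1 ltnNge leq_addr /= ltn_add2l i1 addKn getE; by case: (y ord0 i).
apply/rowP => i; rewrite mxE /real_coord !mxE !inordK; try by rewrite /m; have := ltn_ord i; lia.
have i1 := ltn_ord i.
have e1 : q (n + n + i)%N = complex.Re (v ord0 i).
  rewrite /q ifF; last lia.
  rewrite ifF; last lia.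
  rewrite ifT; last lia.
  by rewrite addKn getE.
have e2 : q (n + n + (n + i))%N = complex.Im (v ord0 i).
  by rewrite /q !ifF; try lia; rewrite addnA addKn getE.
by rewrite e1 e2; case: (v ord0 i).
Qed.

(** The pairs of a base point and a direction fill a compact box in a real vector
    space. The statement to be proved for all of them gets weaker when [P] grows and
    [d] shrinks, and it holds near each of them: by [local_tameness] if the base point is in the
    ball of radius [r], and because there is no base point in the ball of radius [t] nearby
    otherwise. *)
Lemma uniform_tameness f (r t : R) : 1 <= t -> t < r -> holomorphic_on_ball r f ->
  exists (P : nat) (d : R), 0 < d /\ forall y v, enorm y < t ->
    (forall i, modulus (v ord0 i) <= 1) -> tame f P d y v.
Proof.
move=> t1 tr hf; have t0 : 0 < t by apply: lt_le_trans t1.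
have r0 : 0 < r by exact: lt_trans tr.
pose K : set 'rV[R]_m.+1 := [set p | forall j, `[- t, t]%classic (p ord0 j)].
have cK : compact K by exact: (@rV_compact R _ (fun _ => `[- t, t]%classic) (fun _ => @segment_compact R (- t) t)).
pose Pk (k : nat) (p : 'rV[R]_m.+1) : Prop :=
  enorm (base_of p) < t -> tame f k (k.+1%:R^-1) (base_of p) (dir_of p).
have loc p0 : K p0 -> exists (e : R) (k0 : nat), 0 < e /\ forall (p : 'rV[R]_m.+1) k, (k0 <= k)%N ->
    (forall j, `|p0 ord0 j - p ord0 j| < e) -> Pk k p.
  move=> _.
  have close (p : 'rV[R]_m.+1) (e : R) : (forall j, `|p0 ord0 j - p ord0 j| < e / 2) ->
      (forall i, modulus (base_of p0 ord0 i - base_of p ord0 i) < e) /\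
      (forall i, modulus (dir_of p0 ord0 i - dir_of p ord0 i) < e).
    move=> h; have two (i j : 'I_m.+1) :
        modulus ((p0 ord0 i +i* p0 ord0 j)%C - (p ord0 i +i* p ord0 j)%C) < e.
      apply: le_lt_trans (md_le _) _ => /=.
      by have := h i; have := h j; rewrite /=; lra.
    by split=> i; rewrite !mxE; exact: two.
  have [y0r|y0r] := ltP (enorm (base_of p0)) r.
    have [P [d [e [d0 e0 H]]]] := local_tameness (dir_of p0) r0 hf y0r.
    exists (e / 2), (maxn P (Num.truncn d^-1)); split; first by rewrite divr_gt0.
    move=> p k; rewrite geq_max => /andP[Pk1 dk] pe _.
    have [c1 c2] := close p e pe; apply: (tame_mono Pk1 _ (H _ _ c1 c2)).
    rewrite invf_ple ?posrE //; apply: (le_trans (ltW (truncnS_gt _))).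
    by rewrite ler_nat ltnS.
  have g0 : 0 < (r ^+ 2 - t ^+ 2) / 2.
    by rewrite divr_gt0 // subr_gt0 ltr_sqr // nnegrE ltW.
  have [e e0 H] := enorm_near (base_of p0) g0.
  exists (e / 2), 0%N; split; first by rewrite divr_gt0.
  move=> p k _ pe; rewrite /Pk enorm_lt // => yt.
  have [c1 _] := close p e pe; have := H _ c1.
  have : r ^+ 2 <= enorm (base_of p0) ^+ 2 by rewrite ler_sqr ?nnegrE ?enorm_ge0 // ltW.
  by rewrite ler_norml => h1 /andP[h2 h3]; exfalso; move: h1 h2 g0 yt; clear; lra.
have : near_covering K by exact/compact_near_coveringP.
move=> /(_ nat \oo Pk _) H.
have {H} [|k0 _ Hk] := H.
  move=> p0 Kp0; have [e [k0 [e0 He]]] := loc p0 Kp0.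
  exists (ball p0 e, [set k | (k0 <= k)%N]); first by split; [exact: nbhsx_ballx | exists k0].
  move=> [p k] /= [[_ pe] kk]; apply: He => // j; exact: pe.
exists k0, (k0.+1%:R^-1); split; first by rewrite invr_gt0.
move=> y v yt v1.
have yi i : modulus (y ord0 i) <= t.
  apply: ltW; apply: le_lt_trans yt.
  rewrite -ler_sqr ?nnegrE ?md_ge0 ?enorm_ge0 // enorm_sq (bigD1 i) //= lerDl.
  by apply: sumr_ge0 => j _; exact: sqr_ge0.
have [p [pt py pv]] := coord_onto (ltW t0) yi (fun i => le_trans (v1 i) t1).
have := Hk k0 (leqnn k0) p; rewrite /Pk py pv; apply=> //.
by move=> j; rewrite /= in_itv /= -ler_norml.
Qed.

(** The slice of the ball by a line is covered by the discs of a net whose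
    cardinality does not depend on the line. On each of them the number of preimages of a
    value is bounded by [uniform_tameness], unless [f] is constant on some disc and then,
    by the identity principle, on the slice. *)
Theorem ball_valency_finite f (r t : R) : (0 < n)%N -> holomorphic_on_ball r f ->
  1 <= t < r -> ball_valency f t \is a fin_num.
Proof.
move=> n0 hf /andP[t1 tr]; have t0 : 0 < t by apply: lt_le_trans t1.
rewrite ge0_fin_numE; last exact: ball_valency_ge0.
have [P [d [d0 tm]]] := uniform_tameness t1 tr hf.
have d3 : 0 < d / 3 by rewrite divr_gt0.
have [ns [_ nsP]] := disc_net t0 d3.
pose N := (size ns * P)%N.
apply: (@le_lt_trans _ _ (N%:R : R)%:E); last exact: ltry.
apply: ge_ereal_sup => _ [l [[x [v' [vn ->]]] ne] <-].
pose v := ((enorm v')^-1)%:C%C *: v'.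
have ev0 := enorm_gt0 vn.
have ec : (enorm v')%:C%C != 0 :> C by rewrite -md_eq0 md_real gtr0_norm // gt_eqF.
have v1 : enorm v = 1.
  by rewrite enormZ md_real gtr0_norm ?invr_gt0 // mulVf // gt_eqF.
have {ne} : span_line x v' `&` cball t !=set0 by [].
rewrite -/(span_line x v').
have -> : span_line x v' = span_line x v.
  apply/seteqP; split=> [_ [a _ <-]|_ [a _ <-]].
    exists (a * (enorm v')%:C%C) => //; rewrite scalerA -mulrA -rmorphM /= divff ?gt_eqF //.
    by rewrite mulr1.
  by exists (a * ((enorm v')^-1)%:C%C) => //; rewrite scalerA.
clear vn ev0 ec; move=> [z1 [[a1 _ z1E] z1t]].
have vn := enorm_unit_neq0 v1.
have [|a0 [T [T0 Tt inT _ hG]]] := line_disc t1 tr hf v1 (x := x).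
  by exists a1; move: z1t; rewrite -z1E.
have Tn : T%:C%C != 0 :> C by rewrite -md_eq0 md_real gtr0_norm // gt_eqF.
pose G z := f (x + (T%:C%C * z + a0) *: v).
have {}hG : holo G (r / t) by exact: hG.
have s1 : 1 < r / t by rewrite ltr_pdivlMr // mul1r.
have Ga a : G ((a - a0) / T%:C%C) = f (x + a *: v).
  by rewrite /G mulrC divfK // subrK.
have mT a : modulus ((a - a0) / T%:C%C) = modulus (a - a0) / T.
  by rewrite mdM mdV md_real gtr0_norm.
have vi i : modulus (v ord0 i) <= 1.
  rewrite -v1 -ler_sqr ?nnegrE ?md_ge0 ?enorm_ge0 // enorm_sq (bigD1 i) //= lerDl.
  by apply: sumr_ge0 => j _; exact: sqr_ge0.
have sh a b : x + a *: v + (b - a) *: v = x + b *: v.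
  by rewrite -addrA -scalerDl [a + _]addrC subrK.
have [[a2 [a2T cst]]|ncst] := pselect (exists a2, modulus (a2 - a0) < T /\
    forall a, modulus a < d -> f (x + a2 *: v + a *: v) = f (x + a2 *: v)).
  apply: (@le_trans _ _ 0%:E); last by rewrite lee_fin.
  apply: ereal_inf_lbound; exists 0%N => //; right; split=> //.
  exists (f (x + a2 *: v)) => _ [[a _ <-]]; rewrite /cball /= inT => aT.
  rewrite -!Ga; have dT : 0 < d / T by rewrite divr_gt0.
  apply: (identity_principle s1 hG _ dT).
  - by rewrite mT ltr_pdivrMr // mul1r.
  - move=> z; rewrite Ga => zd.
    have zE : z = (T%:C%C * z + a0 - a0) / T%:C%C by rewrite addrK mulrC mulKf.
    rewrite zE Ga -(sh a2); apply: cst.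
    move: zd; rewrite ltr_pdivlMr // => zd.
    have -> : T%:C%C * z + a0 - a2 = (z - (a2 - a0) / T%:C%C) * T%:C%C.
      by rewrite mulrBl divfK // [z * _]mulrC; ring.
    by rewrite mdM md_real gtr0_norm.
  by rewrite mT ltr_pdivrMr // mul1r.
apply: ereal_inf_lbound; exists N => //; left=> w.
apply: card_le_of_seqs => zs uz zw.
pose co z : C := xget 0 [set a | x + a *: v = z].
have coE z : z \in zs -> x + co z *: v = z.
  by move=> /zw[[[a _ az] _] _]; exact: (xgetI 0 (az : [set a | x + a *: v = z] a)).
have uco : uniq [seq co z | z <- zs].
  rewrite map_inj_in_uniq // => z z' zi z'i e; by rewrite -(coE z zi) -(coE z' z'i) e.
rewrite -(size_map co).
have asP a : a \in [seq co z | z <- zs] -> modulus (a - a0) < T /\ f (x + a *: v) = w.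
  move=> /mapP[z zi ->]; have [[_ zt] fz] := zw z zi.
  by rewrite -inT coE.
move: [seq co z | z <- zs] uco asP => {zs uz zw co coE} zs uz zw.
have netE : forall z : C, exists u, modulus z <= t -> u \in ns /\ modulus (z - u) <= d / 3.
  move=> z; have [/nsP[u un zu]|_] := boolP (modulus z <= t); first by exists u.
  by exists 0.
have [net netP] := choice netE.
have zt a : a \in zs -> modulus (a - a0) <= t.
  by move=> /zw[aT _]; apply: ltW; apply: lt_le_trans aT _.
(* The points are grouped by the net point close to them; a nonempty group lies in the disc
   of radius [d] about any of its elements. *)
apply: (@size_by_values _ _ (fun a => net (a - a0)) P ns) => [a az|u].
  by have [] := netP _ (zt a az).
set s := [seq a <- zs | _ == u].
have sP a : a \in s -> net (a - a0) = u /\ a \in zs by rewrite mem_filter => /andP[/eqP].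
have us : uniq s by exact: filter_uniq.
case sE : s => [//|b s']; rewrite -sE.
have bs : b \in s by rewrite sE mem_head.
have [bu bz] := sP b bs; have [bT fb] := zw b bz.
have ybt : enorm (x + b *: v) < t by rewrite inT.
case: (tm (x + b *: v) v ybt vi) => [cst|fz].
  by case: ncst; exists b.
rewrite -(size_map (fun a => a - b)); apply: (fz w).
  by rewrite map_inj_uniq // => p q /addIr.
move=> _ /mapP[a as1 ->]; have [au az] := sP a as1; have [aT fa] := zw a az.
rewrite sh fa; split=> //.
have [_ h1] := netP _ (zt a az); have [_ h2] := netP _ (zt b bz).
have -> : a - b = (a - a0 - u) - (b - a0 - u) by ring.
apply: le_lt_trans (mdB _ _) _; rewrite -{1}au -bu.
by move: h1 h2 d0; lra.
Qed.

End Space.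
End Uniform.

Unset Implicit Arguments.
Set Strict Implicit.
Set Printing Implicit Defensive.

Theorem proposition1p7 (R : realType) (r : R) (hr : 1 < r) :
  (forall (n : nat) (f : 'rV[R[i]]_n -> R[i]), (0 < n)%N ->
     holomorphic_on_ball r f ->
     forall t : R, 1 <= t < r -> ball_valency f t \is a fin_num) /\
  (exists c : R, 0 < c /\
     forall (n : nat) (f : 'rV[R[i]]_n -> R[i]), (0 < n)%N ->
       holomorphic_on_ball r f ->
       (chebyshev_degree f <= c%:E * ball_valency f ((1 + r) / 2))%E).
Proof.
split=> [n f n0 hf t ht|]; last exact: chebyshev_part.
exact: ball_valency_finite n0 hf ht.
Qed.
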